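(* Let $k\ge 2$ be an integer and let $\lambda_1\ge \dots\ge \lambda_k>0$ be fixed real numbers. Set $\Lambda=\lambda_1+\dots+\lambda_k$ and $\lambda_i^*=\Lambda-\lambda_i$. For each $n$, let $G=G_1\cup\dots\cup G_k$ be the randomly edge-colored graph on $[n]$ described in the context, let $\widetilde{\mathcal C}(u)$ be the CA-component of $u$, and let $N_\ell$ be the number of CA-components of size $\ell$. Let $a_1\in[0,1)$ be the limit in probability of $\frac1n\max_{u\in[n]}|\widetilde{\mathcal C}(u)|$ as $n\to\infty$. Then there exists a sequence of non-negative real numbers $(\nu_\ell)_{\ell\ge1}$ such that $\sum_{\ell\ge1}\nu_\ell=1-a_1$ and, for each $\ell\ge1$, $$\frac{|\{u\in[n]:|\widetilde{\mathcal C}(u)|=\ell\}|}{n}=\frac{\ell\cdot N_\ell}{n}\xrightarrow[n\to\infty]{\mathbb P}\nu_\ell.$$ Moreover, $\nu_\ell>0$ for all $\ell\ge1$ if and only if $\lambda_k^*>1$, while if $\lambda_k^*\le1$, then $\nu_1=1$.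
   Context: $[m]=\{1,\dots,m\}$. $G(n,p)$ is the Erdős–Rényi random graph on vertex set $[n]$ in which each edge is present independently with probability $p$. For each $n$, $G_1,\dots,G_k$ are independent random graphs on the same vertex set $[n]$, with $G_i$ distributed as $G(n,\lambda_i/n)$; the edges of $G_i$ are said to have color $i$. $G=G_1\cup\dots\cup G_k$, and for $i\in[k]$, $G^i=\bigcup_{j\in[k]\setminus\{i\}}G_j$. Two vertices $u,v\in[n]$ are CA-connected if they are connected in each of the graphs $G^1,\dots,G^k$. This is an equivalence relation on $[n]$, whose classes are the CA-components; $\widetilde{\mathcal C}(u)$ is the class of $u$ and $|\widetilde{\mathcal C}(u)|$ is its number of vertices. The limit $a_1$ exists as a deterministic constant in $[0,1)$ for all choices of the parameters. $\xrightarrow{\mathbb P}$ denotes convergence in probability. *)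

(* Defs.v *)
From HB Require Import structures.
From mathcomp Require Import all_boot all_order all_algebra.
From mathcomp Require Import all_classical all_reals all_analysis.

Set Implicit Arguments.
Unset Strict Implicit.
Unset Printing Implicit Defensive.

Import Order.TTheory GRing.Theory Num.Theory.
Import numFieldNormedType.Exports.

Local Open Scope ring_scope.

Notation edge n := {e : {set 'I_n} | #|e| == 2%N}.

(* A simple graph on 'I_n is given by its edge set. *)
Notation sgraph n := {set edge n}.

(* [set u; u] has one element, so that this relation is irreflexive. *)
Definition adj (n : nat) (E : sgraph n) : rel 'I_n :=
  fun u v => [exists e, (e \in E) && (val e == [set u; v]%SET)].

Definition without_color (n k : nat) (g : 'I_k -> sgraph n) (i : 'I_k) :
    sgraph n :=
  (\bigcup_(j | j != i) g j)%SET.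

Definition ca_connected (n k : nat) (g : 'I_k -> sgraph n) : rel 'I_n :=
  fun u v => [forall i, connect (adj (without_color g i)) u v].

Definition ca_component (n k : nat) (g : 'I_k -> sgraph n) (u : 'I_n) :
    {set 'I_n} :=
  [set v | ca_connected g u v]%SET.

Definition ca_components (n k : nat) (g : 'I_k -> sgraph n) :
    {set {set 'I_n}} :=
  [set ca_component g u | u : 'I_n]%SET.

Definition num_ca_components (n k : nat) (g : 'I_k -> sgraph n) (l : nat) :
    nat :=
  #|[set C in ca_components g | #|C| == l]%SET|.

Definition num_vertices_ca (n k : nat) (g : 'I_k -> sgraph n) (l : nat) : nat :=
  #|[set u : 'I_n | #|ca_component g u| == l]%SET|.

Definition max_ca_component (n k : nat) (g : 'I_k -> sgraph n) : nat :=
  (\max_(u < n) #|ca_component g u|)%N.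

Definition gnp_pmf (R : realType) (n : nat) (p : R) (E : sgraph n) : R :=
  \prod_(e : edge n) (if e \in E then p else 1 - p).

Definition is_gnp (R : realType) (d : measure_display) (T : measurableType d)
    (P : probability T R) (n : nat) (p : R) (G : T -> sgraph n) : Prop :=
  forall E : sgraph n,
    measurable [set w | G w = E]%classic /\
    P [set w | G w = E]%classic = (gnp_pmf p E)%:E.

(* For random variables with values in a finite type F, the product rule for
   point events over the whole family is equivalent to mutual independence. *)
Definition independent_rvs (R : realType) (d : measure_display)
    (T : measurableType d) (P : probability T R) (I F : finType)
    (X : I -> T -> F) : Prop :=
  forall x : I -> F,
    P [set w | forall i, X i w = x i]%classic =
    (\prod_(i : I) P [set w | X i w = x i]%classic)%E.

(* The minimum only matters for the finitely many n < lambda i, for which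
   lambda i / n is not a probability. *)
Definition is_colored_random_graph (R : realType) (d : measure_display)
    (T : measurableType d) (P : probability T R) (n k : nat)
    (lambda : 'I_k -> R) (G : 'I_k -> T -> sgraph n) : Prop :=
  (forall i, is_gnp P (Num.min 1 (lambda i / n%:R)) (G i)) /\
  independent_rvs P G.

(* The n-th variable may live on its own probability space: the limit is a
   constant. *)
Definition cvg_in_probability (R : realType) (d : nat -> measure_display)
    (T : forall n, measurableType (d n)) (P : forall n, probability (T n) R)
    (X : forall n, T n -> R) (c : R) : Prop :=
  forall eps : R, 0 < eps ->
    ((fun n => P n [set w | eps < `|X n w - c|]%classic) @ \oo --> 0%E)%classic.

Lemma last_color_subproof (k : nat) : (2 <= k)%N -> (k.-1 < k)%N.
Proof. by case: k. Qed.

Definition last_color (k : nat) (hk : (2 <= k)%N) : 'I_k :=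
  Ordinal (last_color_subproof hk).

Definition lambda_star (R : realType) (k : nat) (lambda : 'I_k -> R)
    (i : 'I_k) : R :=
  \sum_(j < k) lambda j - lambda i.

(* Main.v *)
Require Import Defs.
From HB Require Import structures.
From mathcomp Require Import all_boot all_order all_algebra.
From mathcomp Require Import all_classical all_reals all_analysis.
From mathcomp Require Import ring lra zify.
Set Implicit Arguments.
Unset Strict Implicit.
Unset Printing Implicit Defensive.

Import Order.TTheory GRing.Theory Num.Theory.
Import numFieldNormedType.Exports.

Local Open Scope ring_scope.

(** Mark each edge with the set of its colors. The marks are independent with
    one common law, under which the mark [[set j]] has probability about
    [lambda j / n] and several colors on one edge are negligible; every
    statement below is about expectations of functions of the marks. For a
    color [i], deleting the edges whose only color is [i] leaves a graph
    G(n, p) with [n * p] tending to the [i]th rate, the sum of the other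
    [lambda j] ([pexp_without]). Two vertices are equivalent when they lie in
    the same component for every [i].

    Local limits. The ball around a vertex is explored exactly: the probability
    that it has a given isomorphism type is a product, which converges, to zero
    unless the ball is a tree. As the mean size of a ball is bounded, the
    proportion of vertices with a property that is decided in a ball of fixed
    radius has a converging mean ([local_average_cvg]). By the Efron-Stein
    inequality ([variance_le]) it is concentrated ([concentration]).

    Uniqueness of the large component. The size of a class is not a local
    quantity, since equivalence in a large component is not. It becomes one up
    to a small error once almost all pairs of vertices in components of more
    than [K] vertices are connected ([few_split_pairs]). Each time an edge joins
    two such components, the sum over the vertices of the reciprocals of the
    component sizes, truncated at [1 / (K + 1)], drops by one
    ([sum_inv_size_add]), while it never exceeds [n / (K + 1)]. Raising the edge
    density from [(b - h) / n] to [b / n] would thus make too many joins if many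
    pairs of vertices in large components at the lower density were still
    unconnected at the higher one; and few vertices enter large components
    meanwhile, as the limiting density of the vertices in components of size at
    most [K] is left continuous in [b], uniformly in large [K]
    ([small_mass_left_continuous]).

    The densities. A class is therefore described, up to a few vertices, by
    replacing each component of more than [K] vertices by a single symbol
    ([local_approximation]), so that the proportion of vertices in classes of
    size [l] converges in mean to some [nu l] ([class_density_cvg]). Vertices in
    large classes are almost all equivalent to each other, so that the mass
    missing from the [nu l] is that of the largest class ([class_density_sum]).

    The dichotomy. If all rates are at most one, almost every vertex has only
    small components; its neighborhood is a tree with one color on each edge, in
    which deleting the first color of a path separates its ends: almost all
    classes are singletons ([subcritical_density]). The rate of the last color
    being the largest, the remaining case is that deleting the last color leaves
    a component of linear size. Then a path of [l] isolated vertices in the last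
    color, with each vertex hung onto that component by an edge of another
    color, is a class of size [l] ([insert_class]). There are order [n ^ (2 * l)]
    places to insert such a path and its [2 * l - 1] edges cost a factor of order
    [n ^ - (2 * l - 1)], so that the expected number of these classes is of order
    [n] ([insertion_bound], [density_gt0]). *)

(** * Finite product measures *)

(** Locked, lest a conversion test between two updates enumerate [I]. *)
HB.lock Definition upd (I V : finType) (c : {ffun I -> V}) (i : I) (v : V) :
    {ffun I -> V} :=
  [ffun j => if j == i then v else c j].

Section ProductMeasure.
Context {R : realType} {I V : finType}.
Implicit Types (w : I -> V -> R) (c : {ffun I -> V}) (f g : {ffun I -> V} -> R).

Definition weight w c : R := \prod_i w i (c i).

Definition pexp w f : R := \sum_c weight w c * f c.

Definition is_law w := forall i, (forall v, 0 <= w i v) /\ \sum_v w i v = 1.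

Definition is_law1 (wv : V -> R) := (forall v, 0 <= wv v) /\ \sum_v wv v = 1.

Lemma updE c i v j : upd c i v j = if j == i then v else c j.
Proof. by rewrite upd.unlock ffunE. Qed.

Lemma upd_id c i : upd c i (c i) = c.
Proof. by apply/ffunP=> j; rewrite updE; case: eqP => // ->. Qed.

Lemma upd_upd c i v v' : upd (upd c i v) i v' = upd c i v'.
Proof. by apply/ffunP=> j; rewrite !updE; case: eqP. Qed.

Lemma updC c i j v v' : i != j ->
  upd (upd c i v) j v' = upd (upd c j v') i v.
Proof.
move=> ij; apply/ffunP=> k; rewrite !updE.
by case: (eqVneq k j) => // ->; rewrite eq_sym (negPf ij).
Qed.

Lemma weight_ge0 w c : is_law w -> 0 <= weight w c.
Proof. by move=> lw; apply: prodr_ge0 => i _; case: (lw i). Qed.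

Lemma eq_pexp w f g : f =1 g -> pexp w f = pexp w g.
Proof. by move=> fg; apply: eq_bigr => c _; rewrite fg. Qed.

Lemma pexpD w f g : pexp w (fun c => f c + g c) = pexp w f + pexp w g.
Proof. by rewrite /pexp -big_split; apply: eq_bigr => c _; rewrite mulrDr. Qed.

Lemma pexp0 w : pexp w (fun=> 0) = 0.
Proof. by rewrite /pexp big1 // => c _; rewrite mulr0. Qed.

Lemma pexpZ w a f : pexp w (fun c => a * f c) = a * pexp w f.
Proof. by rewrite /pexp mulr_sumr; apply: eq_bigr => c _; rewrite mulrCA. Qed.

Lemma pexpN w f : pexp w (fun c => - f c) = - pexp w f.
Proof. by rewrite /pexp -sumrN; apply: eq_bigr => c _; rewrite mulrN. Qed.

Lemma pexpB w f g : pexp w (fun c => f c - g c) = pexp w f - pexp w g.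
Proof. by rewrite pexpD pexpN. Qed.

Lemma pexp_sum (J : Type) (s : seq J) (P : pred J) w (F : J -> {ffun I -> V} -> R) :
  pexp w (fun c => \sum_(j <- s | P j) F j c) = \sum_(j <- s | P j) pexp w (F j).
Proof.
rewrite /pexp exchange_big /=; apply: eq_bigr => c _.
by rewrite mulr_sumr.
Qed.

Lemma ler_pexp w f g : is_law w -> (forall c, f c <= g c) -> pexp w f <= pexp w g.
Proof.
move=> lw fg; apply: ler_sum => c _.
by apply: ler_wpM2l => //; exact: weight_ge0.
Qed.

Lemma pexp_ge0 w f : is_law w -> (forall c, 0 <= f c) -> 0 <= pexp w f.
Proof.
by move=> lw f0; apply: sumr_ge0 => c _; rewrite mulr_ge0 ?weight_ge0.
Qed.

(** Independence of the coordinates, in the only form that is computed with. *)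
Lemma pexp_prod w (h : I -> V -> R) :
  pexp w (fun c => \prod_i h i (c i)) = \prod_i \sum_v w i v * h i v.
Proof.
rewrite (bigA_distr_bigA (fun i v => w i v * h i v)) /=.
by apply: eq_bigr => c _; rewrite -big_split.
Qed.

Lemma pexp_cst w a : is_law w -> pexp w (fun=> a) = a.
Proof.
move=> lw; rewrite (_ : (fun=> a) = fun c : {ffun I -> V} => a * 1); last first.
  by apply/funext => c; rewrite mulr1.
rewrite pexpZ -[RHS]mulr1; congr (_ * _).
have := pexp_prod w (fun _ _ => 1).
rewrite (_ : (fun c : {ffun I -> V} => \prod_(i : I) (1:R)) = fun=> 1); last first.
  by apply/funext => c; rewrite big1.
move=> ->; apply: big1 => i _.
by under eq_bigr do rewrite mulr1; case: (lw i).
Qed.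

Lemma ler_norm_pexp w f : is_law w -> `|pexp w f| <= pexp w (fun c => `|f c|).
Proof.
move=> lw; apply: le_trans (ler_norm_sum _ _ _) _.
by apply: ler_sum => c _; rewrite normrM (ger0_norm (weight_ge0 c lw)).
Qed.

Lemma weight_bigD1 w c i :
  weight w c = w i (c i) * \prod_(j | j != i) w j (c j).
Proof. by rewrite /weight (bigD1 i). Qed.

(** Exchanging the sampled value of a coordinate with a fresh one is an
    involution of the pairs (configuration, fresh value). *)
Lemma pexp_resample w w' i f : is_law w -> (forall j, j != i -> w' j =1 w j) ->
  pexp w' f = pexp w (fun c => \sum_v w' i v * f (upd c i v)).
Proof.
move=> lw ww'.
rewrite {2}/pexp; under eq_bigr do rewrite mulr_sumr.
rewrite pair_bigA /=.
pose s (p : {ffun I -> V} * V) := (upd p.1 i p.2, p.1 i).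
have sK : involutive s.
  by case=> c v; rewrite /s /= upd_upd upd_id !updE eqxx.
rewrite (reindex_inj (inv_inj sK)) /=.
rewrite -(pair_bigA _ (fun c v => weight w (upd c i v) *
   (w' i (c i) * f (upd (upd c i v) i (c i))))) /=.
apply: eq_bigr => c _.
rewrite (weight_bigD1 _ c i) /=.
under [RHS]eq_bigr => v _.
  rewrite upd_upd upd_id (weight_bigD1 _ _ i) updE eqxx.
  under eq_bigr => j ji do rewrite updE (negPf ji) -(ww' _ ji).
  over.
rewrite /= -[LHS]mul1r -(proj2 (lw i)) mulr_suml.
by apply: eq_bigr => v _; rewrite /=; ring.
Qed.

(** The tower rule for conditioning on all coordinates but [i]. *)
Lemma pexp_upd w i f : is_law w ->
  pexp w f = pexp w (fun c => \sum_v w i v * f (upd c i v)).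
Proof. by move=> lw; apply: pexp_resample. Qed.

Lemma pexp_indep w i (h : V -> R) f : is_law w ->
  (forall c v, f (upd c i v) = f c) ->
  pexp w (fun c => h (c i) * f c) = (\sum_v w i v * h v) * pexp w f.
Proof.
move=> lw fi; rewrite (pexp_upd i) // -pexpZ.
apply: eq_pexp => c; rewrite mulr_suml; apply: eq_bigr => v _.
by rewrite fi updE eqxx mulrA.
Qed.

(** The coordinates outside the range of [iota] integrate to one. *)
Lemma pexp_prod_inj (J : finType) (iota : J -> I) w (h : J -> V -> R) :
  is_law w -> injective iota ->
  pexp w (fun c => \prod_j h j (c (iota j))) =
  \prod_j \sum_v w (iota j) v * h j v.
Proof.
move=> lw inj.
pose h' i v := if [pick j | iota j == i] is Some j then h j v else 1.
have h'E j v : h' (iota j) v = h j v.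
  rewrite /h'; case: pickP => [j' /eqP/inj -> //|/(_ j)]; by rewrite eqxx.
have prodE (F : I -> R) : (forall i, i \notin codom iota -> F i = 1) ->
    \prod_i F i = \prod_j F (iota j).
  move=> F1; rewrite (bigID (mem (codom iota))) /= [X in _ * X]big1 ?mulr1 //.
  rewrite -big_filter (perm_big (codom iota)) ?big_map ?big_enum //.
  apply: uniq_perm; rewrite ?filter_uniq ?index_enum_uniq ?(map_inj_uniq inj) ?enum_uniq //.
  by move=> i; rewrite mem_filter mem_index_enum andbT.
have h'1 i v : i \notin codom iota -> h' i v = 1.
  move=> ni; rewrite /h'; case: pickP => // j /eqP ji.
  by rewrite -ji codom_f in ni.
transitivity (pexp w (fun c => \prod_i h' i (c i))).
  apply: eq_pexp => c; rewrite prodE; first by apply: eq_bigr => j _; rewrite h'E.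
  by move=> i /h'1 ->.
rewrite pexp_prod prodE; first by apply: eq_bigr => j _; under eq_bigr do rewrite h'E.
move=> i /h'1 h1; under eq_bigr do rewrite h1 mulr1.
by case: (lw i).
Qed.

(** The variance is nonnegative. *)
Lemma sqr_pexp_le w f : is_law w -> pexp w f ^+ 2 <= pexp w (fun c => f c ^+ 2).
Proof.
move=> lw; rewrite -subr_ge0.
have -> : pexp w (fun c => f c ^+ 2) - pexp w f ^+ 2 =
    pexp w (fun c => (f c - pexp w f) ^+ 2).
  set m := pexp w f.
  transitivity (pexp w (fun c => f c ^+ 2 - (m *+ 2) * f c + m ^+ 2)).
    by rewrite pexpD pexpB pexpZ pexp_cst // -/m; ring.
  by apply: eq_pexp => c; ring.
by apply: pexp_ge0 => // c; exact: sqr_ge0.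
Qed.

End ProductMeasure.

(** The image of a product measure under a map acting coordinatewise is the
    product of the image measures. *)
Lemma pexp_push (R : realType) (I V V' : finType) (O : V -> V') (w : I -> V -> R)
    (f : {ffun I -> V'} -> R) :
  pexp w (fun c => f [ffun i => O (c i)]) =
  pexp (fun i v' => \sum_(v | O v == v') w i v) f.
Proof.
rewrite /pexp (partition_big (fun c : {ffun I -> V} => [ffun i => O (c i)]) predT) //=.
apply: eq_bigr => c' _.
rewrite /weight bigA_distr_big_dep /= mulr_suml.
apply: eq_big => [c|c /eqP -> //].
apply/eqP/familyP => [<- i|H]; first by rewrite unfold_in ffunE.
by apply/ffunP=> i; rewrite ffunE; apply/eqP; have := H i; rewrite unfold_in.
Qed.

Section Averaging.
Context {R : realType} {I V : finType}.
Variables (w : I -> V -> R) (v0 : V).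
Hypothesis lw : is_law w.

Definition avg i (f : {ffun I -> V} -> R) (c : {ffun I -> V}) :=
  \sum_v w i v * f (upd c i v).

(** Comparing with the value [v0] only, and not between any two values, makes
    the variance proportional to the probability of the other values. *)
Definition bounded_influence (L : R) (f : {ffun I -> V} -> R) :=
  forall c i v, `|f (upd c i v) - f (upd c i v0)| <= L.

Lemma avg_bounded_influence i L f : 0 <= L -> bounded_influence L f -> bounded_influence L (avg i f).
Proof.
move=> L0 fL c j v; case: (eqVneq i j) => [<-|ij].
  by rewrite /avg; under eq_bigr do rewrite upd_upd;
     under [X in _ - X]eq_bigr do rewrite upd_upd; rewrite subrr normr0.
rewrite /avg -sumrB.
apply: le_trans (ler_norm_sum _ _ _) _.
rewrite -[leRHS]mul1r -(proj2 (lw i)) mulr_suml; apply: ler_sum => u _.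
rewrite -mulrBr normrM (ger0_norm (proj1 (lw i) u)).
apply: ler_wpM2l; first exact: (proj1 (lw i)).
by rewrite !(@updC _ _ _ j i) // 1?eq_sym.
Qed.

(** The conditional variance in the coordinate [i] is at most the conditional
    mean square distance from the value at [v0], which is nonzero only with
    probability [q]. *)
Lemma avg_var q i L f : \sum_(v | v != v0) w i v <= q -> bounded_influence L f ->
  pexp w (fun c => f c ^+ 2) - pexp w (fun c => avg i f c ^+ 2) <= q * L ^+ 2.
Proof.
move=> qi fL; rewrite (pexp_upd i) // -pexpB.
rewrite -[leRHS](pexp_cst _ lw); apply: ler_pexp => // c.
set a := f (upd c i v0).
have sw := proj2 (lw i).
have -> : \sum_v w i v * f (upd c i v) ^+ 2 - avg i f c ^+ 2 =
   \sum_v w i v * (f (upd c i v) - a) ^+ 2 - (avg i f c - a) ^+ 2.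
  transitivity (\sum_v (w i v * f (upd c i v) ^+ 2 - (a *+ 2) * (w i v * f (upd c i v)) + w i v * a ^+ 2) -  (avg i f c - a) ^+ 2).
    rewrite big_split sumrB /= -mulr_sumr -mulr_suml sw -/(avg i f c); ring.
  by congr (_ - _); apply: eq_bigr => v _; ring.
apply: (@le_trans _ _ (\sum_v w i v * (f (upd c i v) - a) ^+ 2)).
  by rewrite lerBlDr lerDl sqr_ge0.
rewrite (bigD1 v0) //= subrr expr0n mulr0 add0r.
apply: (@le_trans _ _ (\sum_(v | v != v0) w i v * L ^+ 2)).
  apply: ler_sum => v _; apply: ler_wpM2l; first exact: (proj1 (lw i)).
  by rewrite -real_normK ?num_real // lerXn2r ?nnegrE //; apply: le_trans (fL c i v).
by rewrite -mulr_suml; apply: ler_wpM2r => //; exact: sqr_ge0.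
Qed.

Lemma avg_upd i f c v : avg i f (upd c i v) = avg i f c.
Proof. by rewrite /avg; apply: eq_bigr => u _; rewrite upd_upd. Qed.

Lemma avg_keep i j f : (forall c v, f (upd c j v) = f c) ->
  forall c v, avg i f (upd c j v) = avg i f c.
Proof.
move=> fj c v; case: (eqVneq i j) => [->|ij]; first exact: avg_upd.
by rewrite /avg; apply: eq_bigr => u _; rewrite updC 1?eq_sym ?fj.
Qed.

Definition avgs s f := foldr avg f s.

Lemma avgs_upd s f j c v : j \in s -> avgs s f (upd c j v) = avgs s f c.
Proof.
elim: s c v => //= i s IH c v; rewrite inE.
case: (eqVneq j i) => [-> _|_ /= js]; first exact: avg_upd.
by apply: avg_keep => c' v'; exact: IH.
Qed.

Lemma pexp_avgs s f : pexp w (avgs s f) = pexp w f.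
Proof. by elim: s => //= i s IH; rewrite -[RHS]IH [RHS](pexp_upd i). Qed.

Lemma avgs_const f c : avgs (enum I) f c = pexp w f.
Proof.
have E c' : avgs (enum I) f c' = avgs (enum I) f c.
  pose g := avgs (enum I) f.
  have H (s : seq I) : g [ffun i => if i \in s then c i else c' i] = g c'.
    elim: s => [|i s IH]; first by congr g; apply/ffunP => i; rewrite ffunE.
    rewrite -{}IH; rewrite -[RHS](@avgs_upd (enum I) f i _ (c i)) ?mem_enum //.
    congr g; apply/ffunP => j; rewrite !(updE, ffunE) inE.
    by case: (eqVneq j i) => [->|].
  rewrite -/(g c') -(H (enum I)); congr g.
  by apply/ffunP => i; rewrite ffunE mem_enum.
rewrite -(pexp_avgs (enum I)) -[LHS](pexp_cst _ lw).
by apply: eq_pexp => c'; rewrite E.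
Qed.

(** Efron-Stein: averaging the coordinates out one at a time costs at most
    the conditional variance in that coordinate. *)
Lemma variance_le q L f : 0 <= L -> (forall i, \sum_(v | v != v0) w i v <= q) ->
  bounded_influence L f ->
  pexp w (fun c => (f c - pexp w f) ^+ 2) <= #|I|%:R * (q * L ^+ 2).
Proof.
move=> L0 qi fL.
have -> : pexp w (fun c => (f c - pexp w f) ^+ 2) =
    pexp w (fun c => f c ^+ 2) - pexp w f ^+ 2.
  set m := pexp w f.
  transitivity (pexp w (fun c => f c ^+ 2 - (m *+ 2) * f c + m ^+ 2)).
    by apply: eq_pexp => c; ring.
  by rewrite pexpD pexpB pexpZ pexp_cst // -/m; ring.
have -> : pexp w f ^+ 2 = pexp w (fun c => avgs (enum I) f c ^+ 2).
  rewrite -[LHS](pexp_cst _ lw); apply: eq_pexp => c; by rewrite avgs_const.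
(* Telescoping over the coordinates that have been averaged out. *)
rewrite cardE; elim: (enum I) => [|i s IH] /=.
  by rewrite subrr mul0r.
have lip : bounded_influence L (avgs s f).
  by elim: (s) => //= j t; exact: avg_bounded_influence.
have := lerD IH (avg_var (qi i) lip).
rewrite addrA subrK => /le_trans; apply.
by rewrite -natr1 mulrDl mul1r.
Qed.

End Averaging.

(** * Balls and components *)

Section Balls.
Context {T : finType}.
Implicit Types (e : rel T) (u v x y : T) (r : nat).

Definition gball e u r : {set T} :=
  iter r (fun B : {set T} => [set v | (v \in B) || [exists x in B, e x v]])%SET [set u]%SET.

Definition gcomp e u : {set T} := [set v | connect e u v]%SET.

Lemma gball0 e u : gball e u 0 = [set u]%SET. Proof. by []. Qed.

Lemma in_ballS e u r v :
  (v \in gball e u r.+1) = (v \in gball e u r) || [exists x in gball e u r, e x v].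
Proof. by rewrite inE. Qed.

Lemma gball_sub e u r s : (r <= s)%N -> gball e u r \subset gball e u s.
Proof.
move=> /subnK <-; elim: (s - r)%N => // m; rewrite addSn => /fintype.subset_trans; apply.
by apply/fintype.subsetP=> v vB; rewrite in_ballS vB.
Qed.

Lemma gball_center e u r : u \in gball e u r.
Proof. by apply: (fintype.subsetP (gball_sub e u (leq0n r))); rewrite inE. Qed.

Lemma gball_step e u r x y : x \in gball e u r -> e x y -> y \in gball e u r.+1.
Proof. by move=> xB exy; rewrite in_ballS; apply/orP; right; apply/existsP; exists x; rewrite xB. Qed.

Lemma gball_path e u p : path e u p -> last u p \in gball e u (size p).
Proof.
elim/last_ind: p => [|p y IH]; first by rewrite /= inE.
rewrite rcons_path last_rcons size_rcons => /andP[/IH pB]; exact: gball_step.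
Qed.

(** Removing the loops of a path only shortens it. *)
Lemma gball_uniq_path e u r v : v \in gball e u r ->
  exists p, [/\ path e u p, last u p = v, uniq (u :: p) & (size p <= r)%N].
Proof.
move=> vB.
have {vB} [p [ep <- pr]] : exists p, [/\ path e u p, last u p = v & (size p <= r)%N].
  elim: r v vB => [|r IH] v; first by rewrite gball0 inE => /eqP ->; exists [::].
  rewrite in_ballS => /orP[/IH [p [ep pv pr]]|/existsP[x /andP[/IH [p [ep pv pr]] exv]]].
    by exists p; split => //; exact: leqW.
  by exists (rcons p v); rewrite rcons_path last_rcons size_rcons ep pv.
case/shortenP: ep => p' ep' up' sub; exists p'; split => //.
by apply: leq_trans pr; apply: uniq_leq_size sub; case/andP: up'.
Qed.

Lemma gball_sub_gcomp e u r : gball e u r \subset gcomp e u.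
Proof.
apply/fintype.subsetP=> v /gball_uniq_path [p [ep <- _ _]].
by rewrite inE; apply/connectP; exists p.
Qed.

Lemma gcomp_sub_ball e u r : (#|gcomp e u| <= r.+1)%N -> gcomp e u = gball e u r.
Proof.
move=> Kr; apply/eqP; rewrite finset.eqEsubset gball_sub_gcomp andbT.
apply/fintype.subsetP=> v; rewrite inE => /connectP[p ep ->].
case/shortenP: ep => p' ep' up' _.
apply: (fintype.subsetP (gball_sub e u _)); last exact: gball_path ep'.
rewrite -ltnS; apply: leq_trans Kr.
rewrite -[(size p').+1]/(size (u :: p')) -(card_uniqP up').
apply: subset_leq_card; apply/fintype.subsetP => x xp; rewrite inE.
by apply/connectP; case/splitPl: xp ep' => p1 p2 <-; rewrite cat_path => /andP[]; exists p1.
Qed.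

Lemma gcomp_closed e u x y : x \in gcomp e u -> e x y -> y \in gcomp e u.
Proof. by rewrite !inE => ux xy; exact: connect_trans ux (connect1 xy). Qed.

Lemma gcomp_center e u : u \in gcomp e u. Proof. by rewrite inE. Qed.

Lemma gcomp_eq e u (A : {set T}) : u \in A -> A \subset gcomp e u ->
  (forall x y, x \in A -> e x y -> y \in A) -> gcomp e u = A.
Proof.
move=> uA Asub cl; apply/eqP; rewrite finset.eqEsubset Asub andbT.
apply/fintype.subsetP=> v; rewrite inE => /connectP[p ep ->].
by elim: p u uA ep {Asub} => //= x p IH u uA /andP[ux]; exact: IH (cl _ _ uA ux).
Qed.

(** A ball that is not yet a whole component gains a vertex at every step. *)
Lemma small_ball e u r : (#|gball e u r| <= r)%N -> gball e u r = gcomp e u.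
Proof.
have: (r < #|gball e u r|)%N || (gcomp e u == gball e u r).
  elim: r => [|r]; first by rewrite gball0 finset.cards1.
  case/orP=> [lt|/eqP E]; last first.
    apply/orP; right; rewrite finset.eqEsubset gball_sub_gcomp andbT E.
    exact: gball_sub.
  case: (boolP (gball e u r.+1 \subset gball e u r)) => [sub|nsub]; last first.
    apply/orP; left; apply: leq_trans (proper_card (_ : gball e u r \proper gball e u r.+1)) => //.
    by rewrite properE nsub gball_sub.
  apply/orP; right; apply/eqP; apply: gcomp_eq; first exact: gball_center.
    exact: gball_sub_gcomp.
  move=> x y xB exy; have {}xB := fintype.subsetP sub _ xB.
  exact: gball_step xB exy.
by case/orP => [|/eqP ->//]; rewrite ltnNge => /negP.
Qed.

(** This makes the event of a small component local. *)
Lemma card_ball_comp e u s : (#|gball e u s| == s) = (#|gcomp e u| == s).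
Proof.
apply/eqP/eqP => [Es|Es]; first by rewrite -(@small_ball e u s) Es.
by rewrite -(@gcomp_sub_ball e u s) Es.
Qed.

Section Symmetric.
Variable (e : rel T).
Hypothesis se : symmetric e.

Lemma connect_symm u v : connect e u v = connect e v u.
Proof. exact: sym_connect_sym. Qed.

Lemma gcomp_same u v : v \in gcomp e u -> gcomp e v = gcomp e u.
Proof.
rewrite inE => uv; apply/setP => x; rewrite !inE.
by rewrite (same_connect connect_symm uv).
Qed.

Lemma in_compC u v : (v \in gcomp e u) = (u \in gcomp e v).
Proof. by rewrite !inE connect_symm. Qed.

End Symmetric.
End Balls.

Arguments gball : simpl never.

Lemma eq_gcomp (T : finType) (e e' : rel T) : e =2 e' -> gcomp e =1 gcomp e'.
Proof. by move=> ee u; apply/setP => v; rewrite !inE (eq_connect ee). Qed.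

(** * Marked graphs *)

Section Marks.
Context {V : finType} (v0 : V).
Implicit Types (n s : nat).

(** A graph with marked edges is a function on all potential edges; the value
    [v0] stands for an absent edge. *)
Definition mark_set n (c : {ffun edge n -> V}) (A : {set 'I_n}) : V :=
  if insub A is Some e then c e else v0.

Definition mark n (c : {ffun edge n -> V}) (u v : 'I_n) : V :=
  mark_set c [set u; v]%SET.

Lemma card_set2 n (u v : 'I_n) : u != v -> #|[set u; v]%SET| == 2%N.
Proof. by move=> uv; rewrite finset.cards2 uv. Qed.

Definition edge_of n (u v : 'I_n) (uv : u != v) : edge n :=
  exist _ [set u; v]%SET (card_set2 uv).

Lemma edgeP n (e : edge n) : exists u v, exists uv : u != v, e = edge_of uv.
Proof.
case: e => A; move=> Ae; have /cards2P[u [v [uv AE]]] := Ae.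
by exists u, v, uv; apply: val_inj.
Qed.

Lemma mark_set_val n (c : {ffun edge n -> V}) (e : edge n) : mark_set c (val e) = c e.
Proof. by rewrite /mark_set valK. Qed.

Lemma mark_edge n (c : {ffun edge n -> V}) u v (uv : u != v) :
  mark c u v = c (edge_of uv).
Proof. by rewrite -mark_set_val. Qed.

Lemma mark_diag n (c : {ffun edge n -> V}) u : mark c u u = v0.
Proof. by rewrite /mark /mark_set insubF // finset.setUid finset.cards1. Qed.

Lemma markC n (c : {ffun edge n -> V}) u v : mark c u v = mark c v u.
Proof. by rewrite /mark finset.setUC. Qed.

Lemma mark_upd n (c : {ffun edge n -> V}) e a u v :
  mark (upd c e a) u v = if val e == [set u; v]%SET then a else mark c u v.
Proof.
case: (eqVneq u v) => [->|uv].
  rewrite !mark_diag; case: eqP => // E; have := valP e.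
  by rewrite E finset.setUid finset.cards1.
rewrite !(mark_edge _ uv) updE eq_sym.
by rewrite -(inj_eq val_inj) /=.
Qed.

(** The graph induced on the range of [sigma], with its vertices renamed. *)
Definition pull n s (sigma : 'I_s -> 'I_n) (c : {ffun edge n -> V}) :
    {ffun edge s -> V} :=
  [ffun e : edge s => mark_set c (sigma @: (val e : {set 'I_s}))%SET].

Lemma mark_pull n s (sigma : 'I_s -> 'I_n) (c : {ffun edge n -> V}) x y :
  mark (pull sigma c) x y = mark c (sigma x) (sigma y).
Proof.
case: (eqVneq x y) => [->|xy]; first by rewrite !mark_diag.
by rewrite (mark_edge _ xy) ffunE /= imsetU1 imset_set1.
Qed.

(** The graph of the edges whose mark satisfies [O]. *)
Definition orel n (O : pred V) (c : {ffun edge n -> V}) : rel 'I_n :=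
  fun u v => O (mark c u v).

Lemma orel_sym n (O : pred V) (c : {ffun edge n -> V}) : symmetric (orel O c).
Proof. by move=> u v; rewrite /orel markC. Qed.

(** Every vertex other than the center has an edge to a smaller ball; no edge
    serves two vertices, since it would have to decrease the distance to the
    center both ways. *)
Lemma card_edges_connected n (O : pred V) (c : {ffun edge n -> V}) u r :
  ~~ O v0 -> gball (orel O c) u r = [set: 'I_n]%SET ->
  (n.-1 <= #|[set e | O (c e)]%SET|)%N.
Proof.
move=> O0 BT.
have ex (v : {v : 'I_n | v != u}) : exists e : edge n, O (c e) /\
    exists x t, [/\ val e = [set x; val v]%SET, x \in gball (orel O c) u t &
                 val v \notin gball (orel O c) u t].
  case: v => v vu /=.
  have : v \in gball (orel O c) u r by rewrite BT inE.
  elim: r {BT} => [|t IH]; first by rewrite gball0 inE (negPf vu).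
  rewrite in_ballS; case: (boolP (v \in gball _ u t)) => [/IH //|nv /=].
  case/existsP=> x /andP[xB]; rewrite /orel => Oxv.
  have xv : x != v by apply: contraNneq O0 => xv; rewrite xv mark_diag in Oxv.
  by exists (edge_of xv); rewrite -mark_edge; split => //; exists x, t.
have [f fP] := choice ex.
have finj : injective f.
  move=> v v' E; apply: val_inj; apply/eqP/negPn/negP => vv'.
  have [_ [x [t [e1 xt vt]]]] := fP v; have [_ [x' [t' [e2 xt' vt']]]] := fP v'.
  have E' : [set x; val v]%SET = [set x'; val v']%SET by rewrite -e1 -e2 E.
  have x'E : x' = val v.
    have : val v \in [set x'; val v']%SET by rewrite -E' !inE eqxx orbT.
    by rewrite !inE (negPf vv') orbF => /eqP.
  have xE : x = val v'.
    have : val v' \in [set x; val v]%SET by rewrite E' !inE eqxx orbT.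
    by rewrite !inE [_ == val v]eq_sym (negPf vv') orbF => /eqP.
  rewrite {}x'E {}xE in xt xt'.
  case: (leqP t t') => [le|/ltnW le].
    by have := fintype.subsetP (gball_sub (orel O c) u le) _ xt; rewrite (negPf vt').
  by have := fintype.subsetP (gball_sub (orel O c) u le) _ xt'; rewrite (negPf vt).
have : (#|codom f| <= #|[set e | O (c e)]%SET|)%N.
  apply: subset_leq_card; apply/fintype.subsetP => e /codomP[v ->].
  by rewrite inE; case: (fP v).
rewrite card_codom // card_sig.
rewrite (eq_card (_ : _ =i predC1 u)); last by move=> v; rewrite !inE.
by rewrite cardC1 card_ord.
Qed.

End Marks.

(** * Exploring a ball in a sparse random graph *)

Section PathBound.
Context {R : realType} {V : finType} (v0 : V).
Variables (n : nat) (wv : V -> R) (O : pred V).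
Local Notation w := (fun _ : edge n => wv).
Hypothesis lw1 : is_law1 wv.

Let lw : is_law w. Proof. by []. Qed.

Let q := \sum_v wv v * (O v)%:R.

Lemma path_upd (c : {ffun edge n -> V}) (e : edge n) a (u : 'I_n) p x :
  u \in val e -> u \notin x :: p ->
  path (orel v0 O (upd c e a)) x p = path (orel v0 O c) x p.
Proof.
move=> ue; elim: p x => //= y p IH x; rewrite !inE !negb_or => /and3P[ux uy up].
rewrite IH ?inE ?negb_or ?uy //; congr (_ && _).
rewrite /orel mark_upd; case: eqP => // E.
by move: ue; rewrite E !inE (negPf ux) (negPf uy).
Qed.

(** The edges of a simple path are distinct, hence independent. *)
Lemma pexp_path u p : uniq (u :: p) ->
  pexp w (fun c => (path (orel v0 O c) u p)%:R) = q ^+ size p.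
Proof.
elim: p u => [|x p IH] u up; first by rewrite pexp_cst // expr0.
have ux : u != x by move: up; rewrite /= inE negb_or -andbA => /andP[].
have nu : u \notin x :: p by case/andP: up.
rewrite /= exprS -(IH x); last by case/andP: up.
rewrite -(@pexp_indep _ _ _ _ (edge_of ux) (fun v => (O v)%:R)) //.
  by apply: eq_pexp => c; rewrite -(mark_edge v0) /= -natrM mulnb.
by move=> c v; rewrite (path_upd _ _ (u := u)) //= !inE eqxx.
Qed.

(** Each vertex of the ball is the end of a simple path from the center, of
    which there are at most [n ^ t] with [t] edges. *)
Lemma pexp_card_ball u r :
  pexp w (fun c => #|gball (orel v0 O c) u r|%:R) <= \sum_(t < r.+1) (n%:R * q) ^+ t.
Proof.
pose N c := \sum_(t < r.+1) \sum_(p : t.-tuple 'I_n | uniq (u :: p))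
   (path (orel v0 O c) u p)%:R : R.
apply: (@le_trans _ _ (pexp w N)).
  apply: ler_pexp => // c; rewrite /N.
  have cover (v : 'I_n) : (v \in gball (orel v0 O c) u r)%:R <=
     \sum_(t < r.+1) \sum_(p : t.-tuple 'I_n | uniq (u :: p))
       ((path (orel v0 O c) u p) && (last u p == v))%:R :> R.
    case: (boolP (v \in _)) => [/gball_uniq_path [p [ep pv up pr]]|_]; last first.
      by apply: sumr_ge0 => t _; apply: sumr_ge0.
    rewrite (bigD1 (Ordinal (pr : (size p < r.+1)%N))) //=.
    rewrite (bigD1 (in_tuple p)) //= ep pv eqxx /= -addrA lerDl.
    by apply: addr_ge0; [apply: sumr_ge0|apply: sumr_ge0 => t _; apply: sumr_ge0].
  rewrite -sum1_card natr_sum big_mkcond /=.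
  apply: (@le_trans _ _ (\sum_v \sum_(t < r.+1) \sum_(p : t.-tuple 'I_n | uniq (u :: p))
       ((path (orel v0 O c) u p) && (last u p == v))%:R)).
    by apply: ler_sum => v _; apply: le_trans (cover v); case: ifP.
  rewrite exchange_big; apply: ler_sum => t _; rewrite exchange_big; apply: ler_sum => p _.
  rewrite (bigD1 (last u p)) //= eqxx andbT big1 ?addr0 // => v.
  by rewrite eq_sym => /negPf ->; rewrite andbF.
rewrite /N pexp_sum; apply: ler_sum => t _; rewrite pexp_sum.
have q0 : 0 <= q.
  by apply: sumr_ge0 => v _; rewrite mulr_ge0 ?ler0n //; case: lw1.
apply: (@le_trans _ _ (\sum_(p : t.-tuple 'I_n) q ^+ t)).
  rewrite big_mkcond; apply: ler_sum => p _; case: ifP => [/pexp_path ->|_].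
    by rewrite size_tuple.
  exact: exprn_ge0.
by rewrite sumr_const card_tuple card_ord exprMn -natrX mulr_natl.
Qed.

End PathBound.

Section BallExploration.
Context {V : finType} (v0 : V).

Notation present := (predC1 v0).
Notation B c u r := (gball (orel v0 present c) u r).

(** Radius by radius: a vertex next to the image of the smaller ball is itself
    in the range of [sigma], by hypothesis. *)
Lemma gball_pull (O : pred V) n s (sigma : 'I_s -> 'I_n) (c : {ffun edge n -> V}) x r :
  let B' n (c : {ffun edge n -> V}) u t := gball (orel v0 O c) u t in
  (forall t y z, (t < r)%N -> y \in B' _ (pull v0 sigma c) x t ->
     (B' _ c (sigma x) t = sigma @: B' _ (pull v0 sigma c) x t)%SET ->
     orel v0 O c (sigma y) z -> exists y', z = sigma y') ->
  forall t, (t <= r)%N ->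
  (B' _ c (sigma x) t = sigma @: B' _ (pull v0 sigma c) x t)%SET.
Proof.
move=> B' H; rewrite /B'; elim=> [_|t IH tr]; first by rewrite !gball0 imset_set1.
have {}IH := IH (ltnW tr).
apply/setP => z; rewrite in_ballS IH; apply/idP/imsetP => [|[y]].
  case/orP => [/imsetP[y yB ->]|/existsP[_ /andP[/imsetP[y yB ->] yz]]].
    by exists y => //; rewrite in_ballS yB.
  have [y' E] := H _ _ _ tr yB IH yz.
  exists y' => //; apply: gball_step yB _.
  by rewrite /orel mark_pull -E.
rewrite in_ballS => /orP[yB ->|]; first by rewrite imset_f.
case/existsP=> y' /andP[y'B]; rewrite /orel mark_pull => yy' ->.
by apply/orP; right; apply/existsP; exists (sigma y'); rewrite imset_f.
Qed.

(** [A] has no edge leaving the explored vertices. *)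
Definition sealed n s (sigma : 'I_s -> 'I_n) (A : {set 'I_s})
    (c : {ffun edge n -> V}) : bool :=
  [forall x in A, forall y, (y \notin sigma @: [set: _]%SET)%SET ==> (mark v0 c (sigma x) y == v0)].

(** The range of [sigma] being the ball of radius [r.+1] only depends on the
    edges inside this range and on those leaving the ball of radius [r], and
    these two sets of edges are disjoint. *)
Lemma gball_sealed n s (sigma : 'I_s -> 'I_n) (c : {ffun edge n -> V}) x r :
  injective sigma ->
  (B c (sigma x) r.+1 == sigma @: [set: _]%SET)%SET =
  (B (pull v0 sigma c) x r.+1 == [set: _]%SET)%SET && sealed sigma (B (pull v0 sigma c) x r) c.
Proof.
move=> inj; apply/eqP/andP => [E|[/eqP ET /forallP sl]].
  have key t : (t <= r.+1)%N -> (B c (sigma x) t = sigma @: B (pull v0 sigma c) x t)%SET.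
    move: t; apply: gball_pull => t y z tr yB IH yz.
    have : z \in B c (sigma x) r.+1.
      apply: (fintype.subsetP (gball_sub _ _ tr)); apply: gball_step yz.
      by rewrite IH imset_f.
    by rewrite E => /imsetP[y' _ ->]; exists y'.
  split; first by apply/eqP/(imset_inj inj); rewrite -key.
  apply/forallP => y; apply/implyP => yB; apply/forallP => z; apply/implyP => nz.
  apply: contraNT nz => yz; rewrite -E; apply: gball_step yz.
  by rewrite key // imset_f.
rewrite -[in RHS]ET; apply: gball_pull (leqnn _) => t y z tr yB _ yz.
case: (boolP (z \in sigma @: [set: _]%SET)%SET) => [/imsetP[y' _ ->]|nz]; first by exists y'.
have yBr : y \in B (pull v0 sigma c) x r by apply: (fintype.subsetP (gball_sub _ _ _)) yB.
have /implyP/(_ yBr)/forallP/(_ z)/implyP/(_ nz) := sl y.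
by move=> E; move: yz; rewrite /orel /= E.
Qed.

Variable (R : realType).

(** The value at a vertex only depends on the ball of radius [r] around it, up
    to isomorphism. *)
Definition local (r : nat) (F : forall n, {ffun edge n -> V} -> 'I_n -> R) :=
  forall n s (sigma : 'I_s -> 'I_n) (c : {ffun edge n -> V}) x,
  injective sigma -> (B c (sigma x) r = sigma @: [set: _]%SET)%SET ->
  F n c (sigma x) = F s (pull v0 sigma c) x.

(** The labelling of the explored ball in which the center has number 0. *)
Definition extend n s (u : 'I_n) (tau : {ffun 'I_s -> 'I_n}) (x : 'I_s.+1) : 'I_n :=
  if unlift ord0 x is Some y then tau y else u.

Definition labelling n s (u : 'I_n) (tau : {ffun 'I_s -> 'I_n}) : bool :=
  injectiveb tau && (tau \in ffun_on (predC1 u)).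

Lemma extend0 n s (u : 'I_n) (tau : {ffun 'I_s -> 'I_n}) : extend u tau ord0 = u.
Proof. by rewrite /extend unlift_none. Qed.

Lemma extend_lift n s (u : 'I_n) (tau : {ffun 'I_s -> 'I_n}) y :
  extend u tau (lift ord0 y) = tau y.
Proof. by rewrite /extend liftK. Qed.

Lemma extend_inj n s (u : 'I_n) (tau : {ffun 'I_s -> 'I_n}) :
  labelling u tau -> injective (extend u tau).
Proof.
case/andP=> /injectiveP inj /ffun_onP on x y.
case: (unliftP ord0 x) => [x' ->|->]; case: (unliftP ord0 y) => [y' ->|->] //;
  rewrite ?extend_lift ?extend0.
- by move=> /inj ->.
- by move=> E; have := on x'; rewrite inE E eqxx.
- by move=> E; have := on y'; rewrite inE -E eqxx.
Qed.

Lemma extend_image n s (u : 'I_n) (tau : {ffun 'I_s -> 'I_n}) :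
  (extend u tau @: [set: _]%SET = u |: (tau @: [set: _]%SET))%SET.
Proof.
apply/setP => z; apply/imsetP/idP => [[x _ ->]|].
  case: (unliftP ord0 x) => [x' ->|->]; rewrite ?extend_lift ?extend0 !inE ?eqxx //.
  by rewrite imset_f ?orbT.
rewrite !inE => /orP[/eqP ->|/imsetP[x _ ->]]; first by exists ord0; rewrite ?extend0.
by exists (lift ord0 x); rewrite ?extend_lift.
Qed.

Lemma card_labellings n s (u : 'I_n) :
  #|[set tau : {ffun 'I_s -> 'I_n} | labelling u tau]%SET| = (n.-1 ^_ s)%N.
Proof.
rewrite -[n in RHS]card_ord -(cardC1 u) -[s in RHS]card_ord -card_inj_ffuns_on.
by apply: eq_card => tau; rewrite !inE andbC.
Qed.

(** Numbering a given ball with its center first; the division by [s`!] below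
    undoes this choice. *)
Lemma card_labellings_of n s (u : 'I_n) (A : {set 'I_n}) : u \in A ->
  #|[set tau : {ffun 'I_s -> 'I_n} | labelling u tau & (A == extend u tau @: [set: _]%SET)%SET]%SET|
  = ((#|A| == s.+1) * s`!)%N.
Proof.
move=> uA; case: eqP => [As|nAs]; last first.
  rewrite mul0n; apply: eq_card0 => tau; rewrite !inE; apply/negP => /andP[lab /eqP E].
  by apply: nAs; rewrite E card_imset ?cardsT ?card_ord //; exact: extend_inj.
have As' : #|A :\ u|%SET = s by move: As; rewrite (cardsD1 u) uA => -[].
transitivity (#|A :\ u|%SET ^_ #|'I_s|)%N; last by rewrite As' card_ord ffactnn mul1n.
rewrite -card_inj_ffuns_on.
apply: eq_card => tau; rewrite !inE; apply/idP/idP.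
  case/andP => /andP[inj on] /eqP E; rewrite inj andbT.
  apply/ffun_onP => y; rewrite !inE E extend_image !inE imset_f // orbT andbT.
  by have /ffun_onP/(_ y) := on.
case/andP => /ffun_onP on inj.
have lab : labelling u tau.
  by rewrite /labelling inj; apply/ffun_onP => y; have := on y; rewrite !inE => /andP[].
rewrite lab /= eq_sym eqEcard card_imset ?cardsT ?card_ord ?As ?leqnn ?andbT; last exact: extend_inj.
rewrite extend_image finset.subUset finset.sub1set uA /=; apply/fintype.subsetP => _ /imsetP[y _ ->].
by have := on y; rewrite !inE => /andP[].
Qed.

(** A sum over the numbered marked graphs [H] that the ball can be. *)
Lemma explore_sum (F : forall n, {ffun edge n -> V} -> 'I_n -> R) r n s
    (c : {ffun edge n -> V}) u : local r.+1 F ->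
  (#|B c u r.+1| == s.+1)%:R * F n c u =
  (s`!)%:R^-1 * \sum_(tau : {ffun 'I_s -> 'I_n} | labelling u tau)
    \sum_(H : {ffun edge s.+1 -> V} | B H ord0 r.+1 == [set: _]%SET)
      F s.+1 H ord0 * ((pull v0 (extend u tau) c == H) &&
                       sealed (extend u tau) (B H ord0 r) c)%:R.
Proof.
move=> loc.
transitivity ((s`!)%:R^-1 * \sum_(tau : {ffun 'I_s -> 'I_n} | labelling u tau)
    (B c u r.+1 == extend u tau @: [set: _]%SET)%SET%:R * F n c u).
  rewrite -mulr_suml -natr_sum mulrA.
  congr (_ * _).
  rewrite -big_mkcondr sum1_card.
  rewrite [X in _ = _ * X%:R](_ : _ = ((#|B c u r.+1| == s.+1) * s`!)%N); last first.
    rewrite -(card_labellings_of s (gball_center (orel v0 present c) u r.+1)).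
    by apply: eq_card => tau; rewrite !inE.
  by rewrite natrM mulrCA mulVf ?mulr1 // pnatr_eq0 -lt0n fact_gt0.
congr (_ * _); apply: eq_bigr => tau lab.
set sigma := extend u tau; have inj : injective sigma := extend_inj lab.
rewrite (eq_bigr (fun H => if H == pull v0 sigma c then F s.+1 (pull v0 sigma c) ord0 *
   (sealed sigma (B (pull v0 sigma c) ord0 r) c)%:R else 0)); last first.
  move=> H _; rewrite [H == _]eq_sym; case: eqP => [<- //|_]; by rewrite mulr0.
rewrite -big_mkcondr /=.
have E0 : sigma ord0 = u by rewrite /sigma extend0.
have := gball_sealed c ord0 r inj; rewrite E0 => ->.
case: eqP => [E|nE] /=; last first.
  rewrite mul0r big1 // => H /andP[/eqP HT /eqP HE]; by case: nE; rewrite -HE.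
rewrite (big_pred1 (pull v0 sigma c)) => [|H]; last first.
  by rewrite /=; case: (eqVneq H (pull v0 sigma c)) => [->|_]; rewrite ?andbF // andbT; apply/eqP.
rewrite mulrC; case: (boolP (sealed _ _ _)) => sl; rewrite ?mulr0 // !mulr1.
rewrite -{1}E0 (loc _ _ sigma) //; apply/eqP; by rewrite gball_sealed // E eqxx.
Qed.

Lemma prodr_bool (J : finType) (b : pred J) :
  \prod_j (b j)%:R = [forall j, b j]%:R :> R.
Proof.
case: forallP => [H|/forallP/forallPn[j /negPf nj]]; first by rewrite big1 // => j _; rewrite H.
by rewrite (bigD1 j) //= nj mul0r.
Qed.

(** The edges inside the range of [sigma] and those leaving it are distinct, so
    that both events together prescribe the marks of distinct edges. *)
Lemma pexp_cylinder (wv : V -> R) n s (sigma : 'I_s -> 'I_n) (A : {set 'I_s})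
    (H : {ffun edge s -> V}) : is_law1 wv -> injective sigma ->
  pexp (fun _ : edge n => wv)
    (fun c => ((pull v0 sigma c == H) && sealed sigma A c)%:R) =
  (\prod_e wv (H e)) * wv v0 ^+ (#|A| * (n - s)).
Proof.
move=> lw inj.
pose X := [set p : 'I_s * 'I_n | (p.1 \in A) && (p.2 \notin sigma @: [set: _]%SET)]%SET.
have ne (p : {p | p \in X}) : sigma (val p).1 != (val p).2.
  case: p => -[x y] /=; rewrite inE => /andP[_]; apply: contraNneq => /= <-.
  by rewrite imset_f.
have im2 (e : edge s) : #|sigma @: (val e : {set 'I_s})|%SET == 2%N.
  by rewrite card_imset //; exact: (valP e).
pose iota (j : edge s + {p | p \in X}) : edge n :=
  match j with inl e => exist (fun A : {set 'I_n} => #|A| == 2%N) _ (im2 e) | inr p => edge_of (ne p) end.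
have iinj : injective iota.
  case=> [e|p] [e'|p'] /(congr1 val) /=.
  - by move/(imset_inj inj)/val_inj => ->.
  - move/setP/(_ (val p').2); rewrite !inE eqxx orbT.
    have := valP p'; rewrite !inE => /andP[_ /negP nim] /imsetP[x _ E].
    by case: nim; rewrite E imset_f.
  - move/setP/(_ (val p).2); rewrite !inE eqxx orbT => /esym.
    have := valP p; rewrite !inE => /andP[_ /negP nim] /imsetP[x _ E].
    by case: nim; rewrite E imset_f.
  - move=> E; congr inr; apply: val_inj.
    have out (p1 : {p | p \in X}) x : (val p1).2 != sigma x.
      case: (p1) => -[a b] /=; rewrite inE /= => /andP[_]; apply: contraNneq => ->.
      by rewrite imset_f.
    have E2 : (val p).2 = (val p').2.
      have : (val p).2 \in [set sigma (val p').1; (val p').2]%SET by rewrite -E !inE eqxx orbT.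
      by rewrite !inE (negPf (out _ _)) /= => /eqP.
    have E1 : (val p).1 = (val p').1.
      apply: inj.
      have : sigma (val p).1 \in [set sigma (val p').1; (val p').2]%SET by rewrite -E !inE eqxx.
      by rewrite !inE [_ == (val p').2]eq_sym (negPf (out _ _)) orbF => /eqP.
    by case: (val p) (val p') E1 E2 => ? ? [? ?] /= -> ->.
pose h (j : edge s + {p | p \in X}) v : R :=
  match j with inl e => (v == H e)%:R | inr p => (v == v0)%:R end.
transitivity (pexp (fun _ : edge n => wv) (fun c => \prod_j h j (c (iota j)))).
  apply: eq_pexp => c; rewrite big_sumType /= /h.
  rewrite (eq_bigr (fun e : edge s => (pull v0 sigma c e == H e)%:R)); last first.
    move=> e _; rewrite (_ : pull v0 sigma c e = c (iota (inl e))) // ffunE.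
    exact: (mark_set_val v0 c (iota (inl e))).
  rewrite !prodr_bool -natrM mulnb; congr (nat_of_bool (_ && _))%:R.
    apply/eqP/forallP => [-> //|E]; apply/ffunP => e; exact/eqP.
  apply/forallP/forallP => [sl p|sl x].
    have := valP p; rewrite inE => /andP[xA yim].
    have /implyP/(_ xA)/forallP/(_ (val p).2)/implyP/(_ yim) := sl (val p).1.
    by rewrite (mark_edge v0 _ (ne p)).
  apply/implyP => xA; apply/forallP => y; apply/implyP => yim.
  have pX : (x, y) \in X by rewrite inE xA.
  by have := sl (exist _ (x, y) pX); rewrite -(mark_set_val v0 c).
rewrite pexp_prod_inj // big_sumType /=; congr (_ * _).
  apply: eq_bigr => e _; rewrite (bigD1 (H e)) //= eqxx mulr1 big1 ?addr0 //.
  by move=> v /negPf ->; rewrite mulr0.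
rewrite (eq_bigr (fun=> wv v0)); last first.
  move=> p _; rewrite (bigD1 v0) //= eqxx mulr1 big1 ?addr0 //.
  by move=> v /negPf ->; rewrite mulr0.
rewrite prodr_const; congr (_ ^+ _).
rewrite card_sig (_ : #|_| = #|finset.setX A (~: (sigma @: [set: _]))|%SET); last first.
  by apply: eq_card => -[x y]; rewrite !inE.
by rewrite finset.cardsX [#|~: _|%SET]finset.cardsCs finset.setCK card_imset // finset.cardsT !card_ord.
Qed.

(** All vertices [u] have the same mean, since the marks are identically
    distributed. *)
Definition ball_mean (F : forall n, {ffun edge n -> V} -> 'I_n -> R) r s n
    (wv : V -> R) : R :=
  (s`!)%:R^-1 * \sum_(H : {ffun edge s.+1 -> V} | B H ord0 r.+1 == [set: _]%SET)
    F s.+1 H ord0 * ((n.-1 ^_ s)%:R * (\prod_e wv (H e)) *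
                     wv v0 ^+ (#|B H ord0 r| * (n - s.+1))).

Lemma explore_mean (F : forall n, {ffun edge n -> V} -> 'I_n -> R) r n s
    (wv : V -> R) u : local r.+1 F -> is_law1 wv ->
  pexp (fun _ : edge n => wv) (fun c => (#|B c u r.+1| == s.+1)%:R * F n c u) =
  ball_mean F r s n wv.
Proof.
move=> loc lw.
rewrite (eq_pexp _ (fun c => explore_sum s c u loc)) pexpZ; congr (_ * _).
rewrite pexp_sum.
under eq_bigr => tau lab.
  rewrite pexp_sum; under eq_bigr do rewrite pexpZ (pexp_cylinder _ _ lw (extend_inj lab)).
  over.
rewrite exchange_big; apply: eq_bigr => H _ /=.
rewrite sumr_const -mulrnAr; congr (_ * _).
rewrite -[LHS]mulr_natl mulrA; congr (_ * _ * _).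
by congr (_%:R); rewrite -(card_labellings s u); apply: eq_card => tau; rewrite inE.
Qed.

End BallExploration.

(** * Limits in the sparse regime *)

Section SequenceLimits.
Context {R : realType}.
Implicit Types (u v : nat -> R) (l : R).
Local Open Scope classical_set_scope.

Lemma cvg_near_eq u v l : (\forall n \near \oo, u n = v n) ->
  v @ \oo --> l -> u @ \oo --> l.
Proof.
move=> uv; apply: cvg_trans; apply: near_eq_cvg; near=> n.
by apply/esym; near: n.
Unshelve. all: by end_near. Qed.

Lemma cvg_dist u l (e : R) : u @ \oo --> l -> 0 < e ->
  \forall n \near \oo, `|l - u n| <= e.
Proof. by move=> /cvgrPdist_le H e0; exact: H. Qed.

Lemma cvg_prodr (I : Type) (s : seq I) (P : pred I) (F : I -> nat -> R) (l : I -> R) :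
  (forall i, P i -> F i @ \oo --> l i) ->
  (fun n => \prod_(i <- s | P i) F i n) @ \oo --> \prod_(i <- s | P i) l i.
Proof.
move=> H; elim: s => [|i s IH].
  rewrite big_nil; under eq_fun do rewrite big_nil; exact: cvg_cst.
rewrite big_cons; under eq_fun do rewrite big_cons.
by case: ifP => // Pi; apply: cvgM => //; exact: H.
Qed.

Lemma cvg_sumr (I : Type) (s : seq I) (P : pred I) (F : I -> nat -> R) (l : I -> R) :
  (forall i, P i -> F i @ \oo --> l i) ->
  (fun n => \sum_(i <- s | P i) F i n) @ \oo --> \sum_(i <- s | P i) l i.
Proof.
move=> H; elim: s => [|i s IH].
  rewrite big_nil; under eq_fun do rewrite big_nil; exact: cvg_cst.
rewrite big_cons; under eq_fun do rewrite big_cons.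
by case: ifP => // Pi; apply: cvgD => //; exact: H.
Qed.

Lemma cvg_exprn u l m : u @ \oo --> l -> (fun n => u n ^+ m) @ \oo --> l ^+ m.
Proof.
move=> ul; elim: m => [|m IH]; first by rewrite expr0; under eq_fun do rewrite expr0; exact: cvg_cst.
by rewrite exprS; under eq_fun do rewrite exprS; apply: cvgM.
Qed.

Lemma cvg_invn : (fun n => n%:R^-1 : R) @ \oo --> (0 : R).
Proof. by rewrite -cvg_shiftS; exact: cvg_harmonic. Qed.

Lemma cvg_divn u l : u @ \oo --> l -> (fun n => u n / n%:R) @ \oo --> (0 : R).
Proof. by move=> ul; rewrite -(mulr0 l); apply: cvgM => //; exact: cvg_invn. Qed.

(** A bounded sequence divided by [n] tends to zero. *)
Lemma cvg_of_muln u l : (fun n => n%:R * u n) @ \oo --> l -> u @ \oo --> (0 : R).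
Proof.
move=> /cvg_divn; apply: cvg_near_eq; near=> n.
rewrite mulrAC divff ?mul1r // pnatr_eq0 -lt0n; near: n; exact: nbhs_infty_gt.
Unshelve. all: by end_near. Qed.

Lemma cvg_ffact s : (fun n => (n.-1 ^_ s)%:R / n%:R ^+ s : R) @ \oo --> (1 : R).
Proof.
elim: s => [|s IH].
  apply: (@cvg_near_eq _ (fun=> 1)); last exact: cvg_cst.
  by apply: nearW => n; rewrite ffactn0 expr0 divr1.
have : (fun n => (1 - s.+1%:R / n%:R) : R) @ \oo --> (1 : R).
  rewrite -[X in _ --> X]subr0; apply: cvgB; first exact: cvg_cst.
  by rewrite -(mulr0 s.+1%:R); apply: cvgM; [exact: cvg_cst|exact: cvg_invn].
move=> /(cvgM IH); rewrite mulr1 => H; apply: cvg_near_eq H.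
near=> n.
have ns : (s.+1 < n)%N by near: n; exact: nbhs_infty_gt.
have n0 : n%:R != 0 :> R by rewrite pnatr_eq0 -lt0n; apply: leq_trans ns.
rewrite /= ffactnSr natrM exprSr invfM mulrACA; congr (_ * _).
have -> : (n.-1 - s = n - s.+1)%N by lia.
by rewrite natrB 1?ltnW // mulrBl divff.
Unshelve. all: by end_near. Qed.

Lemma expR_le_1B (x : R) : x < 1 -> expR (- (x / (1 - x))) <= 1 - x.
Proof.
move=> x1; have y0 : 0 < 1 - x by rewrite subr_gt0.
rewrite expRN -[leRHS]invrK lef_pV2 ?posrE ?invr_gt0 ?expR_gt0 //.
apply: le_trans (expR_ge1Dx _); rewrite le_eqVlt; apply/orP; left; apply/eqP.
by field; rewrite gt_eqF.
Qed.

(** The squeeze [exp (- n x / (1 - x)) <= (1 - x) ^ n <= exp (- n x)]. *)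
Lemma cvg_pow_exp u l : (forall n, u n <= 1) -> (fun n => n%:R * u n) @ \oo --> l ->
  (fun n => (1 - u n) ^+ n) @ \oo --> expR (- l).
Proof.
move=> u1 ul; have u0 := cvg_of_muln ul.
have expc : {for - l, continuous (@expR R)} by exact: continuous_expR.
apply: (@squeeze_cvgr _ _ _ _ (fun n => expR (- (n%:R * u n / (1 - u n)))) (fun n => expR (- (n%:R * u n)))); last 2 first.
- have : (fun n => - (n%:R * u n / (1 - u n))) @ \oo --> - l.
    apply: cvgN; rewrite -[X in _ --> X]divr1; apply: cvgM => //.
    apply: cvgV; first exact: oner_neq0.
    rewrite -[X in _ --> X]subr0; apply: cvgB => //; exact: cvg_cst.
  exact: (continuous_cvg _ expc).
- exact: (continuous_cvg _ expc (cvgN ul)).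
near=> n.
have un : u n < 1 by near: n; apply: (cvgr_lt _ u0); exact: ltr01.
apply/andP; split.
  rewrite -mulrA -mulrN expRM_natl lerXn2r ?nnegrE ?expR_ge0 ?subr_ge0 ?u1 //.
  exact: expR_le_1B.
rewrite -mulrN expRM_natl lerXn2r ?nnegrE ?expR_ge0 ?subr_ge0 ?u1 //.
exact: expR_ge1Dx.
Unshelve. all: by end_near. Qed.

End SequenceLimits.

Section SparseLimit.
Context {R : realType} {V : finType} (v0 : V).
Local Open Scope classical_set_scope.

Variables (w : nat -> V -> R) (beta : V -> R).

Definition sparse_law := (forall n, is_law1 (w n)) /\
  forall v, v != v0 -> (fun n => n%:R * w n v) @ \oo --> beta v.

Hypothesis sw : sparse_law.

Let lw n : is_law1 (w n). Proof. by case: sw => H _; exact: H. Qed.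
Let Lambda := \sum_(v | v != v0) beta v.

Lemma w0E n : w n v0 = 1 - \sum_(v | v != v0) w n v.
Proof. by have [_] := lw n; rewrite (bigD1 v0) //= => <-; rewrite addrK. Qed.

Lemma sum_w_cvg : (fun n => n%:R * \sum_(v | v != v0) w n v) @ \oo --> Lambda.
Proof.
under eq_fun do rewrite mulr_sumr.
by apply: cvg_sumr => v; case: sw => _; exact.
Qed.

Lemma w0_cvg : (fun n => w n v0) @ \oo --> (1 : R).
Proof.
rewrite (_ : (fun n => _) = fun n => 1 - \sum_(v | v != v0) w n v); last first.
  by apply/funext => n; exact: w0E.
rewrite -[X in _ --> X]subr0; apply: cvgB; [exact: cvg_cst|].
exact: cvg_of_muln sum_w_cvg.
Qed.

Lemma w0_pow_cvg : (fun n => w n v0 ^+ n) @ \oo --> expR (- Lambda).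
Proof.
rewrite (_ : (fun n => _) = fun n => (1 - \sum_(v | v != v0) w n v) ^+ n); last first.
  by apply/funext => n; rewrite w0E.
apply: cvg_pow_exp sum_w_cvg => n.
by have [w0 <-] := lw n; rewrite [leRHS](bigD1 v0) //= lerDr.
Qed.

Lemma w0_powB_cvg a s :
  (fun n => w n v0 ^+ (a * (n - s))) @ \oo --> expR (- (a%:R * Lambda)).
Proof.
have H : (fun n => (w n v0 ^+ n) ^+ a / w n v0 ^+ (a * s)) @ \oo --> expR (- (a%:R * Lambda)).
  rewrite -mulrN expRM_natl -[X in _ --> X]divr1 -[X in _ / X](expr1n _ (a * s)).
  apply: cvgM; first exact: cvg_exprn w0_pow_cvg.
  apply: cvgV; first by rewrite expr1n oner_neq0.
  exact: cvg_exprn w0_cvg.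
apply: cvg_near_eq H; near=> n.
have w0 : w n v0 != 0.
  by rewrite gt_eqF //; near: n; apply: (cvgr_gt _ w0_cvg); exact: ltr01.
have ns : (s <= n)%N by near: n; exact: nbhs_infty_ge.
by rewrite -exprM mulnC mulnBl [(s * a)%N]mulnC [(a * s)%N]mulnC -expfB_cond ?(negPf w0) // leq_mul2r ns orbT.
Unshelve. all: by end_near. Qed.

(** Each present edge has probability of order [1 / n], which the factor [n ^ s]
    only compensates for [s] of them. *)
Lemma edge_prod_cvg n0 s (H : {ffun edge n0 -> V}) :
  (s <= #|[set e | H e != v0]%SET|)%N ->
  (fun n => n%:R ^+ s * \prod_e w n (H e)) @ \oo -->
  (if #|[set e | H e != v0]%SET| == s then \prod_(e | H e != v0) beta (H e) else 0).
Proof.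
set m := #|_| => sm.
have E : (fun n => (n%:R ^- (m - s) * (\prod_(e | H e != v0) (n%:R * w n (H e))))
            * \prod_(e | ~~ (H e != v0)) w n (H e)) @ \oo -->
    (if m == s then 1 else 0) * (\prod_(e | H e != v0) beta (H e)) * 1.
  apply: cvgM; last first.
    have E1 : \prod_(e | ~~ (H e != v0)) (1 : R) = 1 by rewrite big1.
    rewrite -[X in _ --> X]E1.
    apply: cvg_prodr => e; rewrite negbK => /eqP ->; exact: w0_cvg.
  apply: cvgM; last by apply: cvg_prodr => e He; case: sw => _; exact.
  case: (eqVneq m s) => [->|ms].
    by rewrite subnn; under eq_fun do rewrite expr0 invr1; exact: cvg_cst.
  have := @cvg_exprn R _ _ (m - s)%N (@cvg_invn R); rewrite expr0n.
  rewrite subn_eq0 leqNgt ltn_neqAle sm eq_sym ms /=.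
  by under eq_fun do rewrite exprVn.
rewrite mulr1 in E; rewrite [X in _ --> X](_ : _ = (if m == s then 1 else 0) * \prod_(e | H e != v0) beta (H e)); last first.
  by case: ifP; rewrite ?mul1r ?mul0r.
apply: cvg_near_eq E; near=> n.
have n0' : n%:R != 0 :> R by rewrite pnatr_eq0 -lt0n; near: n; exact: nbhs_infty_gt.
rewrite big_split /= prodr_const -!mulrA [in RHS]mulrA.
rewrite (_ : #|_| = m); last by rewrite /m; apply: eq_card => e; rewrite inE.
rewrite [in LHS](bigID (fun e => H e != v0)) /=; congr (_ * _).
by rewrite -{2}(subnK sm) exprD mulrA mulVf ?mul1r // expf_neq0.
Unshelve. all: by end_near. Qed.

Notation present := (predC1 v0).
Notation B c u r := (gball (orel v0 present c) u r).

(** In the limit the explored graph is a tree: every edge beyond those of a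
    spanning tree costs a factor [1 / n]. *)
Definition ball_limit (F : forall n, {ffun edge n -> V} -> 'I_n -> R) r s : R :=
  (s`!)%:R^-1 * \sum_(H : {ffun edge s.+1 -> V} | B H ord0 r.+1 == [set: _]%SET)
    F s.+1 H ord0 *
     ((if #|[set e | H e != v0]%SET| == s then \prod_(e | H e != v0) beta (H e) else 0)
      * expR (- (#|B H ord0 r|%:R * Lambda))).

Lemma ball_mean_cvg (F : forall n, {ffun edge n -> V} -> 'I_n -> R) r s :
  (fun n => ball_mean v0 F r s n (w n)) @ \oo --> ball_limit F r s.
Proof.
apply: cvgM; first exact: cvg_cst.
apply: cvg_sumr => H /eqP HT; apply: cvgM; first exact: cvg_cst.
apply: cvgM; last exact: w0_powB_cvg.
have sm : (s <= #|[set e | H e != v0]%SET|)%N.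
  by have := card_edges_connected (O := present) _ HT; rewrite /= eqxx => /(_ isT).
have E := cvgM (cvg_ffact s) (edge_prod_cvg sm); rewrite mul1r in E.
apply: cvg_near_eq (E _); near=> n => /=.
have n0' : n%:R != 0 :> R by rewrite pnatr_eq0 -lt0n; near: n; exact: nbhs_infty_gt.
by rewrite mulrA divfK // expf_neq0.
Unshelve. all: by end_near. Qed.

(** Mean degrees stay bounded, since they converge. *)
Lemma sum_w_bounded : exists2 K : R, 0 <= K &
  \forall n \near \oo, n%:R * (\sum_v w n v * (present v)%:R) <= K.
Proof.
exists (`|Lambda| + 1); first by rewrite addr_ge0.
near=> n.
rewrite (_ : \sum_v _ = \sum_(v | v != v0) w n v); last first.
  rewrite [RHS]big_mkcond; apply: eq_bigr => v _ /=; by case: eqP; rewrite ?mulr0 ?mulr1.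
near: n; apply: (cvgr_le _ sum_w_cvg); apply: le_lt_trans (ler_norm _) _.
by rewrite ltrDl.
Unshelve. all: by end_near. Qed.

(** Averages of local functions converge: balls are explored exactly, and
    large balls are rare since the mean size of a ball is bounded. *)
Lemma local_average_cvg (F : forall n, {ffun edge n -> V} -> 'I_n -> R) r :
  local v0 r.+1 F -> (forall n c u, 0 <= F n c u <= 1) ->
  exists l : R,
    (fun L => \sum_(s < L) ball_limit F r s) @ \oo --> l /\
    (fun n => pexp (fun _ : edge n => w n) (fun c => (\sum_u F n c u) / n%:R)) @ \oo --> l.
Proof.
move=> loc F01.
set a := fun n => pexp _ _.
pose M n s := ball_mean v0 F r s n (w n).
have [K K0 wK] := sum_w_bounded.
pose C := \sum_(t < r.+2) K ^+ t.
have C0 : 0 <= C by apply: sumr_ge0 => t _; exact: exprn_ge0.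
have aE n : a n = (\sum_(u < n) pexp (fun _ : edge n => w n) (fun c => F n c u)) / n%:R.
  rewrite /a -pexp_sum mulrC -pexpZ; apply: eq_pexp => c; by rewrite mulrC.
(* The balls of more than [L] vertices are rare by Markov's inequality. *)
have key L : (0 < L)%N -> \forall n \near \oo,
    0 <= a n - \sum_(s < L) M n s <= C / L%:R.
  move=> L0; near=> n.
  have n0 : (0 < n)%N by near: n; exact: nbhs_infty_gt.
  have n0' : 0 < n%:R :> R by rewrite ltr0n.
  have lw' : is_law (fun _ : edge n => w n) by move=> e; exact: lw.
  have -> : a n - \sum_(s < L) M n s =
    (\sum_(u < n) pexp (fun _ : edge n => w n)
       (fun c => F n c u - \sum_(s < L) (#|B c u r.+1| == s.+1)%:R * F n c u)) / n%:R.
    under [in RHS]eq_bigr => u _.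
      rewrite pexpB pexp_sum; under eq_bigr do rewrite (explore_mean _ _ loc (lw n)).
      over.
    rewrite sumrB mulrBl -aE; congr (_ - _).
    by rewrite sumr_const card_ord -[X in _ = X / _]mulr_natr mulfK ?gt_eqF.
  have diff c (u : 'I_n) :
      F n c u - \sum_(s < L) (#|B c u r.+1| == s.+1)%:R * F n c u =
      (L < #|B c u r.+1|)%N%:R * F n c u.
    rewrite -mulr_suml -{1}[F n c u]mul1r -mulrBl; congr (_ * _).
    have B0 : (0 < #|B c u r.+1|)%N by apply/card_gt0P; exists u; exact: gball_center.
    case: ltnP => BL.
      rewrite big1 ?subr0 // => s _; case: eqP => // E; move: BL; rewrite E ltnS.
      by rewrite leqNgt ltn_ord.
    have sL : (#|B c u r.+1|.-1 < L)%N by rewrite prednK.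
    rewrite (bigD1 (Ordinal sL)) //= prednK // eqxx big1 ?addr0 ?subrr // => s ns.
    by case: eqP => // E; case/eqP: ns; apply: val_inj; rewrite /= E.
  apply/andP; split.
    apply: divr_ge0 (ltW n0'); apply: sumr_ge0 => u _; apply: pexp_ge0 => // c.
    by rewrite diff mulr_ge0 //; case/andP: (F01 n c u).
  rewrite ler_pdivrMr // mulr_natr -[X in _ *+ X]card_ord -sumr_const.
  apply: ler_sum => u _.
  apply: (@le_trans _ _ (pexp (fun _ : edge n => w n) (fun c => L%:R^-1 * #|B c u r.+1|%:R))).
    apply: ler_pexp => // c; rewrite diff.
    have /andP[F0 F1] := F01 n c u.
    case: ltnP => BL; last by rewrite mul0r mulr_ge0 ?invr_ge0.
    rewrite mul1r; apply: le_trans F1 _.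
    by rewrite mulrC ler_pdivlMr ?ltr0n // mul1r ler_nat ltnW.
  rewrite pexpZ mulrC; apply: ler_wpM2r; first by rewrite invr_ge0.
  apply: le_trans (pexp_card_ball v0 present (lw n) u r.+1) _.
  apply: ler_sum => t _; rewrite lerXn2r ?nnegrE //; last by near: n.
  rewrite mulr_ge0 //; apply: sumr_ge0 => v _; by rewrite mulr_ge0 //; case: (lw n).
have a1 : \forall n \near \oo, a n <= 1.
  near=> n.
  have n0 : 0 < n%:R :> R by rewrite ltr0n; near: n; exact: nbhs_infty_gt.
  have lw' : is_law (fun _ : edge n => w n) by move=> e; exact: lw.
  rewrite -[leRHS](pexp_cst _ lw'); apply: ler_pexp => // c.
  rewrite ler_pdivrMr // mul1r -[leRHS]mulr1 mulr_natl -[X in _ *+ X]card_ord -sumr_const.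
  by apply: ler_sum => u _; case/andP: (F01 n c u).
have M0 n s : 0 <= M n s.
  apply: mulr_ge0; first by rewrite invr_ge0.
  apply: sumr_ge0 => H _; apply: mulr_ge0; first by case/andP: (F01 _ H ord0).
  have w0 v : 0 <= w n v by case: (lw n).
  by rewrite !mulr_ge0 ?exprn_ge0 ?prodr_ge0.
have b0 s : 0 <= ball_limit F r s.
  rewrite -(cvg_lim _ (@ball_mean_cvg F r s)) //; apply: limr_ge.
    by apply/cvg_ex; eexists; exact: ball_mean_cvg.
  by apply: nearW => n; exact: M0.
pose S L := \sum_(s < L) ball_limit F r s.
have MS L : (fun n => \sum_(s < L) M n s) @ \oo --> S L.
  by apply: cvg_sumr => s _; exact: ball_mean_cvg.
have Sinc : nondecreasing_seq S.
  apply/nondecreasing_seqP => L; by rewrite /S big_ord_recr lerDl.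
have S1 L : S L <= 1.
  apply: (@le_trans _ _ (S L.+1)); first exact: Sinc.
  rewrite -(cvg_lim _ (MS L.+1)) //; apply: limr_le.
    by apply/cvg_ex; eexists; exact: MS.
  near=> n; apply: (@le_trans _ _ (a n)); last by near: n.
  rewrite -subr_ge0.
  have : 0 <= a n - \sum_(s < L.+1) M n s <= C / L.+1%:R by near: n; exact: key.
  by case/andP.
have cS : cvgn S.
  apply: nondecreasing_is_cvgn => //; exists 1 => _ [L _ <-]; exact: S1.
exists (limn S); split; first exact: cS.
apply/cvgrPdist_le => eps e0.
have e3 : 0 < eps / 3 by rewrite divr_gt0.
have : \forall L \near \oo, (0 < L)%N /\ `|limn S - S L| <= eps / 3 /\ C / L%:R <= eps / 3.
  have h1 := cvg_dist cS e3.
  have h2 : (fun L => C / L%:R) @ \oo --> (0 : R).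
    by apply: (@cvg_divn _ (fun=> C) C); exact: cvg_cst.
  near=> L; split; first by near: L; exact: nbhs_infty_gt.
  split; first by near: L.
  by near: L; apply: (cvgr_le _ h2).
move=> /filter_ex [L [L0 [SL CL]]].
near=> n.
have h1 : `|S L - \sum_(s < L) M n s| <= eps / 3.
  by near: n; exact: cvg_dist (MS L) e3.
have /andP[h2 h3] : 0 <= a n - \sum_(s < L) M n s <= C / L%:R by near: n; exact: key.
have -> : limn S - a n = (limn S - S L) + (S L - \sum_(s < L) M n s)
   - (a n - \sum_(s < L) M n s) by ring.
apply: le_trans (ler_normB _ _) _; rewrite (ger0_norm h2).
apply: le_trans (lerD (ler_normD _ _) (lexx _)) _.
have -> : eps = eps / 3 + eps / 3 + eps / 3 by field.
by apply: lerD (le_trans h3 CL); apply: lerD.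
Unshelve. all: by end_near. Qed.

End SparseLimit.

(** * Component sizes of the random graph G(n, b / n) *)

Section ComponentDensities.
Context {R : realType}.
Implicit Types (b : R).
Local Open Scope classical_set_scope.

Definition bern (p : R) (b : bool) : R := if b then p else 1 - p.

Lemma bern_law p : 0 <= p <= 1 -> is_law1 (bern p).
Proof.
move=> /andP[p0 p1]; split; first by case; rewrite /bern // subr_ge0.
by rewrite big_bool /bern /= addrC subrK.
Qed.

Notation "''P' [ n , p ] f" := (pexp (fun _ : edge n => bern p) f)
  (at level 10, n, p at level 9, f at level 9).
Notation rel c := (orel false (predC1 false) c).

Lemma bern_sparse (p : nat -> R) b : (forall n, 0 <= p n <= 1) ->
  (fun n => n%:R * p n) @ \oo --> b ->
  sparse_law false (fun n => bern (p n)) (fun=> b).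
Proof. by move=> p01 pb; split=> [n|[]//]; exact: bern_law. Qed.

(** The number of trees on [s.+1] labelled vertices, divided by [s`!]. *)
Definition tree_coef s : R := (s`!)%:R^-1 *
  #|[set H : {ffun edge s.+1 -> bool} |
     (gball (rel H) ord0 s.+1 == [set: _]) && (#|[set e | H e]| == s)]%SET|%:R.

(** The Borel distribution at [s.+1], the law of the total progeny of a Poisson
    branching process. *)
Definition density b s : R := tree_coef s * (b ^+ s * expR (- (s.+1%:R * b))).

Lemma ball_limit_density b s : ball_limit false (fun=> b) (fun _ _ _ => 1) s s = density b s.
Proof.
rewrite /ball_limit /density /tree_coef -!mulrA; congr (_ * _).
rewrite -sum1_card natr_sum mulr_suml big_mkcond [RHS]big_mkcond.
apply: eq_bigr => H _; rewrite inE.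
case: eqP => //= HT.
rewrite (_ : [set e | H e != false]%SET = [set e | H e]%SET); last first.
  by apply/setP => e; rewrite !inE; case: (H e).
case: eqP => //= Hs; last by rewrite !mul0r mulr0.
rewrite !mul1r; congr (_ * expR _).
  rewrite prodr_const; congr (_ ^+ _).
  by rewrite -[RHS]Hs; apply: eq_card => e; rewrite inE unfold_in; case: (H e).
congr (- (_ * _)).
  have HC : gcomp (rel H) ord0 = [set: 'I_s.+1]%SET.
    by rewrite -(@small_ball _ _ _ s.+1) HT ?finset.cardsT ?card_ord.
  by rewrite -gcomp_sub_ball HC finset.cardsT card_ord.
by rewrite (big_pred1 true) // => -[].
Qed.

Lemma density_ge0 b s : 0 <= b -> 0 <= density b s.
Proof. by move=> b0; rewrite !mulr_ge0 ?invr_ge0 ?exprn_ge0 ?expR_ge0. Qed.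

(** Probability that a given vertex has a component of size at most [K]. *)
Definition small_prob n (p : R) K : R :=
  \sum_(s < K) ball_mean false (fun _ _ _ => 1) s s n (bern p).

Lemma local_one r : local false r (fun n (_ : {ffun edge n -> bool}) (_ : 'I_n) => 1 : R).
Proof. by []. Qed.

(** A component of at most [K] vertices is a ball of radius [K], explored with
    the constant function 1. *)
Lemma small_probE n p K (u : 'I_n) : 0 <= p <= 1 ->
  'P[n, p] (fun c => (#|gcomp (rel c) u| <= K)%N%:R) = small_prob n p K.
Proof.
move=> p01; rewrite /small_prob.
under [RHS]eq_bigr do rewrite -(explore_mean _ u (@local_one _) (bern_law p01)).
rewrite -pexp_sum; apply: eq_pexp => c.
under [RHS]eq_bigr do rewrite card_ball_comp mulr1.
have C0 : (0 < #|gcomp (rel c) u|)%N by apply/card_gt0P; exists u; exact: gcomp_center.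
case: leqP => CK; last first.
  rewrite big1 // => s _; case: eqP => // E; move: CK; rewrite E ltnS.
  by rewrite leqNgt ltn_ord.
have sK : (#|gcomp (rel c) u|.-1 < K)%N by rewrite prednK.
rewrite (bigD1 (Ordinal sK)) //= prednK // eqxx big1 ?addr0 // => s ns.
by case: eqP => // E; case/eqP: ns; apply: val_inj; rewrite /= E.
Qed.

Definition small_mass b K : R := \sum_(s < K) density b s.

Lemma small_prob_cvg (p : nat -> R) b K : (forall n, 0 <= p n <= 1) ->
  (fun n => n%:R * p n) @ \oo --> b ->
  (fun n => small_prob n (p n) K) @ \oo --> small_mass b K.
Proof.
move=> p01 pb; apply: cvg_sumr => s _; rewrite -ball_limit_density.
exact: ball_mean_cvg (bern_sparse p01 pb) _ _ _.
Qed.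

Definition prob_of b n : R := Num.min 1 (b / n%:R).

Lemma prob_of01 b n : 0 <= b -> 0 <= prob_of b n <= 1.
Proof. by move=> b0; rewrite /prob_of le_min ler01 divr_ge0 //= ge_min lexx. Qed.

Lemma prob_ofE b : \forall n \near \oo, prob_of b n = b / n%:R.
Proof.
near=> n; rewrite /prob_of; apply/min_idPr.
have n0 : 0 < n%:R :> R by rewrite ltr0n; near: n; exact: nbhs_infty_gt.
by rewrite ler_pdivrMr // mul1r; near: n; exact: nbhs_infty_ger.
Unshelve. all: by end_near. Qed.

Lemma prob_of_cvg b : (fun n => n%:R * prob_of b n) @ \oo --> b.
Proof.
apply: (@cvg_near_eq _ _ (fun=> b)); last exact: cvg_cst.
near=> n; rewrite (_ : prob_of b n = b / n%:R); last by near: n; exact: prob_ofE.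
rewrite mulrC divfK // pnatr_eq0 -lt0n; near: n; exact: nbhs_infty_gt.
Unshelve. all: by end_near. Qed.

Lemma limit_small_prob b K : 0 <= b ->
  (fun n => small_prob n (prob_of b n) K) @ \oo --> small_mass b K.
Proof.
by move=> b0; apply: small_prob_cvg => [n|]; [exact: prob_of01|exact: prob_of_cvg].
Qed.

(** A limit of probabilities. *)
Lemma small_mass_le1 b K : 0 <= b -> small_mass b K <= 1.
Proof.
move=> b0; rewrite -(cvg_lim _ (@limit_small_prob b K b0)) //; apply: limr_le.
  by apply/cvg_ex; eexists; exact: limit_small_prob.
near=> n.
have n0 : (0 < n)%N by near: n; exact: nbhs_infty_gt.
rewrite -(small_probE _ (Ordinal n0)) ?prob_of01 //.
have lw : is_law (fun _ : edge n => bern (prob_of b n)).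
  by move=> e; apply: bern_law; exact: prob_of01.
by rewrite -[leRHS](pexp_cst _ lw); apply: ler_pexp => // c; case: (_ <= _)%N.
Unshelve. all: by end_near. Qed.

Lemma small_mass_mono b K K' : 0 <= b -> (K <= K')%N -> small_mass b K <= small_mass b K'.
Proof.
move=> b0 /subnKC <-; rewrite /small_mass big_split_ord /= lerDl.
by apply: sumr_ge0 => s _; exact: density_ge0.
Qed.

(** For [b < 1] the mean component size is at most [1 / (1 - b)], so that
    Markov's inequality applies. *)
Lemma small_mass_subcritical b K : 0 <= b < 1 -> (0 < K)%N ->
  1 - ((1 - b) * K%:R)^-1 <= small_mass b K.
Proof.
move=> /andP[b0 b1] K0.
have b1' : 0 < 1 - b by rewrite subr_gt0.
have K0' : 0 < K%:R :> R by rewrite ltr0n.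
rewrite -(cvg_lim _ (@limit_small_prob b K b0)) //; apply: limr_ge.
  by apply/cvg_ex; eexists; exact: limit_small_prob.
near=> n.
have n0 : (0 < n)%N by near: n; exact: nbhs_infty_gt.
have pn : prob_of b n = b / n%:R by near: n; exact: prob_ofE.
set u := Ordinal n0.
have pl := prob_of01 n b0.
have lw : is_law (fun _ : edge n => bern (prob_of b n)) by move=> e; exact: bern_law.
rewrite -(small_probE _ u) //.
have EC : 'P[n, prob_of b n] (fun c => #|gcomp (rel c) u|%:R) <= (1 - b)^-1.
  rewrite (@eq_pexp _ _ _ _ _ (fun c => #|gball (rel c) u n|%:R)); last first.
    by move=> c; rewrite -gcomp_sub_ball // (leq_trans (max_card _)) // card_ord leqnSn.
  apply: le_trans (pexp_card_ball false (predC1 false) (bern_law pl) u n) _.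
  rewrite big_bool /= mulr0 addr0 mulr1 pn mulrC divfK ?pnatr_eq0 -?lt0n //.
  rewrite -[leRHS]mul1r ler_pdivlMr // mulrC -[1 - b]opprB mulNr -subrX1 opprB.
  by rewrite lerBlDr lerDl exprn_ge0.
rewrite lerBlDl.
rewrite -[leLHS](pexp_cst _ lw).
apply: (@le_trans _ _ ('P[n, prob_of b n] (fun c => K%:R^-1 * #|gcomp (rel c) u|%:R
     + (#|gcomp (rel c) u| <= K)%N%:R))).
  apply: ler_pexp => // c; case: leqP => CK; first by rewrite lerDr mulr_ge0 ?invr_ge0.
  by rewrite addr0 mulrC ler_pdivlMr // mul1r ler_nat ltnW.
by rewrite pexpD pexpZ lerD2r invfM mulrC; apply: ler_wpM2r.
Unshelve. all: by end_near. Qed.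

Definition tree_series K (x : R) := \sum_(s < K) tree_coef s * x ^+ s.+1.

Lemma tree_coef_ge0 s : 0 <= tree_coef s.
Proof. by rewrite mulr_ge0 ?invr_ge0. Qed.

(** Up to the factor [b], the densities are the terms of a power series in
    [b exp (- b)] with nonnegative coefficients. *)
Lemma density_tree b s : b * density b s = tree_coef s * (b * expR (- b)) ^+ s.+1.
Proof.
rewrite /density mulrCA; congr (_ * _).
by rewrite mulrA -exprS exprMn -expRM_natl mulrN.
Qed.

Lemma small_mass_tree b K : b * small_mass b K = tree_series K (b * expR (- b)).
Proof. by rewrite /small_mass mulr_sumr; apply: eq_bigr => s _; exact: density_tree. Qed.

Lemma tree_series_le K x y : 0 <= x <= y -> tree_series K x <= tree_series K y.
Proof.
move=> /andP[x0 xy]; apply: ler_sum => s _; apply: ler_wpM2l; first exact: tree_coef_ge0.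
by rewrite lerXn2r ?nnegrE // (le_trans x0).
Qed.

(** The function [b exp (- b)] is maximal at [b = 1]. *)
Lemma mul_expRN_le (b : R) : b * expR (- b) <= expR (- 1).
Proof.
rewrite -(ler_pdivlMr _ _ (expR_gt0 (- b))) -(expRN (- b)) opprK -expRD.
by apply: le_trans (expR_ge1Dx _); rewrite addrA subrr add0r.
Qed.

Lemma tree_series_e K : tree_series K (expR (- 1)) = small_mass 1 K.
Proof. by rewrite -[RHS]mul1r small_mass_tree mul1r. Qed.

(** By [small_mass_tree], [b * small_mass b K] is largest at [b = 1], where it is
    at most one. *)
Lemma small_mass_supercritical b K : 0 < b -> small_mass b K <= b^-1.
Proof.
move=> b0; rewrite -[leRHS]mul1r ler_pdivlMr // mulrC small_mass_tree.
apply: le_trans (small_mass_le1 K ler01); rewrite -tree_series_e.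
by apply: tree_series_le; rewrite mul_expRN_le mulr_ge0 ?expR_ge0 // ltW.
Qed.

(** At [b = 1] the value is the left limit, by comparing power series. *)
Lemma small_mass_critical b (eps : R) : 0 <= b <= 1 -> 0 < eps ->
  exists K, 1 - eps <= small_mass b K.
Proof.
move=> /andP[b0 b1] e0.
have [e1|e1] := leP 1 eps.
  by exists 0%N; rewrite /small_mass big_ord0 subr_le0.
have sub b' e' : 0 <= b' < 1 -> 0 < e' -> exists K, 1 - e' <= small_mass b' K.
  move=> /andP[b'0 b'1] e'0.
  have d0 : 0 < 1 - b' by rewrite subr_gt0.
  have [K] : exists K, ((1 - b') * e')^-1 < K%:R.
    by exists (Num.bound ((1 - b') * e')^-1); apply: le_lt_trans (archi_boundP _); rewrite ?invr_ge0 ?mulr_ge0 // ltW.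
  move=> HK.
  have K0 : 0 < K%:R :> R by apply: le_lt_trans HK; rewrite invr_ge0 mulr_ge0 // ltW.
  exists K; apply: le_trans (small_mass_subcritical _ _); last 2 first.
  - by rewrite b'0.
  - by rewrite -(ltr0n R).
  move: HK; rewrite -div1r ltr_pdivrMr ?mulr_gt0 // => HK.
  rewrite lerD2l lerN2 -div1r ler_pdivrMr ?mulr_gt0 //.
  by apply: ltW; rewrite (_ : e' * _ = K%:R * ((1 - b') * e')) //; ring.
move: b1; rewrite le_eqVlt => /orP[/eqP ->|b1]; last by apply: sub => //; rewrite b0.
have [||K HK] := sub (1 - eps / 2) (eps / 2).
- by apply/andP; split; lra.
- by rewrite divr_gt0.
exists K; apply: (@le_trans _ _ ((1 - eps / 2) * small_mass (1 - eps / 2) K)).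
  apply: (@le_trans _ _ ((1 - eps / 2) * (1 - eps / 2))); first by nra.
  by apply: ler_wpM2l => //; lra.
rewrite small_mass_tree -tree_series_e; apply: tree_series_le.
by rewrite mul_expRN_le mulr_ge0 ?expR_ge0 //; lra.
Qed.

Lemma small_mass_cvg (b : nat -> R) l K : b @ \oo --> l ->
  (fun m => small_mass (b m) K) @ \oo --> small_mass l K.
Proof.
move=> bl; apply: cvg_sumr => s _.
apply: cvgM; first exact: cvg_cst.
apply: cvgM; first exact: cvg_exprn.
have : (fun m => - (s.+1%:R * b m)) @ \oo --> - (s.+1%:R * l).
  by apply: cvgN; apply: cvgM => //; exact: cvg_cst.
by apply: continuous_cvg; exact: continuous_expR.
Qed.

(** Left continuity, uniformly in the cutoff [K]: the tails of the series in
    [b exp (- b)] are dominated by its tails at [1 / e], where it converges. *)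
Lemma small_mass_left_continuous b (eps : R) : 0 < b -> 0 < eps ->
  exists2 h : R, 0 < h < b & exists K0, forall K, (K0 <= K)%N ->
    small_mass (b - h) K - small_mass b K <= eps.
Proof.
move=> b0 e0.
have inc : nondecreasing_seq (small_mass 1).
  by apply/nondecreasing_seqP => K; apply: small_mass_mono.
have cv : cvgn (small_mass 1).
  apply: nondecreasing_is_cvgn => //; exists 1 => _ [K _ <-].
  exact: small_mass_le1.
have d0 : 0 < eps * b / 4 by rewrite divr_gt0 ?mulr_gt0.
have [K0 HK0] := filter_ex (cvg_dist cv d0).
pose bm m := b - b / 2 * m.+1%:R^-1.
have bmb : bm @ \oo --> b.
  rewrite -[X in _ --> X]subr0; apply: cvgB; first exact: cvg_cst.
  by rewrite -(mulr0 (b / 2)); apply: cvgM; [exact: cvg_cst|exact: cvg_harmonic].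
have e2 : 0 < eps / 2 by rewrite divr_gt0.
have [m Hm] := filter_ex (cvg_dist (@small_mass_cvg _ _ K0 bmb) e2).
exists (b / 2 * m.+1%:R^-1).
  rewrite mulr_gt0 ?divr_gt0 ?invr_gt0 //=.
  apply: (@le_lt_trans _ _ (b / 2)); last by lra.
  by rewrite -[leRHS]mulr1 ler_wpM2l ?invf_le1 ?ler1n // divr_ge0 // ltW.
exists K0 => K HK; rewrite -/(bm m).
have bm2 : b / 2 <= bm m.
  have : b / 2 * m.+1%:R^-1 <= b / 2.
    by rewrite -[leRHS]mulr1 ler_wpM2l ?invf_le1 ?ler1n // divr_ge0 // ltW.
  by rewrite /bm; set x := b / 2 * _; lra.
have bm0 : 0 < bm m by apply: lt_le_trans bm2; rewrite divr_gt0.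
(* The terms up to [K0] are continuous in [b]; the others are dominated. *)
have tail x : small_mass x K = small_mass x K0 + \sum_(i < K - K0) density x (K0 + i).
  by rewrite -{1}(subnKC HK) /small_mass big_split_ord.
have t1 : \sum_(i < K - K0) density (bm m) (K0 + i) <= eps / 2.
  apply: (@le_trans _ _ ((bm m)^-1 * \sum_(i < K - K0) density 1 (K0 + i))).
    rewrite mulrC ler_pdivlMr // mulrC mulr_sumr; apply: ler_sum => i _.
    rewrite density_tree -[leRHS]mul1r density_tree mul1r.
    apply: ler_wpM2l; first exact: tree_coef_ge0.
    by rewrite lerXn2r ?nnegrE ?mulr_ge0 ?expR_ge0 ?mul_expRN_le // ltW.
  have H1 : \sum_(i < K - K0) density 1 (K0 + i) <= eps * b / 4.
    rewrite -[leLHS](addKr (small_mass 1 K0)) -tail addrC.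
    apply: le_trans HK0; apply: le_trans (ler_norm _).
    by rewrite lerD2r; apply: nondecreasing_cvgn_le.
  apply: (@le_trans _ _ ((b / 2)^-1 * (eps * b / 4))).
    apply: ler_pM => //; first by rewrite invr_ge0 ltW.
      by apply: sumr_ge0 => i _; exact: density_ge0.
    by rewrite lef_pV2 ?posrE ?divr_gt0.
  by rewrite le_eqVlt; apply/orP; left; apply/eqP; field; rewrite gt_eqF.
have t2 : 0 <= \sum_(i < K - K0) density b (K0 + i).
  by apply: sumr_ge0 => i _; apply: density_ge0; exact: ltW.
rewrite !tail.
have : `|small_mass (bm m) K0 - small_mass b K0| <= eps / 2 by rewrite distrC.
by move=> /(le_trans (ler_norm _)); lra.
Qed.

End ComponentDensities.

(** * Uniqueness of the large component *)

Section Hybrid.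
Context {R : realType} {I : finType}.
Implicit Types (p q : I -> R) (f : {ffun I -> bool} -> R).

(** The edges of [s] have already been raised from [p] to [q]. *)
Definition hybrid p q (s : seq I) i : R := if i \in s then q i else p i.

(** The expectation is affine in the probability of each edge. *)
Lemma hybrid_step p q s i f : is_law (fun j => bern (hybrid p q s j)) -> i \notin s ->
  pexp (fun j => bern (hybrid p q (i :: s) j)) f - pexp (fun j => bern (hybrid p q s j)) f =
  (q i - p i) * pexp (fun j => bern (hybrid p q s j))
                  (fun c => f (upd c i true) - f (upd c i false)).
Proof.
move=> lw ns.
rewrite (@pexp_resample _ _ _ (fun j => bern (hybrid p q s j)) _ i) //; last first.
  by move=> j ji v; rewrite /hybrid inE (negPf ji).
rewrite [X in _ - X](pexp_upd i) // -pexpB -pexpZ; apply: eq_pexp => c.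
by rewrite !big_bool /bern /hybrid /= inE eqxx (negPf ns) /=; ring.
Qed.

Definition increasing f := forall c i, f (upd c i false) <= f (upd c i true).

Lemma pexp_increasing p q s f : (forall i, 0 <= p i <= q i) -> (forall i, q i <= 1) ->
  increasing f -> uniq s ->
  pexp (fun j => bern (p j)) f <= pexp (fun j => bern (hybrid p q s j)) f.
Proof.
move=> pq q1 inc; elim: s => [|i s IH] //= /andP[ns us].
apply: le_trans (IH us) _; rewrite -subr_ge0 hybrid_step //; last first.
  move=> j; apply: bern_law; rewrite /hybrid; have /andP[p0 le] := pq j; have := q1 j.
  by case: ifP => _ ?; apply/andP; split => //; lra.
apply: mulr_ge0; first by rewrite subr_ge0; case/andP: (pq i).
apply: pexp_ge0 => [j|c]; last by rewrite subr_ge0.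
apply: bern_law; rewrite /hybrid; have /andP[p0 le] := pq j; have := q1 j.
by case: ifP => _ ?; apply/andP; split => //; lra.
Qed.

Lemma pexp_mono p q f : (forall i, 0 <= p i <= q i) -> (forall i, q i <= 1) ->
  increasing f -> pexp (fun j => bern (p j)) f <= pexp (fun j => bern (q j)) f.
Proof.
move=> pq q1 inc; have := pexp_increasing pq q1 inc (enum_uniq I).
rewrite (_ : (fun j => bern (hybrid p q (enum I) j)) = fun j => bern (q j)) //.
by apply/funext => j; rewrite /hybrid mem_enum.
Qed.

End Hybrid.

Section Uniqueness.
Context {R : realType}.
Variable (n : nat).
Implicit Types (c : {ffun edge n -> bool}).

Notation rel c := (orel false (predC1 false) c).
Notation C c u := (gcomp (rel c) u).
Notation "''P' [ n , p ] f" := (pexp (fun _ : edge n => bern p) f)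
  (at level 10, n, p at level 9, f at level 9).

Lemma relE c u v : rel c u v = mark false c u v.
Proof. by rewrite /orel /=; case: (mark _ _ _ _). Qed.

Lemma gcomp_mono c c' u : (forall e, c e ==> c' e) -> C c u \subset C c' u.
Proof.
move=> cc'; apply/fintype.subsetP => v; rewrite !inE; apply: connect_sub => x y.
rewrite relE => xy; apply: connect1; rewrite relE; move: xy.
rewrite /mark /mark_set; case: insub => // e; exact/implyP.
Qed.

Definition big K c u : bool := (K < #|C c u|)%N.

Definition both_big K c u v := big K c u && big K c v.

(** Two vertices in distinct large components: there are few such pairs exactly
    when the large component is essentially unique. *)
Definition split_pair K c u v := both_big K c u v && (v \notin C c u).

Lemma big_mono K c c' u : (forall e, c e ==> c' e) -> big K c u -> big K c' u.
Proof. by move=> cc' /leq_trans; apply; apply: subset_leq_card; exact: gcomp_mono. Qed.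

Lemma split_pairE K c u v :
  (split_pair K c u v)%:R = (both_big K c u v)%:R - (big K c u && (v \in C c u))%:R :> R.
Proof.
rewrite /split_pair /both_big; case: (boolP (v \in C c u)) => vC /=.
  have -> : big K c v = big K c u.
    rewrite /big (gcomp_same _ vC) //; exact: orel_sym.
  by rewrite andbb !andbT andbF subrr.
by rewrite !andbT andbF subr0.
Qed.

(** Without the edge between [u] and [v], so that the result is independent of
    that edge. *)
Definition cut_edge c u v : {ffun edge n -> bool} :=
  [ffun e => (val e != [set u; v]%SET) && c e].

Lemma cut_edge_upd c (e : edge n) u v : val e = [set u; v]%SET -> upd c e false = cut_edge c u v.
Proof.
move=> E; apply/ffunP => e'; rewrite updE ffunE -E (inj_eq val_inj).
by case: eqP.
Qed.

Lemma upd_mono c e e' : upd c e false e' ==> upd c e true e'.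
Proof. rewrite !updE; case: (e' == e); [exact: isT|exact: implybb]. Qed.

(** An added edge merges the components of its ends. *)
Lemma gcomp_add c (e : edge n) u v x : val e = [set u; v]%SET ->
  let c0 := upd c e false in let c1 := upd c e true in
  C c1 x = (if (x \in C c0 u) || (x \in C c0 v) then C c0 u :|: C c0 v else C c0 x)%SET.
Proof.
move=> E c0 c1.
have s0 := @orel_sym _ false n (predC1 false) c0.
have s1 := @orel_sym _ false n (predC1 false) c1.
have sub y : C c0 y \subset C c1 y by apply: gcomp_mono; exact: upd_mono.
have uv1 : v \in C c1 u.
  by rewrite inE; apply: connect1; rewrite relE mark_upd E eqxx.
have step y z : rel c1 y z -> [set y; z]%SET = [set u; v]%SET \/ rel c0 y z.
  rewrite !relE !mark_upd E; case: eqP => [-> _|ne]; first by left.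
  by right.
case: ifP => [xuv|/negbT]; last first.
  rewrite negb_or => /andP[xu xv].
  apply: gcomp_eq; [exact: gcomp_center|exact: sub|].
  move=> y z yx /step[yz|]; last exact: gcomp_closed yx.
  have : y \in [set u; v]%SET by rewrite -yz !inE eqxx.
  rewrite !inE => /orP[] /eqP yE; move: yx; rewrite yE (in_compC s0).
    by rewrite (negPf xu).
  by rewrite (negPf xv).
have uvsub : (C c0 u :|: C c0 v)%SET \subset C c1 u.
  rewrite finset.subUset sub /= -(gcomp_same s1 uv1); exact: sub.
have xin : x \in (C c0 u :|: C c0 v)%SET by rewrite inE.
have xu : x \in C c1 u := fintype.subsetP uvsub _ xin.
rewrite (gcomp_same s1 xu); apply: gcomp_eq; rewrite ?uvsub //.
  by rewrite inE gcomp_center.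
move=> y z; rewrite !finset.in_setU => yuv /step[yz|y0z]; last first.
  by case/orP: yuv => /gcomp_closed/(_ y0z) ->; rewrite ?orbT.
have : z \in [set u; v]%SET by rewrite -yz !inE eqxx orbT.
by rewrite !inE => /orP[] /eqP ->; rewrite connect0 ?orbT.
Qed.

(** The truncated reciprocal of the component size: summed over a component
    of size [x] it gives [min (x / K.+1) 1]. *)
Definition inv_size K c u : R := Num.min (K.+1%:R^-1) (#|C c u|%:R^-1).

Lemma gcomp_gt0 c u : (0 < #|C c u|)%N.
Proof. by apply/card_gt0P; exists u; exact: gcomp_center. Qed.

Lemma mul_min_inv (K x : nat) : (0 < x)%N ->
  x%:R * Num.min (K.+1%:R^-1) (x%:R^-1) = Num.min (x%:R / K.+1%:R) 1 :> R.
Proof. by move=> x0; rewrite minr_pMr // divff // pnatr_eq0 -lt0n. Qed.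

(** Subadditivity of [min (x / K.+1) 1], which loses one when both terms are
    truncated. *)
Lemma min_ratio_add K (x y : nat) :
  Num.min ((x + y)%:R / K.+1%:R) 1 + ((K < x) && (K < y))%N%:R <=
  Num.min (x%:R / K.+1%:R) 1 + Num.min (y%:R / K.+1%:R) 1 :> R.
Proof.
have K0 : 0 < K.+1%:R :> R by rewrite ltr0n.
have mE z : Num.min (z%:R / K.+1%:R) 1 = if (K < z)%N then 1 else z%:R / K.+1%:R :> R.
  case: ltnP => zK; first by apply/min_idPr; rewrite ler_pdivlMr // mul1r ler_nat.
  by apply/min_idPl; rewrite ler_pdivrMr // mul1r ler_nat leqW.
rewrite [in leRHS]mE [in leRHS]mE.
have l1 : Num.min ((x + y)%:R / K.+1%:R) 1 <= 1 :> R by rewrite ge_min lexx orbT.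
have l2 : Num.min ((x + y)%:R / K.+1%:R) 1 <= x%:R / K.+1%:R + y%:R / K.+1%:R :> R.
  by rewrite -mulrDl -natrD ge_min lexx.
have x0 : 0 <= x%:R / K.+1%:R :> R by rewrite divr_ge0.
have y0 : 0 <= y%:R / K.+1%:R :> R by rewrite divr_ge0.
move: l1 l2 x0 y0; set m := Num.min _ _; set a := x%:R / _; set b := y%:R / _.
by case: ltnP => xK; case: ltnP => yK /=; rewrite ?addr0; lra.
Qed.

(** Joining two components of size larger than [K] loses a full unit of
    the sum of truncated reciprocals; joining other components never gains. *)
Lemma sum_inv_size_add K c (e : edge n) u v : val e = [set u; v]%SET ->
  \sum_x inv_size K (upd c e true) x + (split_pair K (upd c e false) u v)%:R <=
  \sum_x inv_size K (upd c e false) x.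
Proof.
move=> E; set c0 := upd c e false; set c1 := upd c e true.
have s0 := @orel_sym _ false n (predC1 false) c0.
have CE := fun x => gcomp_add c x E; rewrite -/c0 -/c1 in CE.
case: (boolP (v \in C c0 u)) => vu.
  rewrite /split_pair vu andbF addr0 le_eqVlt; apply/orP; left; apply/eqP.
  apply: eq_bigr => x _; rewrite /inv_size CE (gcomp_same s0 vu) orbb finset.setUid.
  by case: ifP => // /(gcomp_same s0) ->.
rewrite /split_pair vu andbT.
have dis : [disjoint C c0 u & C c0 v].
  apply/pred0P => x /=; apply/negbTE/negP => /andP[xu xv].
  by case/negP: vu; rewrite -(gcomp_same s0 xu) (gcomp_same s0 xv) gcomp_center.
have cU : #|C c0 u :|: C c0 v|%SET = (#|C c0 u| + #|C c0 v|)%N.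
  by apply/eqP; rewrite (leq_card_setU (C c0 u) (C c0 v)).2.
rewrite (bigID (mem (C c0 u :|: C c0 v)%SET)) [leRHS](bigID (mem (C c0 u :|: C c0 v)%SET)) /=.
rewrite addrAC; apply: lerD; last first.
  apply: ler_sum => x; rewrite finset.in_setU => /negPf nx.
  by rewrite /inv_size CE nx.
rewrite [leRHS](eq_bigl (fun x => x \in [predU C c0 u & C c0 v])); last first.
  by move=> x; rewrite finset.in_setU.
rewrite [leRHS]bigU //=.
have -> : \sum_(x in (C c0 u :|: C c0 v)%SET) inv_size K c1 x =
    Num.min ((#|C c0 u| + #|C c0 v|)%:R / K.+1%:R) 1.
  rewrite -mul_min_inv ?addn_gt0 ?gcomp_gt0 // mulr_natl -cU -sumr_const.
  by apply: eq_bigr => x; rewrite finset.in_setU /inv_size CE => ->.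
have part z : \sum_(x in C c0 z) inv_size K c0 x = Num.min (#|C c0 z|%:R / K.+1%:R) 1.
  rewrite -mul_min_inv ?gcomp_gt0 // mulr_natl -sumr_const.
  by apply: eq_bigr => x xz; rewrite /inv_size (gcomp_same s0 xz).
by rewrite !part; exact: min_ratio_add.
Qed.

End Uniqueness.

Section SplitPairs.
Context {R : realType}.
Variables (n K : nat).
Implicit Types (c : {ffun edge n -> bool}) (p q : R).

Notation rel c := (orel false (predC1 false) c).
Notation C c u := (gcomp (rel c) u).
Notation E p f := (pexp (fun _ : edge n => bern p) f).

Lemma increasing_bool (Q : {ffun edge n -> bool} -> bool) :
  (forall c c', (forall e, c e ==> c' e) -> Q c -> Q c') ->
  increasing (fun c => (Q c)%:R : R).
Proof.
move=> QQ c i; rewrite ler_nat.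
by case: (boolP (Q (upd c i false))) => // /QQ -> // e; exact: upd_mono.
Qed.

Lemma both_big_mono c c' u v : (forall e, c e ==> c' e) ->
  both_big K c u v -> both_big K c' u v.
Proof. by move=> cc' /andP[bu bv]; apply/andP; split; exact: big_mono cc' _. Qed.

Lemma cut_edge_mono c c' u v : (forall e, c e ==> c' e) ->
  forall e, cut_edge c u v e ==> cut_edge c' u v e.
Proof. by move=> cc' e; rewrite !ffunE; case: (_ != _); [exact: cc'|]. Qed.

Lemma connected_big_mono c c' u v : (forall e, c e ==> c' e) ->
  big K c u && (v \in C c u) -> big K c' u && (v \in C c' u).
Proof.
move=> cc' /andP[bu vu]; rewrite (big_mono cc' bu) /=.
by apply: fintype.subsetP vu; exact: gcomp_mono.
Qed.

Lemma E_mono p q f : 0 <= p <= q -> q <= 1 -> increasing f -> E p f <= E q f.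
Proof. by move=> pq q1; apply: pexp_mono. Qed.

(** A lower bound for the probability that [u] and [v] are a split pair once the
    edge between them is cut, valid at all densities between [p] and [q]: each of the two increasing events is
    evaluated at the density that is unfavorable. *)
Definition split_bound p q u v : R :=
  E p (fun c => (both_big K (cut_edge c u v) u v)%:R) -
  E q (fun c => (big K c u && (v \in C c u))%:R).

(** Opening all edges one after another, each new edge sees a configuration
    whose law lies between the two extreme ones. *)
Lemma sum_split_le p q : 0 <= p <= q -> q <= 1 ->
  (q - p) * \sum_u \sum_(v | u != v) split_bound p q u v <= 2 * n%:R / K.+1%:R.
Proof.
move=> /andP[p0 pq] q1; set Y := split_bound p q.
pose f c : R := \sum_x inv_size K c x.
have hyb01 s j : 0 <= hybrid (fun _ : edge n => p) (fun=> q) s j <= q.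
  by rewrite /hybrid; case: ifP => _; rewrite ?lexx ?p0 ?(le_trans p0).
have hlaw s : is_law (fun j => bern (hybrid (fun _ : edge n => p) (fun=> q) s j)).
  move=> j; apply: bern_law; have /andP[-> h] := hyb01 s j; exact: le_trans h q1.
(* Each edge stands for two ordered pairs, hence the factor 2. *)
have card2 (e : edge n) : #|[pred x : 'I_n * 'I_n | val e == [set x.1; x.2]%SET]| = 2%N.
  have [u [v [uv ->]]] := edgeP e.
  rewrite (eq_card (_ : _ =i [set (u, v); (v, u)]%SET)).
    by rewrite finset.cards2 xpair_eqE (negPf uv).
  move=> [a b]; rewrite !inE !xpair_eqE /=; apply/eqP/orP => [Eab|]; last first.
    by case=> /andP[/eqP -> /eqP ->] //; rewrite finset.setUC.
  have : u \in [set a; b]%SET by rewrite -Eab !inE eqxx.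
  have : v \in [set a; b]%SET by rewrite -Eab !inE eqxx orbT.
  rewrite !inE => /orP[] /eqP va /orP[] /eqP ua.
  - by rewrite ua va eqxx in uv.
  - by right; rewrite ua va !eqxx.
  - by left; rewrite ua va !eqxx.
  - by rewrite ua va eqxx in uv.
(* Telescoping over the edges raised from [p] to [q] one at a time. *)
have tele s : uniq s ->
    2 * (pexp (fun j => bern (hybrid (fun _ : edge n => p) (fun=> q) s j)) f - E p f)
    + (q - p) * \sum_(e <- s) \sum_(x : 'I_n * 'I_n | val e == [set x.1; x.2]%SET) Y x.1 x.2 <= 0.
  elim: s => [_|e s IH /= /andP[es us]].
    rewrite big_nil mulr0 addr0 (_ : pexp _ f = E p f) ?subrr ?mulr0 //.
  have {}IH := IH us.
  rewrite big_cons.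
  set hs := pexp (fun j => bern (hybrid _ _ s j)) in IH *.
  suff step : 2 * (pexp (fun j => bern (hybrid (fun=> p) (fun=> q) (e :: s) j)) f - hs f)
     + (q - p) * \sum_(x : 'I_n * 'I_n | val e == [set x.1; x.2]%SET) Y x.1 x.2 <= 0.
    by move: step IH; lra.
  rewrite /hs hybrid_step // -/hs mulrCA -mulrDr.
  apply: mulr_ge0_le0; first by rewrite subr_ge0.
  rewrite -lerBrDl sub0r.
  have -> : - (2 * hs (fun c => f (upd c e true) - f (upd c e false))) =
      hs (fun c => \sum_(x : 'I_n * 'I_n | val e == [set x.1; x.2]%SET)
           (f (upd c e false) - f (upd c e true))).
    rewrite -mulrN -pexpN -pexpZ; apply: eq_pexp => c.
    by rewrite sumr_const card2 opprB mulr_natl.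
  rewrite /hs pexp_sum; apply: ler_sum => -[u v] /= /eqP Euv; rewrite /Y /split_bound.
  apply: (@le_trans _ _ (hs (fun c => (split_pair K (cut_edge c u v) u v)%:R))); last first.
    apply: ler_pexp => // c; rewrite -(cut_edge_upd c Euv) lerBrDl.
    exact: sum_inv_size_add.
  rewrite /hs (eq_pexp _ (fun c => split_pairE K (cut_edge c u v) u v)) pexpB.
  apply: lerB.
    apply: pexp_increasing => //; first by rewrite p0.
    apply: increasing_bool => c c' cc'; apply: both_big_mono; exact: cut_edge_mono.
  apply: (@le_trans _ _ (hs (fun c => (big K c u && (v \in C c u))%:R))).
    apply: ler_pexp => // c; rewrite ler_nat.
    case: (boolP (big K (cut_edge c u v) u && _)) => // /connected_big_mono -> //.
    by move=> e'; rewrite ffunE; apply/implyP => /andP[].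
  apply: pexp_mono => //.
  apply: increasing_bool => c c' cc'; exact: connected_big_mono.
have Eend : pexp (fun j => bern (hybrid (fun _ : edge n => p) (fun=> q) (enum (edge n : finType)) j)) f
    = E q f.
  congr (pexp _ f); apply/funext => j; by rewrite /hybrid mem_enum.
have := tele (enum (edge n : finType)) (enum_uniq _); rewrite {}Eend.
rewrite big_enum /= (_ : \sum_e _ = \sum_u \sum_(v | u != v) Y u v); last first.
  rewrite (exchange_big_dep predT) //= [RHS]pair_big_dep /= [RHS]big_mkcond.
  apply: eq_bigr => -[u v] _ /=; case: (eqVneq u v) => [<-|uv].
    rewrite big1 // => e /eqP ee; have : #|sval e| == 2%N := valP e.
    by rewrite ee finset.setUid finset.cards1.
  rewrite (big_pred1 (edge_of uv)) // => e; by rewrite /= -(inj_eq val_inj).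
have f0 c : 0 <= f c <= n%:R / K.+1%:R.
  apply/andP; split.
    by apply: sumr_ge0 => x _; rewrite le_min !invr_ge0 !ler0n.
  rewrite mulr_natl -[X in _ *+ X]card_ord -sumr_const; apply: ler_sum => x _.
  by rewrite ge_min lexx.
have lp r : 0 <= r <= 1 -> is_law (fun _ : edge n => bern r).
  by move=> r01 e; exact: bern_law.
have Eq0 : 0 <= E q f.
  apply: pexp_ge0 => [|c]; last by case/andP: (f0 c).
  by apply: lp; rewrite (le_trans p0 pq).
have Ep : E p f <= n%:R / K.+1%:R.
  have lpp : is_law (fun _ : edge n => bern p) by apply: lp; rewrite p0 (le_trans pq).
  by rewrite -[leRHS](pexp_cst _ lpp); apply: ler_pexp => // c; case/andP: (f0 c).
rewrite -mulrA; move: Ep Eq0; set A := E p f; set B := E q f; set D := n%:R / _; lra.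
Qed.

End SplitPairs.

Section FewSplitPairs.
Context {R : realType}.
Local Open Scope classical_set_scope.

Notation rel c := (orel false (predC1 false) c).
Notation C c u := (gcomp (rel c) u).
Notation E n p f := (pexp (fun _ : edge n => bern p) f).

Lemma pexp_big n K (p : R) (u : 'I_n) : 0 <= p <= 1 ->
  E n p (fun c => (big K c u)%:R) = 1 - small_prob n p K.
Proof.
move=> p01; have lw : is_law (fun _ : edge n => bern p) by move=> e; exact: bern_law.
rewrite -(small_probE K u p01); transitivity (E n p (fun c => 1 - (#|C c u| <= K)%N%:R)); last first.
  by rewrite pexpB pexp_cst.
apply: eq_pexp => c.
by rewrite /big; case: ltnP => _ /=; rewrite ?subrr ?subr0.
Qed.

(** By inclusion-exclusion, as the probability that one of the two vertices is in
    a large component increases with the density. *)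
Lemma pexp_both_big_le n K (p q : R) (u v : 'I_n) : 0 <= p <= q -> q <= 1 ->
  E n q (fun c => (both_big K c u v)%:R) <=
  E n p (fun c => (both_big K c u v)%:R) + 2 * (small_prob n p K - small_prob n q K).
Proof.
move=> /andP[p0 pq] q1.
have or_and (r : R) : 0 <= r <= 1 -> E n r (fun c => (both_big K c u v)%:R) =
    (1 - small_prob n r K) + (1 - small_prob n r K)
    - E n r (fun c => (big K c u || big K c v)%:R).
  move=> r01; rewrite -{1}(pexp_big K u r01) -(pexp_big K v r01) -pexpD -pexpB.
  apply: eq_pexp => c; rewrite /both_big.
  by case: (big K c u); case: (big K c v); rewrite /= ?addrK ?subr0 ?addr0 ?add0r ?subrr.
have p01 : 0 <= p <= 1 by rewrite p0 (le_trans pq q1).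
have q01 : 0 <= q <= 1 by rewrite q1 (le_trans p0 pq).
rewrite !or_and //.
have : E n p (fun c => (big K c u || big K c v)%:R) <=
       E n q (fun c => (big K c u || big K c v)%:R).
  apply: E_mono => //; first by rewrite p0.
  apply: increasing_bool => c c' cc' /orP[] /(big_mono cc') ->; rewrite ?orbT //.
set x := E n p _; set y := E n q _; lra.
Qed.

Lemma pexp_mark n (p : R) (u v : 'I_n) : 0 <= p <= 1 -> u != v ->
  E n p (fun c => (mark false c u v)%:R) = p.
Proof.
move=> p01 uv; have lw : is_law (fun _ : edge n => bern p) by move=> e; exact: bern_law.
rewrite (@eq_pexp _ _ _ _ _ (fun c : {ffun edge n -> bool} => (c (edge_of uv))%:R * 1)); last first.
  by move=> c; rewrite mulr1 (mark_edge false _ uv).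
rewrite (@pexp_indep _ _ _ _ _ (fun b : bool => b%:R)) // pexp_cst // mulr1.
by rewrite big_bool /= mulr1 mulr0 addr0.
Qed.

(** The pairs at density [q], compared with [split_bound]: the errors are the
    vertices that enter a large component between [p] and [q], and the edge
    between the two vertices, present with probability at most [p]. *)
Lemma split_pairs_le n K (p q : R) : 0 <= p < q -> q <= 1 ->
  E n q (fun c => \sum_u \sum_v (split_pair K c u v)%:R) <=
  n%:R ^+ 2 * (2 * (small_prob n p K - small_prob n q K) + p)
  + 2 * n%:R / K.+1%:R / (q - p).
Proof.
move=> /andP[p0 pq] q1.
have p01 : 0 <= p <= 1 by rewrite p0 (le_trans (ltW pq) q1).
have q01 : 0 <= q <= 1 by rewrite q1 (le_trans p0 (ltW pq)).
have pq' : 0 <= p <= q by rewrite p0 ltW.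
have lw : is_law (fun _ : edge n => bern p) by move=> e; exact: bern_law.
have [n0|n0] := posnP n.
  rewrite {1}(_ : n%:R = 0 :> R) ?n0 // expr0n mul0r add0r.
  apply: (@le_trans _ _ 0); last by rewrite !mulr_ge0 ?invr_ge0 ?subr_ge0 // ltW.
  rewrite (@eq_pexp _ _ _ _ _ (fun=> 0)) => [|c]; first by rewrite pexp0.
  by rewrite big1 // => -[].
set D := 2 * _ + p.
have D0 : 0 <= D.
  rewrite /D addr_ge0 // mulr_ge0 // subr_ge0.
  rewrite -lerN2 -(lerD2l 1) -!(pexp_big K (Ordinal n0)) //.
  by apply: E_mono => //; apply: increasing_bool => c c' cc'; exact: big_mono.
have pair u v : u != v -> E n q (fun c => (split_pair K c u v)%:R) <= split_bound K p q u v + D.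
  move=> uv; rewrite (eq_pexp _ (fun c => split_pairE K c u v)) pexpB /split_bound.
  have h1 := pexp_both_big_le K u v pq' q1.
  have h2 : E n p (fun c => (both_big K c u v)%:R) <=
            E n p (fun c => (both_big K (cut_edge c u v) u v)%:R) + p.
    rewrite -[X in _ + X](pexp_mark p01 uv) -pexpD; apply: ler_pexp => // c.
    case: (boolP (mark false c u v)) => m; first by apply: (@le_trans _ _ 1); rewrite ?lern1 ?leq_b1 ?lerDr.
    rewrite addr0 (_ : cut_edge c u v = c) //; apply/ffunP => e; rewrite ffunE.
    case: eqP => //= ee; apply/esym/negbTE; apply: contraNN m.
    by rewrite /mark -ee mark_set_val.
  by rewrite /D; move: h1 h2; lra.
rewrite pexp_sum.
apply: (@le_trans _ _ (\sum_u \sum_(v | u != v) (split_bound K p q u v + D))).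
  apply: ler_sum => u _; rewrite pexp_sum [leRHS]big_mkcond; apply: ler_sum => v _.
  case: (eqVneq u v) => [->|/pair //].
  rewrite (@eq_pexp _ _ _ _ _ (fun=> 0)) => [|c]; first by rewrite pexp0.
  by rewrite /split_pair gcomp_center andbF.
under eq_bigr do rewrite big_split; rewrite big_split [leLHS]addrC; apply: lerD.
  apply: (@le_trans _ _ (\sum_(u < n) \sum_(v < n) D)).
    apply: ler_sum => u _; rewrite [leLHS]big_mkcond; apply: ler_sum => v _; by case: ifP.
  by rewrite !sumr_const !card_ord -mulrnA -[leLHS]mulr_natl natrM expr2.
rewrite ler_pdivlMr ?subr_gt0 // mulrC; exact: sum_split_le.
Qed.

Variables (p : nat -> R) (b : R).
Hypotheses (p01 : forall n, 0 <= p n <= 1) (pb : (fun n => n%:R * p n) @ \oo --> b).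

(** The edges sprinkled between densities [b - h] and [b] would join most pairs
    of large components, unless such pairs are rare; [h] is chosen so small
    that few vertices enter large components meanwhile. *)
Lemma few_split_pairs (eps : R) : 0 < b -> 0 < eps ->
  exists K0, forall K, (K0 <= K)%N -> \forall n \near \oo,
    E n (p n) (fun c => \sum_u \sum_v (split_pair K c u v)%:R) <= eps * n%:R ^+ 2.
Proof.
move=> b0 e0.
have e8 : 0 < eps / 8 by rewrite divr_gt0.
have [h /andP[h0 hb] [K1 HK1]] := small_mass_left_continuous b0 e8.
have hb0 : 0 <= b - h by rewrite subr_ge0 ltW.
(* Twice [eps / 8] is for the vertices entering large components, and [eps / 4]
   for the edges that join two of these. *)
have [K2 HK2] : exists K2, 8 / (eps * h) < K2%:R.
  by exists (Num.bound (8 / (eps * h))); apply: le_lt_trans (archi_boundP _); rewrite ?divr_ge0 ?mulr_ge0 // ltW.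
exists (maxn K1 K2) => K; rewrite geq_max => /andP[K1K K2K].
pose p' := prob_of (b - h).
have p'01 n : 0 <= p' n <= 1 by exact: prob_of01.
have dif : (fun n => n%:R * (p n - p' n)) @ \oo --> h.
  have -> : (fun n => n%:R * (p n - p' n)) = (fun n => n%:R * p n - n%:R * p' n).
    by apply/funext => n; rewrite mulrBr.
  have -> : h = b - (b - h) by ring.
  by apply: cvgB => //; exact: prob_of_cvg.
have lim : (fun n => 2 * (small_prob n (p' n) K - small_prob n (p n) K) + p' n
       + 2 / K.+1%:R / (n%:R * (p n - p' n))) @ \oo -->
     2 * (small_mass (b - h) K - small_mass b K) + 0 + 2 / K.+1%:R / h.
  apply: cvgD; last first.
    by apply: cvgM; [exact: cvg_cst|apply: cvgV => //; rewrite gt_eqF].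
  apply: cvgD; last exact: (cvg_of_muln (@prob_of_cvg R (b - h))).
  apply: cvgM; first exact: cvg_cst.
  by apply: cvgB; [exact: limit_small_prob|exact: small_prob_cvg].
have lt_eps : 2 * (small_mass (b - h) K - small_mass b K) + 0 + 2 / K.+1%:R / h < eps.
  have := HK1 _ K1K; set m := _ - _ => mle.
  have : 2 / K.+1%:R / h <= eps / 4.
    rewrite ler_pdivrMr // ler_pdivrMr ?ltr0n //.
    have : 8 <= K.+1%:R * (eps * h).
      rewrite -ler_pdivrMr ?mulr_gt0 //; apply: le_trans (ltW HK2) _.
      by rewrite ler_nat leqW.
    by rewrite (_ : eps / 4 * h * K.+1%:R = K.+1%:R * (eps * h) / 4); [lra|ring].
  by set x := 2 / _ / _; lra.
near=> n.
have n0 : 0 < n%:R :> R by rewrite ltr0n; near: n; exact: nbhs_infty_gt.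
have np : 0 < n%:R * (p n - p' n) by near: n; exact: (cvgr_gt _ dif).
have pp : p' n < p n by move: np; rewrite pmulr_rgt0 // subr_gt0.
apply: (le_trans (@split_pairs_le n K (p' n) (p n) _ _)).
- by rewrite pp; case/andP: (p'01 n) => ->.
- by case/andP: (p01 n).
rewrite (_ : _ + _ = n%:R ^+ 2 * (2 * (small_prob n (p' n) K - small_prob n (p n) K) + p' n
       + 2 / K.+1%:R / (n%:R * (p n - p' n)))).
  rewrite mulrC; apply: ler_wpM2r; first by rewrite exprn_ge0 // ltW.
  by near: n; apply: (cvgr_le _ lim).
have pn : p n - p' n != 0 by rewrite gt_eqF // subr_gt0.
by field; rewrite pn (gt_eqF n0) /= addrC natr1 pnatr_eq0.
Unshelve. all: by end_near. Qed.

Lemma sum_both_big n K (c : {ffun edge n -> bool}) :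
  \sum_u \sum_v (both_big K c u v)%:R = (\sum_u (big K c u)%:R) ^+ 2 :> R.
Proof.
rewrite expr2 mulr_suml; apply: eq_bigr => u _; rewrite mulr_sumr.
by apply: eq_bigr => v _; rewrite -natrM mulnb.
Qed.

(** A proportion [1 - b^-1] of the vertices is in large components, by
    [small_mass_supercritical], and almost all pairs of these are connected. *)
Lemma giant_pairs : 1 < b -> exists2 delta : R, 0 < delta &
  \forall n \near \oo,
    delta * n%:R ^+ 2 <= E n (p n) (fun c => \sum_u \sum_v (v \in C c u)%:R).
Proof.
move=> b1; have b0 : 0 < b by apply: lt_trans b1.
(* [rho] is a lower bound for the limiting proportion of vertices in large
   components, and [(3 / 4) ^ 2 - 1 / 4 > 1 / 4]. *)
pose rho := 1 - b^-1.
have rho0 : 0 < rho by rewrite subr_gt0 invf_lt1.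
have r2 : 0 < rho ^+ 2 / 4 by rewrite divr_gt0 ?exprn_gt0.
have [K HK] := few_split_pairs b0 r2.
have big_cvg : (fun n => 1 - small_prob n (p n) K) @ \oo --> 1 - small_mass b K.
  by apply: cvgB; [exact: cvg_cst|exact: small_prob_cvg].
exists (rho ^+ 2 / 4) => //; near=> n.
have lw : is_law (fun _ : edge n => bern (p n)) by move=> e; exact: bern_law.
have h1 : E n (p n) (fun c => \sum_u \sum_v (split_pair K c u v)%:R) <= rho ^+ 2 / 4 * n%:R ^+ 2.
  by near: n; exact: HK.
have h2 : 3 / 4 * rho <= 1 - small_prob n (p n) K.
  near: n; apply: (cvgr_ge _ big_cvg).
  apply: (@lt_le_trans _ _ rho); first by move: rho0; lra.
  by rewrite lerD2l lerN2; exact: small_mass_supercritical.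
have h3 : n%:R ^+ 2 * (1 - small_prob n (p n) K) ^+ 2 <=
    E n (p n) (fun c => \sum_u \sum_v (both_big K c u v)%:R).
  rewrite (eq_pexp _ (@sum_both_big n K)); apply: le_trans (sqr_pexp_le _ lw).
  rewrite pexp_sum (eq_bigr (fun=> 1 - small_prob n (p n) K)); last first.
    by move=> u _; rewrite pexp_big.
  by rewrite sumr_const card_ord -[X in _ <= X ^+ 2]mulr_natl exprMn.
have h4 : E n (p n) (fun c => \sum_u \sum_v (both_big K c u v)%:R) -
    E n (p n) (fun c => \sum_u \sum_v (split_pair K c u v)%:R) <=
    E n (p n) (fun c => \sum_u \sum_v (v \in C c u)%:R).
  rewrite -pexpB; apply: ler_pexp => // c; rewrite -sumrB; apply: ler_sum => u _.
  rewrite -sumrB; apply: ler_sum => v _; rewrite split_pairE opprB addrCA subrr addr0.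
  by rewrite ler_nat; case: (big K c u).
have h5 : (3 / 4 * rho) ^+ 2 <= (1 - small_prob n (p n) K) ^+ 2.
  by rewrite lerXn2r // nnegrE; [rewrite mulr_ge0 // ltW|apply: le_trans h2; rewrite mulr_ge0 // ltW].
have n0 : 0 <= n%:R ^+ 2 :> R by exact: exprn_ge0.
move: (ler_wpM2l n0 h5) h1 h3 h4.
rewrite exprMn (_ : (3 / 4) ^+ 2 = 9 / 16 :> R); last by field.
set N := n%:R ^+ 2 in n0 *; set r := rho ^+ 2.
have : 0 <= N * r by rewrite mulr_ge0 // exprn_ge0 // ltW.
have -> : r / 4 * N = N * r / 4 by ring.
have -> : N * (9 / 16 * r) = N * r * (9 / 16) by ring.
set x := N * r; set s := E n _ _; set t := E n _ _; set y := E n _ _; lra.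
Unshelve. all: by end_near. Qed.

End FewSplitPairs.

(** * The edge-colored graph *)

Section ColorLaw.
Context {R : realType} (k : nat).
Local Open Scope classical_set_scope.

(** The mark of an edge is the set of its colors. *)
Definition color_law (p : 'I_k -> R) (J : {set 'I_k}) : R :=
  \prod_j (if j \in J then p j else 1 - p j).

(** The edge survives the deletion of color [i]. *)
Definition other_color (i : 'I_k) (J : {set 'I_k}) : bool := ~~ (J \subset [set i])%SET.

Lemma other_color0 i : ~~ other_color i finset.set0.
Proof. by rewrite negbK finset.sub0set. Qed.

Lemma color_law_is_law p : (forall j, 0 <= p j <= 1) -> is_law1 (color_law p).
Proof.
move=> p01; split=> [J|].
  apply: prodr_ge0 => j _; have /andP[p0 p1] := p01 j.
  by case: ifP; rewrite ?subr_ge0.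
transitivity (\prod_(j < k) (p j + (1 - p j))); last first.
  by rewrite big1 // => j _; rewrite addrCA subrr addr0.
by rewrite bigA_distr /=; apply: eq_big => J; rewrite ?inE.
Qed.

Variable lambda : 'I_k -> R.
Hypothesis lambda_ge0 : forall i, 0 <= lambda i.

Definition edge_law n := color_law (fun j => prob_of (lambda j) n).

(** Edges with several colors disappear in the limit. *)
Definition color_rate (J : {set 'I_k}) : R := \sum_j (J == [set j])%SET%:R * lambda j.

Lemma edge_law_sparse : sparse_law (finset.set0 : {set 'I_k}) edge_law color_rate.
Proof.
split=> [n|J /set0Pn[j jJ]].
  by apply: color_law_is_law => j; exact: prob_of01.
have -> : color_rate J = lambda j * \prod_(j' | j' != j) (if j' \in J then 0 else 1).
  case: (eqVneq J [set j]%SET) => [->|nJ].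
    rewrite /color_rate (bigD1 j) //= eqxx mul1r big1 ?addr0; last first.
      move=> j' jj'; rewrite (inj_eq finset.set1_inj) eq_sym (negPf jj') mul0r //.
    by rewrite big1 ?mulr1 // => j' jj'; rewrite finset.in_set1 (negPf jj').
  have [j' j'J jj'] : exists2 j', j' \in J & j' != j.
    apply/exists_inP; apply: contraNT nJ => /exists_inPn H.
    rewrite finset.eqEsubset finset.sub1set jJ andbT; apply/fintype.subsetP => x xJ.
    by have := H x xJ; rewrite negbK finset.in_set1.
  rewrite (bigD1 j') //= j'J mul0r mulr0 /color_rate big1 // => x _.
  case: eqP => [E|_]; rewrite ?mul0r //; move: jj' nJ; move: jJ j'J; rewrite E !finset.in_set1.
  by move=> /eqP -> /eqP ->; rewrite eqxx.
rewrite /edge_law /color_law.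
under eq_fun do rewrite (bigD1 j) //= jJ mulrA.
apply: cvgM; first exact: prob_of_cvg.
apply: cvg_prodr => j' _; have p0 := cvg_of_muln (@prob_of_cvg R (lambda j')).
case: ifP => // _; rewrite -[X in _ --> X]subr0; apply: cvgB => //; exact: cvg_cst.
Qed.

Definition without_prob n i : R := \sum_(J | other_color i J == true) edge_law n J.

Lemma without_prob_cvg i :
  (fun n => n%:R * without_prob n i) @ \oo --> \sum_(j < k) lambda j - lambda i.
Proof.
have -> : \sum_(j < k) lambda j - lambda i = \sum_(J | other_color i J == true) color_rate J.
  rewrite exchange_big (bigD1 i) //= addrAC subrr add0r [RHS](bigD1 i) //=.
  rewrite [X in X + _]big1 ?add0r; last first.
    move=> J; rewrite eqb_id /other_color; case: eqP => [->|]; last by rewrite mul0r.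
    by rewrite fintype.subxx.
  apply: eq_bigr => j ji; rewrite (bigD1 [set j]%SET) /=; last first.
    by rewrite eqb_id /other_color finset.sub1set finset.in_set1.
  by rewrite eqxx mul1r big1 ?addr0 // => J /andP[_ /negPf ->]; rewrite mul0r.
under eq_fun do rewrite mulr_sumr.
apply: cvg_sumr => J; rewrite eqb_id => oJ; case: edge_law_sparse => _; apply.
by apply: contraNneq (other_color0 i) => <-.
Qed.

Lemma without_prob01 n i : 0 <= without_prob n i <= 1.
Proof.
have [w0 <-] : is_law1 (edge_law n) by apply: color_law_is_law => j; exact: prob_of01.
apply/andP; split; first exact: sumr_ge0.
by rewrite [leRHS](bigID (fun J => other_color i J == true)) /= lerDl sumr_ge0.
Qed.

(** Forgetting color [i] turns the colored graph into a graph G(n, p). *)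
Lemma pexp_without n i (f : {ffun edge n -> bool} -> R) :
  pexp (fun _ : edge n => edge_law n) (fun c => f [ffun e => other_color i (c e)]) =
  pexp (fun _ : edge n => bern (without_prob n i)) f.
Proof.
rewrite pexp_push; congr (pexp _ f); apply/funext => e; apply/funext => -[] //=.
have [w0 sw] : is_law1 (edge_law n) by apply: color_law_is_law => j; exact: prob_of01.
rewrite /without_prob -sw [X in _ = X - _](bigID (fun J => other_color i J == true)) /=.
rewrite addrAC subrr add0r; apply: eq_bigl => J; by case: (other_color i J).
Qed.

End ColorLaw.

Lemma orel_forget (V : finType) (v0 : V) (O : pred V) n (c : {ffun edge n -> V}) :
  ~~ O v0 -> orel false (predC1 false) [ffun e => O (c e)] =2 orel v0 O c.
Proof.
move=> O0 u v; rewrite /orel /mark /mark_set.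
by case: insub => [e|] /=; [rewrite ffunE; case: (O (c e))|rewrite (negPf O0)].
Qed.

Section ColorAvoiding.
Context (k : nat).
Implicit Types (n : nat).

Definition crel n (i : 'I_k) (c : {ffun edge n -> {set 'I_k}}) : rel 'I_n :=
  orel finset.set0 (other_color i) c.

Notation C i c u := (gcomp (crel i c) u).

Lemma crel_sym n i (c : {ffun edge n -> {set 'I_k}}) : symmetric (crel i c).
Proof. exact: orel_sym. Qed.

Definition avoiding_class n (c : {ffun edge n -> {set 'I_k}}) u : {set 'I_n} :=
  [set v | [forall i, v \in C i c u]]%SET.

(** Components of at most [K] vertices; all larger ones are identified, as if
    they were parts of a single giant component. *)
Definition signature K n (c : {ffun edge n -> {set 'I_k}}) u i : {set 'I_n} :=
  if (#|C i c u| <= K)%N then C i c u else finset.set0.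

Definition same_signature K n (c : {ffun edge n -> {set 'I_k}}) u v : bool :=
  [forall i, signature K c u i == signature K c v i].

Definition truncated_class K n (c : {ffun edge n -> {set 'I_k}}) u : {set 'I_n} :=
  [set v | same_signature K c u v]%SET.

(** The vertex has a component of at most [M] vertices for some color, which
    bounds its class; for the other colors only components of at most [K]
    vertices are distinguished. *)
Definition local_class l M K n (c : {ffun edge n -> {set 'I_k}}) u : bool :=
  [exists i, 0 < #|signature K c u i| <= M]%N && (#|truncated_class K c u| == l).

Lemma signature_gt0 K n (c : {ffun edge n -> {set 'I_k}}) u i :
  (0 < #|signature K c u i|)%N = (#|C i c u| <= K)%N.
Proof.
rewrite /signature; case: ifP => _; last by rewrite finset.cards0.
by apply/card_gt0P; exists u; exact: gcomp_center.
Qed.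

Lemma in_signature K n (c : {ffun edge n -> {set 'I_k}}) u i :
  (0 < #|signature K c u i|)%N -> u \in signature K c u i.
Proof. by rewrite signature_gt0 /signature => ->; exact: gcomp_center. Qed.

Lemma gball_trans (T : finType) (e : rel T) u v s t :
  v \in gball e u s -> gball e v t \subset gball e u (s + t).
Proof.
move=> vs; elim: t => [|t IH]; first by rewrite addn0 gball0 finset.sub1set.
apply/fintype.subsetP => y; rewrite in_ballS addnS => /orP[yB|].
  by apply: (fintype.subsetP (gball_sub _ _ (leqnSn _))); exact: (fintype.subsetP IH).
case/existsP => z /andP[zB zy]; apply: gball_step zy; exact: (fintype.subsetP IH).
Qed.

Lemma gball_subrel (T : finType) (e e' : rel T) u t :
  (forall x y, e x y -> e' x y) -> gball e u t \subset gball e' u t.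
Proof.
move=> ee; elim: t => [|t IH]; first by rewrite !gball0.
apply/fintype.subsetP => y; rewrite !in_ballS => /orP[/(fintype.subsetP IH) -> //|].
case/existsP => z /andP[zB /ee zy]; apply/orP; right; apply/existsP; exists z.
by rewrite (fintype.subsetP IH _ zB).
Qed.

Notation P c := (orel finset.set0 (predC1 finset.set0) c).

Lemma crel_sub n i (c : {ffun edge n -> {set 'I_k}}) x y : crel i c x y -> P c x y.
Proof.
rewrite /crel /orel /=; apply: contraTneq => ->; exact: other_color0.
Qed.

Lemma card_le_gball (T : finType) (e : rel T) u K :
  (#|gcomp e u| <= K)%N = (#|gball e u K| <= K)%N.
Proof.
apply/idP/idP => H; first by rewrite -gcomp_sub_ball // leqW.
by rewrite -(small_ball H).
Qed.

(** A component of at most [K] vertices lies within distance [K]. *)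
Lemma signature_pull K n s (sigma : 'I_s -> 'I_n) (c : {ffun edge n -> {set 'I_k}}) x y d r i :
  injective sigma -> (gball (P c) (sigma x) r = sigma @: [set: _])%SET ->
  sigma y \in gball (P c) (sigma x) d -> (d + K <= r)%N ->
  signature K c (sigma y) i = (sigma @: signature K (pull finset.set0 sigma c) y i)%SET.
Proof.
move=> inj Br yd dK.
have key : (gball (crel i c) (sigma y) K = sigma @: gball (crel i (pull finset.set0 sigma c)) y K)%SET.
  move: (leqnn K); apply: gball_pull => t y' z tK y't Et yz.
  have : sigma y' \in gball (P c) (sigma x) (d + t).
    apply: (fintype.subsetP (gball_trans _ yd)).
    apply: (fintype.subsetP (gball_subrel _ _ (@crel_sub _ i c))).
    by rewrite /crel Et imset_f.
  move=> /gball_step/(_ (crel_sub yz)) zB.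
  have : z \in gball (P c) (sigma x) r.
    by apply: (fintype.subsetP (gball_sub _ _ _)) zB; rewrite -addnS; apply: leq_trans dK; rewrite leq_add2l.
  by rewrite Br => /imsetP[y'' _ ->]; exists y''.
rewrite /signature !card_le_gball key card_imset //.
case: ifP => H; last by rewrite imset0.
have H' : (#|gball (crel i c) (sigma y) K| <= K)%N by rewrite key card_imset.
by rewrite -(small_ball H) -(small_ball H') key.
Qed.

(** Every vertex with the signature of [x] is in a small component of [x], hence
    within distance [K], and its own signature is decided within distance [K]. *)
Lemma local_class_pull l M K n s (sigma : 'I_s -> 'I_n)
    (c : {ffun edge n -> {set 'I_k}}) x : injective sigma ->
  (gball (P c) (sigma x) (K + K).+1 = sigma @: [set: _])%SET ->
  local_class l M K c (sigma x) = local_class l M K (pull finset.set0 sigma c) x.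
Proof.
move=> inj Br.
have K2 : (K + K <= (K + K).+1)%N by exact: leqnSn.
have sx i : signature K c (sigma x) i = (sigma @: signature K (pull finset.set0 sigma c) x i)%SET.
  exact: (@signature_pull K n s sigma c x x K _ i inj Br (gball_center _ _ K) K2).
rewrite /local_class.
have -> : [exists i, 0 < #|signature K c (sigma x) i| <= M]%N =
          [exists i, 0 < #|signature K (pull finset.set0 sigma c) x i| <= M]%N.
  by apply: eq_existsb => i; rewrite sx card_imset.
case: existsP => //= -[j /andP[j0 _]].
have j0' : (0 < #|signature K c (sigma x) j|)%N by rewrite sx card_imset.
have inK n' (c' : {ffun edge n' -> {set 'I_k}}) a b : (0 < #|signature K c' a j|)%N ->
    b \in signature K c' a j -> b \in gball (P c') a K.
  rewrite signature_gt0 /signature => aK; rewrite aK => bC.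
  apply: (fintype.subsetP (gball_subrel _ _ (@crel_sub _ j c'))).
  by rewrite -gcomp_sub_ball // leqW.
have sy y : sigma y \in signature K c (sigma x) j ->
    forall i, signature K c (sigma y) i = (sigma @: signature K (pull finset.set0 sigma c) y i)%SET.
  by move=> /(inK _ _ _ _ j0') yB i; exact: (@signature_pull K n s sigma c x y K _ i inj Br yB K2).
have -> : truncated_class K c (sigma x) = (sigma @: truncated_class K (pull finset.set0 sigma c) x)%SET.
  apply/setP => v; rewrite inE; apply/forallP/imsetP => [sv|[y]]; last first.
    rewrite inE => /forallP yx -> i; rewrite sx sy ?(eqP (yx i)) //.
    rewrite sx imset_f // (eqP (yx j)); apply: in_signature.
    by rewrite -(eqP (yx j)).
  have vj : v \in signature K c (sigma x) j.
    by rewrite (eqP (sv j)); apply: in_signature; rewrite -(eqP (sv j)).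
  have /imsetP[y _ vy] : v \in (sigma @: [set: _])%SET.
    rewrite -Br; apply: (fintype.subsetP (gball_sub _ _ _)) (inK _ _ _ _ j0' vj).
    exact: leq_trans (leq_addr _ _) K2.
  exists y => //; rewrite inE; apply/forallP => i.
  by rewrite -(inj_eq (imset_inj inj)) -sx -sy -?vy //; exact: sv.
by rewrite card_imset.
Qed.

Lemma local_class_local (R : realType) l M K :
  local finset.set0 (K + K).+1 (fun n c u => (local_class l M K (n := n) c u)%:R : R).
Proof. by move=> n s sigma c x inj Br; rewrite (local_class_pull l M inj Br). Qed.

End ColorAvoiding.

(** * Effect of a single edge on the classes *)

Section Resampling.
Context (k n : nat).
Implicit Types (c : {ffun edge n -> {set 'I_k}}) (u v x : 'I_n).

Notation C i c u := (gcomp (crel i c) u).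

Lemma gcomp_min (T : finType) (e : rel T) (u : T) (A : {set T}) : u \in A ->
  (forall x y : T, x \in A -> e x y -> y \in A) -> gcomp e u \subset A.
Proof.
move=> uA cl; apply/fintype.subsetP=> v; rewrite inE => /connectP[p ep ->].
by elim: p u uA ep => //= x p IH u uA /andP[ux]; exact: IH (cl _ _ uA ux).
Qed.

(** Marks being symmetric, only the mark of the pair [a], [b] itself can differ. *)
Definition agree_off a b c c' : Prop :=
  forall x y, x != a -> x != b -> mark finset.set0 c x y = mark finset.set0 c' x y.

Lemma agree_off_sym a b c c' : agree_off a b c c' -> agree_off a b c' c.
Proof. by move=> H x y xa xb; rewrite H. Qed.

(** A component without [a] and [b] does not see their mark. *)
Lemma gcomp_agree a b c c' i v : agree_off a b c c' ->
  a \notin C i c v -> b \notin C i c v -> C i c' v = C i c v.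
Proof.
move=> ag av bv.
have same x y : x \in C i c v -> crel i c x y = crel i c' x y.
  move=> xC; rewrite /crel /orel ag //.
    by apply: contraNneq av => <-.
  by apply: contraNneq bv => <-.
have sub : C i c' v \subset C i c v.
  apply: gcomp_min; first exact: gcomp_center.
  by move=> x y xC; rewrite -same //; exact: gcomp_closed.
apply/eqP; rewrite finset.eqEsubset sub /=; apply: gcomp_min; first exact: gcomp_center.
move=> x y xC; rewrite same; first exact: gcomp_closed.
exact: fintype.subsetP sub _ xC.
Qed.

Variables (K : nat).

(** The small components of the two ends of an edge. *)
Definition near_pair a b c : {set 'I_n} :=
  (\bigcup_i (signature K c a i :|: signature K c b i))%SET.

Lemma card_bigcup_sum (T I : finType) (Q : pred I) (F : I -> {set T}) :
  (#|(\bigcup_(i | Q i) F i)%SET| <= \sum_(i | Q i) #|F i|)%N.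
Proof.
elim/big_rec2: _ => [|i m A _ IH]; first by rewrite finset.cards0.
by apply: leq_trans (leq_card_setU _ _) _; rewrite leq_add2l.
Qed.

Lemma card_bigcup_le (T I : finType) (F : I -> {set T}) m :
  (forall i, #|F i| <= m)%N -> (#|(\bigcup_i F i)%SET| <= #|I| * m)%N.
Proof.
move=> Fm; apply: leq_trans (card_bigcup_sum _ _) _.
by rewrite -sum_nat_const; apply: leq_sum => i _.
Qed.

Lemma card_signature c u i : (#|signature K c u i| <= K)%N.
Proof. by rewrite /signature; case: ifP => // _; rewrite finset.cards0. Qed.

Lemma card_near_pair a b c : (#|near_pair a b c| <= k * (K + K))%N.
Proof.
rewrite -[k in (k * _)%N]card_ord; apply: card_bigcup_le => i.
by apply: leq_trans (leq_card_setU _ _) _; apply: leq_add; exact: card_signature.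
Qed.

Lemma signature_agree a b c c' v : agree_off a b c c' ->
  v \notin (near_pair a b c :|: near_pair a b c')%SET ->
  signature K c v =1 signature K c' v.
Proof.
move=> ag; rewrite finset.in_setU negb_or => /andP[nc nc'] i.
have out c1 x : x \in [set a; b]%SET -> v \notin near_pair a b c1 ->
    (#|C i c1 v| <= K)%N -> x \notin C i c1 v.
  move=> xab nv vK; apply: contraNN nv => xv.
  have E := gcomp_same (crel_sym i c1) xv.
  have vS : v \in signature K c1 x i by rewrite /signature E vK gcomp_center.
  apply/finset.bigcupP; exists i => //; rewrite finset.in_setU.
  by move: xab; rewrite !inE => /orP[] /eqP <-; rewrite vS ?orbT.
have ina : a \in [set a; b]%SET by rewrite !inE eqxx.
have inb : b \in [set a; b]%SET by rewrite !inE eqxx orbT.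
rewrite /signature; case: (leqP #|C i c v| K) => vK.
  by rewrite (gcomp_agree ag (out _ _ ina nc vK) (out _ _ inb nc vK)) vK.
case: (leqP #|C i c' v| K) => v'K //; exfalso.
have := gcomp_agree (agree_off_sym ag) (out _ _ ina nc' v'K) (out _ _ inb nc' v'K).
by move=> E; move: vK; rewrite E ltnNge v'K.
Qed.

(** Vertices whose signature changes, and those whose class meets them. *)
Definition affected a b c c' : {set 'I_n} :=
  let Z := (near_pair a b c :|: near_pair a b c')%SET in
  (Z :|: \bigcup_(z in Z) \bigcup_i (signature K c z i :|: signature K c' z i))%SET.

Definition affected_bound := ((k * (K + K)).*2 * (k * (K + K)).+1)%N.

Lemma card_affected a b c c' : (#|affected a b c c'| <= affected_bound)%N.
Proof.
rewrite /affected; set Z := (near_pair a b c :|: near_pair a b c')%SET.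
have Zle : (#|Z| <= (k * (K + K)).*2)%N.
  rewrite -addnn; apply: leq_trans (leq_card_setU _ _) _.
  by apply: leq_add; exact: card_near_pair.
apply: leq_trans (leq_card_setU _ _) _.
rewrite /affected_bound mulnS; apply: leq_add => //.
apply: leq_trans (card_bigcup_sum _ _) _.
apply: leq_trans (leq_mul Zle (leqnn _)); rewrite -sum_nat_const; apply: leq_sum => z _.
rewrite -[k in (k * _)%N]card_ord; apply: card_bigcup_le => i.
by apply: leq_trans (leq_card_setU _ _) _; apply: leq_add; exact: card_signature.
Qed.

(** A class changes only if it gains or loses a vertex of changed signature; that
    vertex then shares a small component with the whole class. *)
Lemma local_class_agree l M a b c c' u : agree_off a b c c' ->
  u \notin affected a b c c' -> local_class l M K c u = local_class l M K c' u.
Proof.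
move=> ag; rewrite /affected; set Z := (near_pair a b c :|: near_pair a b c')%SET.
rewrite finset.in_setU negb_or => /andP[uZ /finset.bigcupP nu].
have su := signature_agree ag uZ.
rewrite /local_class (@eq_existsb _ _ (fun i => 0 < #|signature K c' u i| <= M)%N); last first.
  by move=> i; rewrite su.
case: existsP => [[j /andP[j0 _]]|_]; last by rewrite !andFb.
rewrite !andTb.
have j0c : (0 < #|signature K c u j|)%N by rewrite su.
suff -> : truncated_class K c u = truncated_class K c' u by [].
apply/setP => v; rewrite !inE.
case: (boolP (v \in Z)) => [vZ|/(signature_agree ag) sv]; last first.
  by apply: eq_forallb => i; rewrite su sv.
have nv w : w \in [set signature K c v j; signature K c' v j]%SET -> u \notin w.
  move=> wv; apply/negP => uw; apply: nu; exists v => //; apply/finset.bigcupP; exists j => //.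
  rewrite finset.in_setU; move: wv uw; rewrite !inE => /orP[] /eqP -> ->; by rewrite ?orbT.
transitivity false.
  apply/negbTE/negP => /forallP/(_ j)/eqP E.
  by have := nv (signature K c v j); rewrite !inE eqxx -E (in_signature j0c) => /(_ isT).
apply/esym/negbTE/negP => /forallP/(_ j)/eqP E.
by have := nv (signature K c' v j); rewrite !inE eqxx orbT -E (in_signature j0) => /(_ isT).
Qed.

End Resampling.

Section Lipschitz.
Context {R : realType} (k n : nat).
Implicit Types (c : {ffun edge n -> {set 'I_k}}).

Lemma agree_off_upd c (e : edge n) J J' : exists a b,
  agree_off a b (upd c e J) (upd c e J').
Proof.
have [a [b [ab ->]]] := edgeP e.
exists a, b => x y xa xb; rewrite !mark_upd; case: eqP => // E.
have : x \in [set a; b]%SET by rewrite (E : [set a; b]%SET = _) !inE eqxx.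
by rewrite !inE (negPf xa) (negPf xb).
Qed.

Lemma bounded_influence_count (F : {ffun edge n -> {set 'I_k}} -> 'I_n -> bool) (L : nat) :
  (forall a b c c', agree_off a b c c' -> exists2 A : {set 'I_n}, (#|A| <= L)%N &
     forall u, u \notin A -> F c u = F c' u) ->
  bounded_influence finset.set0 L%:R (fun c => \sum_u (F c u)%:R : R).
Proof.
move=> H c e J; have [a [b ag]] := agree_off_upd c e J finset.set0.
have [A AL FA] := H _ _ _ _ ag.
rewrite -sumrB; apply: le_trans (ler_norm_sum _ _ _) _.
apply: (@le_trans _ _ (\sum_(u in A) 1)); last by rewrite sumr_const ler_nat.
rewrite [leRHS]big_mkcond; apply: ler_sum => u _; case: ifPn => [_|uA].
  by case: (F _ u); case: (F _ u); rewrite ?subrr ?normr0 ?subr0 ?sub0r ?normrN ?normr1.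
by rewrite FA // subrr normr0.
Qed.

Lemma bounded_influence_local_class l M K :
  bounded_influence finset.set0 (affected_bound k K)%:R
    (fun c : {ffun edge n -> {set 'I_k}} => \sum_u (local_class l M K c u)%:R : R).
Proof.
apply: bounded_influence_count => a b c c' ag; exists (affected K a b c c').
  exact: card_affected.
by move=> u; exact: local_class_agree.
Qed.

Definition isolated c (u : 'I_n) : bool := [forall v, mark finset.set0 c u v == finset.set0].

(** One edge can only affect the isolation of its two ends. *)
Lemma bounded_influence_isolated :
  bounded_influence finset.set0 2%:R (fun c : {ffun edge n -> {set 'I_k}} => \sum_u (isolated c u)%:R : R).
Proof.
apply: bounded_influence_count => a b c c' ag; exists [set a; b]%SET.
  by rewrite finset.cards2; case: (_ != _).
move=> u; rewrite !inE negb_or => /andP[ua ub].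
by apply: eq_forallb => v; rewrite ag.
Qed.

End Lipschitz.

(** * Concentration *)

Section Concentration.
Context {R : realType} (k : nat).
Local Open Scope classical_set_scope.
Variable lambda : 'I_k -> R.
Hypothesis lambda_ge0 : forall i, 0 <= lambda i.

Notation Ec n f := (pexp (fun _ : edge n => edge_law lambda n) f).

Lemma edge_law_law n : is_law (fun _ : edge n => edge_law lambda n).
Proof. by move=> e; apply: color_law_is_law => j; exact: prob_of01. Qed.

Lemma card_edge n : (#|[set: edge n]%SET| <= n ^ 2)%N.
Proof.
rewrite -[n in (n ^ 2)%N]card_ord -mulnn -card_prod.
have [|f fP] := @choice (edge n) ('I_n * 'I_n) (fun e p => val e = [set p.1; p.2]%SET).
  by move=> e; have [a [b [ab ->]]] := edgeP e; exists (a, b).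
rewrite -(@card_imset _ _ f) ?max_card // => e e' E.
by apply: val_inj; rewrite (fP e) (fP e') E.
Qed.

(** There are order [n ^ 2] edges, each present with probability of order
    [1 / n]; a count with bounded influences thus has variance of order [n]. *)
Lemma concentration (N : forall n, {ffun edge n -> {set 'I_k}} -> R) (L l : R) :
  0 <= L -> (forall n, bounded_influence finset.set0 L (N n)) ->
  (fun n => Ec n (fun c => N n c / n%:R)) @ \oo --> l ->
  (fun n => Ec n (fun c => (N n c / n%:R - l) ^+ 2)) @ \oo --> (0 : R).
Proof.
move=> L0 NL Nl.
have sw := edge_law_sparse lambda_ge0.
pose q n := \sum_(J | J != finset.set0) edge_law lambda n J.
pose m n := Ec n (fun c => N n c / n%:R).
have q0 n : 0 <= q n.
  apply: sumr_ge0 => J _; by have [w0 _] := proj1 sw n.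
have var n : (0 < n)%N -> Ec n (fun c => (N n c / n%:R - m n) ^+ 2) <= q n * L ^+ 2.
  move=> n0; have n0' : 0 < n%:R :> R by rewrite ltr0n.
  have NL' : bounded_influence finset.set0 (L / n%:R) (fun c => N n c / n%:R).
    move=> c e J; have i0 : 0 <= n%:R^-1 :> R by rewrite invr_ge0 ltW.
    by rewrite -mulrBl normrM (ger0_norm i0); apply: (ler_wpM2r i0); exact: NL.
  have L0' : 0 <= L / n%:R by rewrite divr_ge0 // ltW.
  have qe : forall e : edge n, \sum_(J | J != finset.set0) edge_law lambda n J <= q n by [].
  have := variance_le (@edge_law_law n) L0' qe NL'; rewrite -/(m n) => /le_trans; apply.
  have -> : q n * L ^+ 2 = n%:R ^+ 2 * (q n * (L / n%:R) ^+ 2).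
    by field; rewrite gt_eqF.
  apply: ler_wpM2r; first by rewrite mulr_ge0 // exprn_ge0.
  by rewrite -natrX ler_nat -finset.cardsT card_edge.
have lim : (fun n => q n * L ^+ 2 + (m n - l) ^+ 2) @ \oo --> (0 : R).
  have -> : 0 = 0 * L ^+ 2 + (l - l) ^+ 2 :> R by rewrite subrr expr0n mul0r addr0.
  apply: cvgD.
    by apply: cvgM; [exact: cvg_of_muln (sum_w_cvg sw)|exact: cvg_cst].
  by apply: cvg_exprn; apply: cvgB => //; exact: cvg_cst.
apply: (@squeeze_cvgr _ _ _ _ (fun=> 0) (fun n => q n * L ^+ 2 + (m n - l) ^+ 2)) => //; last exact: cvg_cst.
near=> n; have n0 : (0 < n)%N by near: n; exact: nbhs_infty_gt.
have lw := @edge_law_law n.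
apply/andP; split; first by apply: pexp_ge0 => // c; exact: sqr_ge0.
rewrite (@eq_pexp _ _ _ _ _ (fun c => (N n c / n%:R - m n) ^+ 2
   + (2 * (m n - l) * (N n c / n%:R) + (l ^+ 2 - m n ^+ 2)))); last by move=> c; ring.
rewrite pexpD pexpD pexpZ pexp_cst // -/(m n).
rewrite (_ : 2 * (m n - l) * m n + _ = (m n - l) ^+ 2); last by ring.
by rewrite lerD2r; exact: var.
Unshelve. all: by end_near. Qed.

End Concentration.

(** * Local approximation of the class sizes *)

Section Comparison.
Context (k n : nat).
Variable c : {ffun edge n -> {set 'I_k}}.
Implicit Types (i j : 'I_k) (u v : 'I_n) (K M l : nat).

Notation C i u := (gcomp (crel i c) u).

Definition split i K u v : bool := [&& K < #|C i u|, K < #|C i v| & v \notin C i u]%N.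

Definition splits i K : nat := (\sum_u \sum_v split i K u v)%N.

Definition large_class l M : {set 'I_n} :=
  [set u | [forall i, M < #|C i u|]%N && (#|avoiding_class c u| == l)]%SET.

Lemma in_avoiding u v : (v \in avoiding_class c u) = [forall i, v \in C i u].
Proof. by rewrite inE. Qed.

(** Vertices in large components of every color-deleted graph are mostly
    equivalent to each other, so few of them have classes of bounded size. *)
Lemma card_large_class l M :
  (#|large_class l M| ^ 2 <= l * n + \sum_i splits i M)%N.
Proof.
apply: (@leq_trans (\sum_(u in large_class l M) (l + \sum_i \sum_v split i M u v))%N); last first.
  rewrite big_split /= sum_nat_const mulnC; apply: leq_add.
    by rewrite leq_mul2l -[X in (_ <= X)%N]card_ord max_card orbT.
  rewrite exchange_big /=; apply: leq_sum => i _.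
  by rewrite [X in (_ <= X)%N](bigID (mem (large_class l M))) leq_addr.
rewrite -mulnn -[X in (X <= _)%N]sum_nat_const; apply: leq_sum => u uZ.
have ul : #|avoiding_class c u| = l by move: uZ; rewrite inE => /andP[_ /eqP].
have cardS (A : {set 'I_n}) : (\sum_v (v \in A))%N = #|A|.
  by rewrite -sum1_card [RHS]big_mkcond.
rewrite exchange_big -[X in (_ <= X + _)%N]ul -!cardS -big_split.
apply: leq_sum => v _ /=; case: (boolP (v \in large_class l M)) => // vZ.
case: (boolP (v \in avoiding_class c u)) => //; rewrite in_avoiding negb_forall => /existsP[i vu].
rewrite (bigD1 i) //= /split vu.
by move: uZ vZ; rewrite !inE => /andP[/forallP/(_ i) -> _] /andP[/forallP/(_ i) -> _].
Qed.

(** Vertices of large components which are not the strictly largest one. *)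
Definition off_giant i K : {set 'I_n} :=
  [set u | (K < #|C i u|)%N && [exists v, (#|C i u| <= #|C i v|)%N && (u \notin C i v)]]%SET.

(** Such a vertex [u] is split from all the vertices of large components outside
    its own one, which are at least half of them, as the other component is not
    smaller. *)
Lemma card_off_giant i K : (#|off_giant i K| ^ 2 <= 2 * splits i K)%N.
Proof.
have sC := crel_sym i c.
pose bigs : {set 'I_n} := [set v | (K < #|C i v|)%N]%SET.
apply: (@leq_trans (\sum_(u in off_giant i K) (2 * \sum_v split i K u v))%N); last first.
  rewrite -big_distrr leq_mul2l /= /splits.
  by rewrite [X in (_ <= X)%N](bigID (mem (off_giant i K))) leq_addr.
rewrite -mulnn -[X in (X <= _)%N]sum_nat_const; apply: leq_sum => u.
rewrite inE => /andP[uK /existsP[v /andP[uv nuv]]].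
have -> : (\sum_w split i K u w)%N = #|bigs :\: C i u|%SET.
  rewrite -sum1_card [RHS]big_mkcond; apply: eq_bigr => w _.
  have wb : (w \in bigs) = (K < #|C i w|)%N by rewrite inE.
  by rewrite /split uK finset.in_setD wb andTb andbC; case: (_ && _).
have subu : C i u \subset bigs.
  by apply/fintype.subsetP => w wu; rewrite inE (gcomp_same sC wu).
have subv : C i v \subset bigs.
  by apply/fintype.subsetP => w wv; rewrite inE (gcomp_same sC wv) (leq_trans uK).
have dis : [disjoint C i u & C i v].
  apply/pred0P => w /=; apply/negbTE/negP => /andP[wu wv].
  by case/negP: nuv; rewrite -(gcomp_same sC wv) (gcomp_same sC wu) gcomp_center.
(* The component of [u] is at most half of the large components' union, as that
   of [v] is disjoint from it and not smaller. *)
have two : (#|C i u| + #|C i v| <= #|bigs|)%N.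
  have := (leq_card_setU (C i u) (C i v)).2; rewrite dis => /eqP <-.
  by apply: subset_leq_card; rewrite finset.subUset subu subv.
have Bb : (#|off_giant i K| <= #|bigs|)%N.
  by apply: subset_leq_card; apply/fintype.subsetP => w; rewrite !inE => /andP[].
rewrite cardsDS //; move: two Bb uv.
move: #|C i u| #|C i v| #|bigs| #|off_giant i K| => a b z w; lia.
Qed.

(** Outside this set, identifying all components of more than [K] vertices does
    no harm: neither the vertex nor any vertex sharing its small component is in
    the wrong large component. *)
Definition exceptional l M K : {set 'I_n} :=
  (large_class l M :|: \bigcup_i (off_giant i K :|:
     \bigcup_(v in off_giant i K) \bigcup_j signature M c v j))%SET.

(** A vertex [v] with the same signature as [u], but not equivalent to it, would
    be in another component of more than [K] vertices for some color [i]; the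
    smaller of the two is then off the giant. *)
Lemma local_class_exact l M K u : (M <= K)%N -> u \notin exceptional l M K ->
  local_class l M K c u = (#|avoiding_class c u| == l).
Proof.
move=> MK; rewrite finset.in_setU negb_or => /andP[uZ /finset.bigcupP nB].
case: (boolP [exists j, #|C j u| <= M]%N) => [/existsP[j jM]|nj]; last first.
  have uM : [forall i, M < #|C i u|]%N.
    by apply/forallP => i; rewrite ltnNge; apply: contra nj => ?; apply/existsP; exists i.
  move: uZ; rewrite inE uM andTb => /negPf ->.
  apply/negbTE/negP => /andP[/existsP[i /andP[i0 iM]] _].
  move: i0 iM; rewrite signature_gt0 /signature => ->.
  by rewrite leqNgt (forallP uM i).
have sj : signature K c u j = C j u by rewrite /signature (leq_trans jM MK).
rewrite /local_class.
have -> : [exists i, 0 < #|signature K c u i| <= M]%N.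
  apply/existsP; exists j; rewrite sj jM andbT.
  by apply/card_gt0P; exists u; exact: gcomp_center.
rewrite andTb; suff -> : truncated_class K c u = avoiding_class c u by [].
apply/setP => v; rewrite inE in_avoiding; apply/forallP/forallP => H i; last first.
  have E := gcomp_same (crel_sym i c) (H i).
  by rewrite /signature E.
apply/negPn/negP => nvu.
have si := eqP (H i); have sjv := eqP (H j).
have vj : v \in C j u.
  rewrite -sj sjv; apply: in_signature; rewrite -sjv sj.
  by apply/card_gt0P; exists u; exact: gcomp_center.
have Cj := gcomp_same (crel_sym j c) vj.
have uK : (K < #|C i u|)%N.
  rewrite ltnNge; apply/negP => uK; case/negP: nvu.
  have s0 : (0 < #|signature K c u i|)%N by rewrite signature_gt0.
  have : v \in signature K c v i by apply: in_signature; rewrite -si.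
  by rewrite -si /signature uK.
have vK : (K < #|C i v|)%N.
  rewrite ltnNge; apply/negP => vK.
  have : (0 < #|signature K c v i|)%N by rewrite signature_gt0.
  by rewrite -si signature_gt0 leqNgt uK.
have nuv : u \notin C i v by rewrite (in_compC (crel_sym i c)).
apply: nB; exists i => //; rewrite finset.in_setU.
case: (leqP #|C i u| #|C i v|) => [le|/ltnW le].
  apply/orP; left; rewrite inE uK; apply/existsP; exists v.
  by rewrite le nuv.
apply/orP; right; apply/finset.bigcupP; exists v.
  rewrite inE vK; apply/existsP; exists u; by rewrite le nvu.
apply/finset.bigcupP; exists j => //.
by rewrite /signature Cj jM gcomp_center.
Qed.

Lemma card_exceptional l M K : (#|exceptional l M K| <=
  #|large_class l M| + (k * M).+1 * \sum_i #|off_giant i K|)%N.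
Proof.
apply: leq_trans (leq_card_setU _ _) _; rewrite leq_add2l.
apply: leq_trans (card_bigcup_sum _ _) _; rewrite big_distrr /=; apply: leq_sum => i _.
apply: leq_trans (leq_card_setU _ _) _; rewrite mulSn leq_add2l.
apply: leq_trans (card_bigcup_sum _ _) _; rewrite mulnC -sum_nat_const.
apply: leq_sum => v _; rewrite -[k in (k * _)%N]card_ord; apply: card_bigcup_le => j.
exact: card_signature.
Qed.

Lemma count_diff (R : realType) l M K : (M <= K)%N ->
  `|\sum_u (#|avoiding_class c u| == l)%:R - \sum_u (local_class l M K c u)%:R| <=
  #|large_class l M|%:R + (k * M).+1%:R * \sum_i #|off_giant i K|%:R :> R.
Proof.
move=> MK; rewrite -sumrB; apply: le_trans (ler_norm_sum _ _ _) _.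
apply: (@le_trans _ _ (#|exceptional l M K|%:R)); last first.
  by rewrite -natr_sum -natrM -natrD ler_nat card_exceptional.
rewrite -sum1_card natr_sum [leRHS]big_mkcond; apply: ler_sum => u _.
case: ifPn => [_|uE]; last by rewrite (local_class_exact MK uE) subrr normr0.
case: (_ == _); case: (local_class _ _ _ _ _);
  by rewrite ?subrr ?normr0 ?subr0 ?sub0r ?normrN ?normr1.
Qed.

End Comparison.

Section Densities.
Context {R : realType} (k : nat).
Local Open Scope classical_set_scope.
Variable lambda : 'I_k -> R.
Hypothesis lambda_ge0 : forall i, 0 <= lambda i.
Hypothesis rate_gt0 : forall i, 0 < \sum_(j < k) lambda j - lambda i.

Notation Ec n f := (pexp (fun _ : edge n => edge_law lambda n) f).
Let law n : is_law (fun _ : edge n => edge_law lambda n) := @edge_law_law R k lambda lambda_ge0 n.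

Lemma Ec_splits n i K : Ec n (fun c => (splits c i K)%:R) =
  pexp (fun _ : edge n => bern (without_prob lambda n i))
    (fun c => \sum_u \sum_v (split_pair K c u v)%:R).
Proof.
rewrite -pexp_without //; apply: eq_pexp => c; rewrite /splits natr_sum.
apply: eq_bigr => u _; rewrite natr_sum; apply: eq_bigr => v _.
have E := eq_gcomp (orel_forget c (other_color0 i)).
by rewrite /split /split_pair /both_big /big !E andbA.
Qed.

Lemma few_splits (eps : R) : 0 < eps -> exists K0, forall K, (K0 <= K)%N ->
  \forall n \near \oo, Ec n (fun c => \sum_i (splits c i K)%:R) <= eps * n%:R ^+ 2.
Proof.
move=> e0.
suff H (s : seq 'I_k) (e : R) : 0 < e -> exists K0, forall K, (K0 <= K)%N ->
    \forall n \near \oo, Ec n (fun c => \sum_(i <- s) (splits c i K)%:R) <= e * n%:R ^+ 2.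
  by have [K0 HK0] := H (index_enum _) _ e0; exists K0.
elim: s e {e0} => [|i s IH] e e0.
  exists 0%N => K _; near=> n; rewrite (@eq_pexp _ _ _ _ _ (fun=> 0)) ?pexp0.
    by rewrite mulr_ge0 ?exprn_ge0 // ltW.
  by move=> c; rewrite big_nil.
have e2 : 0 < e / 2 by rewrite divr_gt0.
have [K1 H1] := IH _ e2.
have [K2 H2] := few_split_pairs (fun n => without_prob01 lambda_ge0 n i)
  (@without_prob_cvg R k lambda lambda_ge0 i) (rate_gt0 i) e2.
exists (maxn K1 K2) => K; rewrite geq_max => /andP[/H1 {}H1 /H2 {}H2].
near=> n.
rewrite (@eq_pexp _ _ _ _ _ (fun c => (splits c i K)%:R + \sum_(i <- s) (splits c i K)%:R)).
  rewrite pexpD [X in X * _]splitr mulrDl; apply: lerD; last by near: n.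
  by rewrite Ec_splits; near: n.
by move=> c; rewrite big_cons.
Unshelve. all: by end_near. Qed.

(** A first moment bound out of a second moment bound. *)
Lemma le_add_sqr (a d : R) : 0 < d -> a <= d + a ^+ 2 / d.
Proof.
move=> d0; rewrite -(ler_pM2r d0) mulrDl divfK ?gt_eqF //.
have := sqr_ge0 (a - d); have := sqr_ge0 d; have := sqr_ge0 a; nra.
Qed.

Definition class_count n (c : {ffun edge n -> {set 'I_k}}) l : R :=
  \sum_u (#|avoiding_class c u| == l)%:R.

Definition local_count M K n (c : {ffun edge n -> {set 'I_k}}) l : R :=
  \sum_u (local_class l M K c u)%:R.

(** [M] is chosen first, so that few vertices are large for every color and still
    in a class of size [l]; then [K], so that the vertices off the giant are
    few even compared with [1 / M]. *)
Lemma local_approximation l (eps : R) : 0 < eps -> exists M K, \forall n \near \oo,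
  Ec n (fun c => `|class_count c l / n%:R - local_count M K c l / n%:R|) <= eps.
Proof.
move=> e0; pose d := eps / 8; have d0 : 0 < d by rewrite divr_gt0.
have ed0 : 0 < eps * d / 8 by rewrite divr_gt0 ?mulr_gt0.
have [M HM] := few_splits ed0; exists M.
have {}HM := HM _ (leqnn M).
pose A : R := (k * M).+1%:R; have A0 : 0 < A by rewrite ltr0n.
pose d' := eps / (8 * A * k.+1%:R).
have k0 : 0 < k.+1%:R :> R by rewrite ltr0n.
have d'0 : 0 < d' by apply: divr_gt0 => //; rewrite !mulr_gt0.
have ed'0 : 0 < eps * d' / (16 * A) by apply: divr_gt0; apply: mulr_gt0.
have hlim : (fun n => l%:R / n%:R : R) @ \oo --> (0 : R).
  by apply: (@cvg_divn _ (fun=> l%:R) l%:R); exact: cvg_cst.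
have [K0 HK0] := few_splits ed'0; pose K := maxn M K0; exists K.
have {}HK : \forall n \near \oo, Ec n (fun c => \sum_i (splits c i K)%:R) <= eps * d' / (16 * A) * n%:R ^+ 2.
  by apply: HK0; rewrite leq_maxr.
near=> n.
have n0 : 0 < n%:R :> R by rewrite ltr0n; near: n; exact: nbhs_infty_gt.
have n0' : n%:R != 0 :> R by rewrite gt_eqF.
have hM : Ec n (fun c => \sum_i (splits c i M)%:R) <= eps * d / 8 * n%:R ^+ 2 by near: n.
have hK : Ec n (fun c => \sum_i (splits c i K)%:R) <= eps * d' / (16 * A) * n%:R ^+ 2 by near: n.
have hl : l%:R / n%:R <= eps * d / 8.
  by near: n; exact: (cvgr_le _ hlim).
have sq (m : nat) (x : R) : m%:R ^+ 2 <= x -> forall e, 0 < e -> m%:R / n%:R <= e + x / n%:R ^+ 2 / e.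
  move=> mx e ee; apply: le_trans (le_add_sqr _ ee) _; rewrite lerD2l.
  apply: ler_wpM2r; first by rewrite invr_ge0 ltW.
  by rewrite exprMn exprVn; apply: ler_wpM2r; rewrite // invr_ge0 exprn_ge0 // ltW.
(* [le_add_sqr] is applied with [d] to the large classes and with [d'] to the
   vertices off the giant; the factor [A] forces [d'] to depend on [M]. *)
have bound (c : {ffun edge n -> {set 'I_k}}) :
    `|class_count c l / n%:R - local_count M K c l / n%:R| <=
    (d + l%:R / n%:R / d + A * k%:R * d')
    + (n%:R ^- 2 / d * \sum_i (splits c i M)%:R
    + A * (2 * n%:R ^- 2 / d') * \sum_i (splits c i K)%:R).
  have i0 : 0 <= n%:R^-1 :> R by rewrite invr_ge0 ltW.
  rewrite -mulrBl normrM (ger0_norm i0).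
  have cd := count_diff c R l (leq_maxl M K0); rewrite -/K -/A in cd.
  apply: (le_trans (ler_wpM2r i0 cd)).
  rewrite mulrDl.
  have h1 : #|large_class c l M|%:R / n%:R <=
      d + (l%:R * n%:R + \sum_i (splits c i M)%:R) / n%:R ^+ 2 / d.
    apply: sq => //; rewrite -natr_sum -natrM -natrD -natrX ler_nat.
    exact: card_large_class.
  have h2 : (\sum_i #|off_giant c i K|%:R) / n%:R <=
      k%:R * d' + 2 * n%:R ^- 2 / d' * \sum_i (splits c i K)%:R.
    rewrite mulr_suml mulr_sumr -[k in k%:R * _]card_ord mulr_natl -sumr_const -big_split /=.
    apply: ler_sum => i _.
    have : #|off_giant c i K|%:R / n%:R <= d' + (2 * (splits c i K)%:R) / n%:R ^+ 2 / d'.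
      by apply: sq => //; rewrite -natrX -natrM ler_nat; exact: card_off_giant.
    by move/le_trans; apply; rewrite lerD2l le_eqVlt; apply/orP; left; apply/eqP; ring.
  have h2' := ler_wpM2l (ltW A0) h2.
  rewrite -[_ * _ / n%:R]mulrA.
  apply: le_trans (lerD h1 h2') _.
  rewrite le_eqVlt; apply/orP; left; apply/eqP; field.
  by rewrite n0' !gt_eqF.
apply: le_trans (ler_pexp (@law n) bound) _.
rewrite pexpD pexp_cst ?pexpD ?pexpZ //.
have b1 : l%:R / n%:R / d <= eps / 8.
  by rewrite ler_pdivrMr // mulrAC.
have b2 : n%:R ^- 2 / d * Ec n (fun c => \sum_i (splits c i M)%:R) <= eps / 8.
  rewrite mulrC mulrA ler_pdivrMr // ler_pdivrMr ?exprn_gt0 //.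
  by apply: le_trans hM _; rewrite le_eqVlt; apply/orP; left; apply/eqP; ring.
have b3 : A * (2 * n%:R ^- 2 / d') * Ec n (fun c => \sum_i (splits c i K)%:R) <= eps / 8.
  have a0 : 0 <= A * (2 * n%:R ^- 2 / d').
    by rewrite !mulr_ge0 ?invr_ge0 ?exprn_ge0 // ltW.
  apply: le_trans (ler_wpM2l a0 hK) _; rewrite le_eqVlt; apply/orP; left; apply/eqP.
  by field; rewrite n0' !gt_eqF.
have b4 : A * k%:R * d' <= eps / 8.
  rewrite /d' mulrA ler_pdivrMr ?mulr_gt0 //.
  rewrite (_ : eps / 8 * (8 * A * k.+1%:R) = A * k.+1%:R * eps); last by field.
  apply: ler_wpM2r; first exact: ltW.
  by apply: ler_wpM2l; [exact: ltW|rewrite ler_nat].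
rewrite /d in b1 b2 *; move: b1 b2 b3 b4.
set x1 := l%:R / _ / _; set x2 := _ * Ec _ _; set x3 := _ * Ec _ _; set x4 := _ * d'.
lra.
Unshelve. all: by end_near. Qed.

End Densities.

(** * Limits of the class densities *)

Section ClassDensities.
Context {R : realType} (k : nat).
Local Open Scope classical_set_scope.
Variable lambda : 'I_k -> R.
Hypothesis lambda_ge0 : forall i, 0 <= lambda i.
Hypothesis rate_gt0 : forall i, 0 < \sum_(j < k) lambda j - lambda i.

Notation Ec n f := (pexp (fun _ : edge n => edge_law lambda n) f).
Let law n : is_law (fun _ : edge n => edge_law lambda n) := @edge_law_law R k lambda lambda_ge0 n.

Lemma cvg_of_approx (x : nat -> R) :
  (forall eps : R, 0 < eps -> exists y : R, \forall n \near \oo, `|y - x n| <= eps) ->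
  cvgn x.
Proof.
move=> H; apply/cauchy_cvgP; apply: cauchy_exP => eps e0.
have e2 : 0 < eps / 2 by rewrite divr_gt0.
have [y Hy] := H _ e2; exists y; near=> n.
apply: (@le_lt_trans _ _ (eps / 2)); first by near: n.
by rewrite ltr_pdivrMr // ltr_pMr // ltr1n.
Unshelve. all: by end_near. Qed.

Definition mean_cvg (X : forall n, {ffun edge n -> {set 'I_k}} -> R) (l : R) : Prop :=
  (fun n => Ec n (fun c => `|X n c - l|)) @ \oo --> (0 : R).

(** The mean converges as it is within [eps] of the converging mean of a local
    count, and the local count is concentrated. *)
Lemma class_density_cvg l : exists nu : R,
  0 <= nu /\ mean_cvg (fun n c => class_count c l / n%:R : R) nu.
Proof.
pose x n := Ec n (fun c => class_count c l / n%:R).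
have approx (eps : R) : 0 < eps -> exists M K (y : R),
   [/\ \forall n \near \oo, Ec n (fun c => `|class_count c l / n%:R - local_count M K c l / n%:R|) <= eps,
       \forall n \near \oo, `|y - x n| <= 2 * eps &
       (fun n => Ec n (fun c => (local_count M K c l / n%:R - y) ^+ 2)) @ \oo --> (0 : R)].
  move=> e0; have [M [K HMK]] := local_approximation lambda_ge0 rate_gt0 l e0.
  have F01 n (c : {ffun edge n -> {set 'I_k}}) u : 0 <= ((local_class l M K c u)%:R : R) <= 1.
    by rewrite ler0n lern1 leq_b1.
  have [y [_ Hy]] := local_average_cvg (edge_law_sparse lambda_ge0)
    (@local_class_local k R l M K) F01.
  exists M, K, y; split => //; last first.
    apply: (@concentration R k lambda lambda_ge0 (fun n c => local_count M K c l)
      (affected_bound k K)%:R) => //.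
    by move=> n; exact: bounded_influence_local_class.
  near=> n.
  have h1 : `|y - Ec n (fun c => local_count M K c l / n%:R)| <= eps.
    by near: n; exact: cvg_dist Hy e0.
  have h2 : Ec n (fun c => `|class_count c l / n%:R - local_count M K c l / n%:R|) <= eps.
    by near: n.
  have h3 : `|Ec n (fun c => local_count M K c l / n%:R) - x n| <= eps.
    rewrite distrC /x -pexpB; apply: le_trans h2; exact: ler_norm_pexp.
  have := ler_distD (Ec n (fun c => local_count M K c l / n%:R)) y (x n).
  by move/le_trans; apply; rewrite mulr_natl mulr2n; apply: lerD.
have cx : cvgn x.
  apply: cvg_of_approx => eps e0.
  have e2 : 0 < eps / 2 by rewrite divr_gt0.
  have [M [K [y [_ H _]]]] := approx _ e2; exists y.
  by move: H; rewrite (_ : 2 * (eps / 2) = eps) //; field.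
exists (limn x); split.
  apply: limr_ge => //; near=> n; apply: pexp_ge0 => // c.
  by rewrite divr_ge0 // sumr_ge0.
apply/cvgrPdist_le => eps e0.
have e8 : 0 < eps / 8 by rewrite divr_gt0.
have [M [K [y [H1 H2 H3]]]] := approx _ e8.
have hy : `|y - limn x| <= 3 * (eps / 8).
  have [n [h1 h2]] := filter_ex (filterI H2 (cvg_dist cx e8)).
  have := ler_distD (x n) y (limn x); move/le_trans; apply.
  rewrite (_ : 3 * _ = 2 * (eps / 8) + eps / 8); last by ring.
  by apply: lerD => //; rewrite distrC.
have d0 : 0 < eps / 8 * (eps / 8) by rewrite mulr_gt0.
near=> n.
rewrite sub0r normrN ger0_norm; last by apply: pexp_ge0 => // c; exact: normr_ge0.
have h1 : Ec n (fun c => `|class_count c l / n%:R - local_count M K c l / n%:R|) <= eps / 8.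
  by near: n.
have h3 : Ec n (fun c => (local_count M K c l / n%:R - y) ^+ 2) <= eps / 8 * (eps / 8).
  by near: n; exact: (cvgr_le _ H3).
apply: (@le_trans _ _ (Ec n (fun c => `|class_count c l / n%:R - local_count M K c l / n%:R|
   + ((eps / 8 + 3 * (eps / 8)) + (eps / 8)^-1 * (local_count M K c l / n%:R - y) ^+ 2)))).
  apply: ler_pexp => // c; set a := class_count _ _ / _; set b := local_count _ _ _ _ / _.
  have := ler_distD b a (limn x); move/le_trans; apply; rewrite lerD2l.
  have := ler_distD y b (limn x); move/le_trans; apply.
  have h : `|b - y| <= eps / 8 + (eps / 8)^-1 * (b - y) ^+ 2.
    rewrite [_^-1 * _]mulrC -[(b - y) ^+ 2]real_normK ?num_real //; exact: le_add_sqr.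
  by rewrite [leRHS]addrAC; apply: lerD.
rewrite pexpD pexpD pexpZ pexp_cst //.
have : (eps / 8)^-1 * Ec n (fun c => (local_count M K c l / n%:R - y) ^+ 2) <= eps / 8.
  by rewrite mulrC ler_pdivrMr.
move: h1; set z1 := Ec n _; set z2 := _ * Ec n _; lra.
Unshelve. all: by end_near. Qed.

Definition tail_count n (c : {ffun edge n -> {set 'I_k}}) K : R :=
  \sum_u (K < #|avoiding_class c u|)%N%:R.

Lemma tail_countE n (c : {ffun edge n -> {set 'I_k}}) K :
  tail_count c K = n%:R - \sum_(1 <= l < K.+1) class_count c l.
Proof.
rewrite /class_count exchange_big /= -[n in n%:R]card_ord -sum1_card natr_sum -sumrB.
apply: eq_bigr => u _.
have A0 : (0 < #|avoiding_class c u|)%N.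
  by apply/card_gt0P; exists u; rewrite inE; apply/forallP => i; exact: gcomp_center.
case: ltnP => AK; last first.
  rewrite (bigD1_seq #|avoiding_class c u|) ?iota_uniq //=; last first.
    by rewrite mem_index_iota A0 ltnS.
  rewrite eqxx big1 ?addr0 ?subrr // => l /negPf.
  by rewrite eq_sym => ->.
rewrite big_nat big1 ?subr0 // => l /andP[_ lK]; case: eqP => // E.
by move: AK; rewrite E ltnNge -ltnS lK.
Qed.

Definition max_class n (c : {ffun edge n -> {set 'I_k}}) : nat :=
  (\max_(u < n) #|avoiding_class c u|)%N.

(** If the largest class has more than [K] vertices, all of them are counted. *)
Lemma max_class_le_tail n (c : {ffun edge n -> {set 'I_k}}) K :
  (max_class c)%:R <= tail_count c K + K%:R.
Proof.
rewrite /tail_count -natr_sum -natrD ler_nat; apply/bigmax_leqP => u _.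
case: (leqP #|avoiding_class c u| K) => AK; first exact: leq_trans AK (leq_addl _ _).
apply: leq_trans (leq_addr _ _); rewrite -sum1_card big_mkcond; apply: leq_sum => v _.
case: ifP => // vu.
suff -> : avoiding_class c v = avoiding_class c u by rewrite AK.
apply/setP => w; rewrite !in_avoiding; apply: eq_forallb => i.
by move: vu; rewrite in_avoiding => /forallP/(_ i)/(gcomp_same (crel_sym i c)) ->.
Qed.

(** A pair of vertices in classes of more than [K] vertices is either equivalent,
    which leaves at most [max_class c] choices for the second vertex, or split
    for some color. *)
Lemma tail_splits n (c : {ffun edge n -> {set 'I_k}}) K :
  tail_count c K * (tail_count c K - (max_class c)%:R) <= \sum_i (splits c i K)%:R.
Proof.
rewrite mulrBr /tail_count mulr_suml [X in _ - X]mulr_suml -sumrB.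
rewrite /splits; under [leRHS]eq_bigr do rewrite natr_sum.
rewrite exchange_big /=; apply: ler_sum => u _.
case: (ltnP K #|avoiding_class c u|) => uK; last first.
  by rewrite !mul0r subr0; apply: sumr_ge0.
rewrite !mul1r lerBlDr.
apply: (@le_trans _ _ (\sum_v (\sum_i (split c i K u v)%:R + (v \in avoiding_class c u)%:R))); last first.
  rewrite big_split exchange_big /= lerD //.
    by apply: ler_sum => i _; rewrite natr_sum.
  rewrite -natr_sum ler_nat.
  apply: (@leq_trans #|avoiding_class c u|); last exact: (leq_bigmax u).
  by rewrite -sum1_card [X in (_ <= X)%N]big_mkcond.
apply: ler_sum => v _; case: ltnP => vK; last first.
  by rewrite addr_ge0 // sumr_ge0.
case: (boolP (v \in avoiding_class c u)) => [_|]; first by rewrite lerDr sumr_ge0.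
rewrite addr0 in_avoiding negb_forall => /existsP[i vu].
have sub w : (#|avoiding_class c w| <= #|gcomp (crel i c) w|)%N.
  by apply: subset_leq_card; apply/fintype.subsetP => z; rewrite in_avoiding => /forallP.
rewrite (bigD1 i) //= /split vu (leq_trans uK (sub u)) (leq_trans vK (sub v)) lerDl.
exact: sumr_ge0.
Qed.

(** Writing [s] for the limiting proportion of vertices in classes of size
    larger than [K], almost all pairs of such vertices are equivalent, whence
    [s * (s - a) <= o(1)]; and [a <= s] since a macroscopic class is large. *)
Lemma class_density_sum (nu : nat -> R) (a : R) : 0 <= a ->
  (forall l, mean_cvg (fun n c => class_count c l / n%:R) (nu l)) ->
  mean_cvg (fun n c => (max_class c)%:R / n%:R) a ->
  (fun m => \sum_(1 <= l < m.+1) nu l) @ \oo --> 1 - a.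
Proof.
move=> a0 Hnu Ha.
pose s K := 1 - \sum_(1 <= l < K.+1) nu l.
pose t n (c : {ffun edge n -> {set 'I_k}}) K := tail_count c K / n%:R.
have tE n (c : {ffun edge n -> {set 'I_k}}) K : (0 < n)%N -> t n c K - s K =
    \sum_(1 <= l < K.+1) (nu l - class_count c l / n%:R).
  move=> n0; rewrite /t tail_countE mulrBl divff ?pnatr_eq0 -?lt0n // sumrB -mulr_suml /s.
  by set x := \sum_(_ <= _ < _) _; set y := _ / _; ring.
have ts K : mean_cvg (fun n c => t n c K) (s K).
  have lim : (fun n => \sum_(1 <= l < K.+1) Ec n (fun c => `|class_count c l / n%:R - nu l|)) @ \oo --> (0 : R).
    have E0 : \sum_(1 <= l < K.+1) (0 : R) = 0 by rewrite big1.
    by rewrite -[X in _ --> X]E0; apply: cvg_sumr => l _; exact: Hnu.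
  apply: (squeeze_cvgr _ (cvg_cst 0) lim); near=> n.
  apply/andP; split; first by apply: pexp_ge0 => // c; exact: normr_ge0.
  rewrite -pexp_sum; apply: ler_pexp => // c; rewrite tE; last by near: n; exact: nbhs_infty_gt.
  by apply: le_trans (ler_norm_sum _ _ _) _; apply: ler_sum => l _; rewrite distrC.
pose m n (c : {ffun edge n -> {set 'I_k}}) : R := (max_class c)%:R / n%:R.
have as_ K : a <= s K.
  have lim : (fun n => s K + K%:R / n%:R + (Ec n (fun c => `|t n c K - s K|)
      + Ec n (fun c => `|m n c - a|))) @ \oo --> s K + 0 + (0 + 0).
    apply: cvgD; last by apply: cvgD; [exact: ts|exact: Ha].
    apply: cvgD; first exact: cvg_cst.
    by apply: (@cvg_divn _ (fun=> K%:R) K%:R); exact: cvg_cst.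
  rewrite !addr0 in lim; rewrite -(cvg_lim _ lim) //; apply: limr_ge.
    by apply/cvg_ex; eexists; exact: lim.
  near=> n; have n0 : 0 < n%:R :> R by rewrite ltr0n; near: n; exact: nbhs_infty_gt.
  rewrite -[leLHS](pexp_cst _ (@law n)) -[X in X + (_ + _)](pexp_cst _ (@law n)) -!pexpD.
  apply: ler_pexp => // c.
  have h : m n c <= t n c K + K%:R / n%:R.
    by rewrite -mulrDl ler_pM2r ?invr_gt0 //; exact: max_class_le_tail.
  have h1 : a <= m n c + `|m n c - a| by rewrite -lerBlDl -normrN opprB ler_norm.
  have h2 : t n c K <= s K + `|t n c K - s K| by rewrite -lerBlDl ler_norm.
  by move: h h1 h2; set x1 := `|_|; set x2 := `|_|; set x3 := _ / _; lra.
have small (eps : R) : 0 < eps -> exists K0, forall K, (K0 <= K)%N -> s K * (s K - a) <= eps.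
  move=> e0; have e2 : 0 < eps / 2 by rewrite divr_gt0.
  have [K0 HK0] := few_splits lambda_ge0 rate_gt0 e2; exists K0 => K /HK0 {}HK0.
  pose B := `|s K| + 1 + a.
  have lim : (fun n => eps / 2 + (B * Ec n (fun c => `|t n c K - s K|)
      + Ec n (fun c => `|m n c - a|))) @ \oo --> eps / 2 + (B * 0 + 0).
    apply: cvgD; first exact: cvg_cst.
    apply: cvgD; last exact: Ha.
    by apply: cvgM; [exact: cvg_cst|exact: ts].
  have lt : eps / 2 + (B * 0 + 0) < eps by rewrite mulr0 !addr0 ltr_pdivrMr // ltr_pMr // ltr1n.
  have HL : \forall n \near \oo, eps / 2 + (B * Ec n (fun c => `|t n c K - s K|)
      + Ec n (fun c => `|m n c - a|)) < eps by exact: (cvgr_lt _ lim).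
  have [n [h1 [h2 n0]]] := filter_ex (filterI HK0 (filterI HL (nbhs_infty_gt 0))).
  have n0' : 0 < n%:R :> R by rewrite ltr0n.
  apply: le_trans (ltW h2).
  have h1' : Ec n (fun c => n%:R ^- 2 * \sum_i (splits c i K)%:R) <= eps / 2.
    by rewrite pexpZ mulrC ler_pdivrMr ?exprn_gt0.
  apply: le_trans (lerD h1' (lexx _)).
  rewrite -pexpZ -!pexpD -[leLHS](pexp_cst _ (@law n)); apply: ler_pexp => // c.
  have tsp : t n c K * (t n c K - m n c) <= n%:R ^- 2 * \sum_i (splits c i K)%:R.
    rewrite [leRHS]mulrC ler_pdivlMr ?exprn_gt0 //; apply: le_trans (tail_splits c K).
    rewrite le_eqVlt; apply/orP; left; apply/eqP; rewrite /t /m; field; exact: lt0r_neq0.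
  have t0 : 0 <= t n c K by rewrite divr_ge0 // sumr_ge0.
  have t1 : t n c K <= 1.
    rewrite ler_pdivrMr // mul1r /tail_count -[n in leRHS]card_ord -sum1_card natr_sum.
    by apply: ler_sum => u _; rewrite ler_nat leq_b1.
  have e1 : s K * (s K - a) = t n c K * (t n c K - m n c) +
     ((s K - t n c K) * (s K + t n c K - a) + t n c K * (m n c - a)) by ring.
  rewrite e1; apply: lerD => //; apply: lerD.
    apply: le_trans (ler_norm _) _; rewrite normrM distrC mulrC; apply: ler_wpM2r => //.
    apply: le_trans (ler_normB _ _) _; rewrite (ger0_norm a0) lerD2r.
    by apply: le_trans (ler_normD _ _) _; rewrite lerD2l ger0_norm.
  apply: le_trans (ler_norm _) _; rewrite normrM ger0_norm //.
  by rewrite -[leRHS]mul1r; apply: ler_wpM2r.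
have slim : s @ \oo --> a.
  apply/cvgrPdist_le => eps e0.
  have [K0 HK0] := small _ (exprn_gt0 2 e0).
  exists K0 => // K /= /HK0 h.
  have h0 := as_ K.
  have sq : (s K - a) ^+ 2 <= eps ^+ 2.
    apply: le_trans h; rewrite expr2; apply: ler_wpM2r; rewrite ?subr_ge0 //.
    by rewrite lerBlDr lerDl.
  rewrite distrC ger0_norm ?subr_ge0 //.
  by move: sq; rewrite ler_pXn2r // ?nnegrE ?subr_ge0 // ltW.
have : (fun m => 1 - s m) @ \oo --> 1 - a by apply: cvgB => //; exact: cvg_cst.
by rewrite (_ : (fun m => 1 - s m) = fun m => \sum_(1 <= l < m.+1) nu l) //;
  apply/funext => K; rewrite /s opprB addrCA subrr addr0.
Unshelve. all: by end_near. Qed.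

End ClassDensities.

(** * No large component: all classes are singletons *)

Section Trees.
Context (k : nat).

Notation P c := (orel finset.set0 (predC1 finset.set0) c).

(** In a tree whose edges carry a single color, deleting the color of the first
    edge of a path separates its ends. *)
Lemma avoiding_class_tree s (c : {ffun edge s.+1 -> {set 'I_k}}) u r :
  gball (P c) u r = [set: _]%SET ->
  #|[set e | c e != finset.set0]%SET| = s ->
  (forall e, c e != finset.set0 -> exists j, c e = [set j]%SET) ->
  avoiding_class c u = [set u]%SET.
Proof.
move=> BT cs single; apply/eqP; rewrite eq_sym finset.eqEsubset finset.sub1set.
have -> : u \in avoiding_class c u by rewrite in_avoiding; apply/forallP => i; exact: gcomp_center.
rewrite andTb; apply/fintype.subsetP => v; rewrite in_avoiding => /forallP vC.
rewrite finset.in_set1; apply/negPn/negP => vu.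
have : v \in gcomp (P c) u by apply: (fintype.subsetP (gball_sub_gcomp _ _ r)); rewrite BT inE.
rewrite inE => /connectP[p0 ep0 ev]; move: ev; case/shortenP: ep0 => p ep up _ ev.
case: p ep up ev => [|x p] ep up ev; first by rewrite ev eqxx in vu.
case/andP: ep => ux ep; case/andP: up => nu _.
have nux : u != x by move: nu; rewrite inE negb_or => /andP[].
pose e := edge_of nux.
have ce : c e != finset.set0 by move: ux; rewrite /orel /= (mark_edge _ _ nux).
have [j cj] := single e ce.
pose c' := upd c e finset.set0.
have keep y z : val e != [set y; z]%SET -> P c y z -> P c' y z.
  by rewrite /orel /= mark_upd => /negPf ->.
have cr y z : crel j c y z -> P c' y z.
  move=> yz; apply: keep (crel_sub yz); apply: contraTneq yz => E.
  rewrite /crel /orel /other_color negbK /mark -E mark_set_val cj; exact: fintype.subxx.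
have s' : symmetric (P c') by exact: orel_sym.
have xu : x \in gcomp (P c') u.
  have uv : v \in gcomp (P c') u.
    have := vC j; rewrite !inE; apply: connect_sub => y z yz; apply: connect1; exact: cr.
  rewrite -(gcomp_same s' uv) (in_compC s') inE; apply/connectP; exists p => //.
  by rewrite (@path_upd _ finset.set0 s.+1 _ c e finset.set0 u) //= !inE eqxx.
have CT : gcomp (P c') u = [set: _]%SET.
  apply/eqP; rewrite finset.eqEsubset finset.subsetT /=.
  have <- : gcomp (P c) u = [set: _]%SET.
    by apply/eqP; rewrite finset.eqEsubset finset.subsetT -BT gball_sub_gcomp.
  apply: gcomp_min; first exact: gcomp_center.
  move=> y z yC yz; case: (eqVneq (val e) [set y; z]%SET) => [E|ne]; last first.
    by apply: gcomp_closed yC _; exact: keep.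
  have : z \in [set u; x]%SET by rewrite (E : [set u; x]%SET = _) !finset.in_set2 eqxx orbT.
  rewrite finset.in_set2 => /orP[] /eqP -> //; exact: gcomp_center.
have BT' : gball (P c') u s.+1 = [set: 'I_s.+1]%SET.
  by rewrite -gcomp_sub_ball CT // finset.cardsT card_ord.
have := card_edges_connected (O := predC1 finset.set0) _ BT'.
rewrite /= eqxx => /(_ isT) le1.
have : ([set e' | c' e' != finset.set0] \proper [set e' | c e' != finset.set0])%SET.
  apply/properP; split.
    apply/fintype.subsetP => e'; rewrite !inE updE; case: (e' == e) => //.
    by rewrite eqxx.
  by exists e; rewrite inE // updE !eqxx.
by move=> /proper_card; rewrite cs ltnNge le1.
Qed.

End Trees.

Section Subcritical.
Context {R : realType} (k : nat).
Local Open Scope classical_set_scope.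
Variable lambda : 'I_k -> R.
Hypothesis lambda_ge0 : forall i, 0 <= lambda i.
Variable i0 : 'I_k.

Notation Ec n f := (pexp (fun _ : edge n => edge_law lambda n) f).
Notation P c := (orel finset.set0 (predC1 finset.set0) c).
Let law n : is_law (fun _ : edge n => edge_law lambda n) := @edge_law_law R k lambda lambda_ge0 n.

(** Vertices with small components whose class is not a singleton; smallness makes
    this property local. *)
Definition small_nontrivial M n (c : {ffun edge n -> {set 'I_k}}) u : bool :=
  [forall i, #|gcomp (crel i c) u| <= M]%N && ~~ local_class 1 M M c u.

(** If no component is truncated, the truncated class is the class. *)
Lemma local_class_small M n (c : {ffun edge n -> {set 'I_k}}) u :
  [forall i, #|gcomp (crel i c) u| <= M]%N ->
  local_class 1 M M c u = (#|avoiding_class c u| == 1%N).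
Proof.
move=> /forallP uM.
have su i : signature M c u i = gcomp (crel i c) u by rewrite /signature uM.
have u0 i : (0 < #|signature M c u i|)%N by rewrite signature_gt0.
have ex : [exists i, 0 < #|signature M c u i| <= M]%N.
  by apply/existsP; exists i0; rewrite u0 card_signature.
rewrite /local_class ex andTb; suff -> : truncated_class M c u = avoiding_class c u by [].
apply/setP => v; rewrite inE in_avoiding; apply/forallP/forallP => H i; last first.
  have E := gcomp_same (crel_sym i c) (H i).
  by rewrite /signature E.
rewrite -su (eqP (H i)); apply: in_signature; by rewrite -(eqP (H i)).
Qed.

Lemma small_nontrivial_local M :
  local finset.set0 (M + M).+1 (fun n c u => (small_nontrivial M (n := n) c u)%:R : R).
Proof.
move=> n s sigma c x inj Br; rewrite /small_nontrivial (local_class_pull 1 M inj Br).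
congr (nat_of_bool (_ && _))%:R; apply: eq_forallb => i.
have MM : (M + M <= (M + M).+1)%N by exact: leqnSn.
rewrite -!signature_gt0.
by rewrite (@signature_pull k M n s sigma c x x M _ i inj Br (gball_center _ _ M) MM) card_imset.
Qed.

(** In the limit the neighborhood of a vertex is a tree with single colors, where
    classes are singletons. *)
Lemma small_nontrivial_rare M :
  (fun n => Ec n (fun c => (\sum_u (small_nontrivial M c u)%:R) / n%:R)) @ \oo --> (0 : R).
Proof.
have F01 n (c : {ffun edge n -> {set 'I_k}}) u : 0 <= ((small_nontrivial M c u)%:R : R) <= 1.
  by rewrite ler0n lern1 leq_b1.
have [l [Sl El]] := local_average_cvg (edge_law_sparse lambda_ge0) (@small_nontrivial_local M) F01.
suff l0 : l = 0 by rewrite l0 in El.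
(* The limit is a series over trees, each term of which vanishes: it has an edge
   with several colors, whose rate is zero, or its center a singleton class. *)
apply: (cvg_unique (@Rhausdorff R) Sl).
rewrite (_ : (fun L => _) = fun=> 0); first exact: cvg_cst.
apply/funext => L; apply: big1 => s _; rewrite /ball_limit big1 ?mulr0 // => H /eqP HT.
case: eqP => [Hs|_]; last by rewrite mul0r mulr0.
case: (boolP [forall e, (H e != finset.set0) ==> [exists j, H e == [set j]%SET]]) => [/forallP all1|].
  have AC := avoiding_class_tree HT Hs.
  suff -> : small_nontrivial M H ord0 = false by rewrite mul0r.
  apply/negbTE/negP => /andP[sm /negP]; apply; rewrite local_class_small // AC ?finset.cards1 //.
  by move=> e He; have /implyP/(_ He)/existsP[j /eqP ->] := all1 e; exists j.
rewrite negb_forall => /existsP[e]; rewrite negb_imply => /andP[He /existsPn nj].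
rewrite (bigD1 e) //= (_ : color_rate lambda (H e) = 0) ?mul0r ?mulr0 //.
by rewrite /color_rate big1 // => j _; rewrite (negPf (nj j)) mul0r.
Qed.

(** A vertex outside a singleton class is one of the rare vertices above or has a
    large component for some color, and at rates up to one these have density
    zero by [small_mass_critical]. *)
Lemma subcritical_density (nu : R) :
  (forall i, 0 <= \sum_(j < k) lambda j - lambda i <= 1) ->
  mean_cvg lambda (fun n c => class_count c 1 / n%:R : R) nu -> nu = 1.
Proof.
move=> rate Hnu; apply/eqP; rewrite -subr_eq0 -normr_le0; apply/ler_addgt0Pl => eps e0.
rewrite addr0; pose d := eps / k.+2%:R.
have k0 : 0 < k.+2%:R :> R by rewrite ltr0n.
have d0 : 0 < d / 2 by rewrite !divr_gt0.
have [Mi HMi] := @choice 'I_k nat (fun i K => 1 - d / 2 <= small_mass (\sum_(j < k) lambda j - lambda i) K)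
  (fun i => small_mass_critical (rate i) d0).
pose M := (\max_i Mi i)%N.
have HM i : 1 - d / 2 <= small_mass (\sum_(j < k) lambda j - lambda i) M.
  apply: le_trans (HMi i) _; apply: small_mass_mono; first by case/andP: (rate i).
  exact: leq_bigmax.
pose a n := Ec n (fun c => `|class_count c 1 / n%:R - nu|).
pose b n := Ec n (fun c => (\sum_u (small_nontrivial M c u)%:R) / n%:R).
pose g n := \sum_i (1 - small_prob n (without_prob lambda n i) M).
have lim : (fun n => a n + b n + g n) @ \oo --> 0 + 0 +
    \sum_i (1 - small_mass (\sum_(j < k) lambda j - lambda i) M).
  apply: cvgD; first by apply: cvgD; [exact: Hnu|exact: small_nontrivial_rare].
  apply: cvg_sumr => i _; apply: cvgB; first exact: cvg_cst.
  apply: small_prob_cvg => [n|]; [exact: without_prob01|exact: without_prob_cvg].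
have lt : 0 + 0 + \sum_i (1 - small_mass (\sum_(j < k) lambda j - lambda i) M) < eps.
  rewrite !add0r; apply: (@le_lt_trans _ _ (\sum_(i < k) d / 2)).
    by apply: ler_sum => i _; have := HM i; lra.
  rewrite sumr_const card_ord -[X in X < _]mulr_natr /d.
  have E0 (z : R) : 0 < z -> eps / z / 2 * k%:R = eps * (k%:R / (2 * z)).
    by move=> z0; field; rewrite gt_eqF.
  rewrite E0 //.
  rewrite gtr_pMr // ltr_pdivrMr ?mulr_gt0 // mul1r -natrM ltr_nat; lia.
have [n [h n0]] := filter_ex (filterI (cvgr_lt _ lim _ lt) (nbhs_infty_gt 0)).
have n0' : 0 < n%:R :> R by rewrite ltr0n.
apply: le_trans (ltW h); rewrite -addrA; apply: (@le_trans _ _ (a n + Ec n (fun c => 1 - class_count c 1 / n%:R))).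
  rewrite -pexpD -[leLHS](pexp_cst _ (@law n)); apply: ler_pexp => // c.
  have c1 : 0 <= 1 - class_count c 1 / n%:R :> R.
    rewrite subr_ge0 ler_pdivrMr // mul1r /class_count -[n in leRHS]card_ord -sum1_card natr_sum.
    by apply: ler_sum => u _; rewrite ler_nat leq_b1.
  have := ler_distD (class_count c 1 / n%:R) nu 1; move/le_trans; apply.
  by rewrite distrC lerD2l distrC ger0_norm.
rewrite lerD2l.
apply: (@le_trans _ _ (Ec n (fun c => (\sum_u (small_nontrivial M c u)%:R) / n%:R +
   n%:R^-1 * \sum_i \sum_u (M < #|gcomp (crel i c) u|)%N%:R))).
  apply: ler_pexp => // c.
  rewrite [n%:R^-1 * _]mulrC -mulrDl -{1}(divff (lt0r_neq0 n0')) -mulrBl ler_pM2r ?invr_gt0 //.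
  rewrite exchange_big -big_split /= /class_count -[n in n%:R - _]card_ord -sum1_card natr_sum -sumrB.
  apply: ler_sum => u _; case: eqP => [_|/eqP nAC].
    by rewrite subrr addr_ge0 // sumr_ge0.
  rewrite subr0 /small_nontrivial; case: (boolP [forall i, _]) => [uM|].
    by rewrite local_class_small // nAC lerDl sumr_ge0.
  rewrite negb_forall => /existsP[i]; rewrite -ltnNge => iM.
  by rewrite add0r (bigD1 i) //= iM lerDl sumr_ge0.
rewrite pexpD lerD2l pexpZ pexp_sum mulr_sumr; apply: ler_sum => i _.
rewrite pexp_sum mulrC ler_pdivrMr // mulr_natr -[n in _ *+ n]card_ord -sumr_const.
apply: ler_sum => u _.
rewrite -(pexp_big M u (without_prob01 lambda_ge0 n i)) -(pexp_without lambda_ge0).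
rewrite le_eqVlt; apply/orP; left; apply/eqP; apply: eq_pexp => c.
by rewrite /big (eq_gcomp (orel_forget c (other_color0 i))).
Qed.

End Subcritical.

(** * Classes of every size *)

Section Insertion.
Context (k n m : nat).
Variables (i0 i1 : 'I_k).
Hypothesis i01 : i0 != i1.
Implicit Types (c : {ffun edge n -> {set 'I_k}}) (v w : {ffun 'I_m.+1 -> 'I_n}).

Notation C i c u := (gcomp (crel i c) u).

(** A configuration ready for the insertion of a path [v 0], ..., [v m] of color
    [i1], hung by edges of color [i0] onto a component in the other colors. *)
Definition ready c v w : bool :=
  [&& injectiveb v, [forall a, isolated c (v a)],
      [forall a, ~~ isolated c (w a)] & [forall a, w a \in C i1 c (w ord0)]].

Definition hanging v w (e : edge n) : bool := [exists a, val e == [set v a; w a]%SET].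

Definition chain v (e : edge n) : bool :=
  [exists b : 'I_m, val e == [set v (widen_ord (leqnSn m) b); v (lift ord0 b)]%SET].

Definition insert v w c : {ffun edge n -> {set 'I_k}} :=
  [ffun e => if hanging v w e then [set i0]%SET
             else if chain v e then [set i1]%SET else c e].

Lemma isolated_edge c u (e : edge n) : isolated c u -> u \in val e -> c e = finset.set0.
Proof.
move=> /forallP iso; have [x [y [xy ->]]] := edgeP e.
rewrite finset.in_set2 => /orP[] /eqP ue; subst u.
  by have := iso y; rewrite (mark_edge _ _ xy) => /eqP.
by have := iso x; rewrite markC (mark_edge _ _ xy) => /eqP.
Qed.

Section Ready.
Variables (c : {ffun edge n -> {set 'I_k}}) (v w : {ffun 'I_m.+1 -> 'I_n}).
Hypothesis rd : ready c v w.

Lemma ready_inj : injective v.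
Proof. by apply/injectiveP; case/and4P: rd. Qed.

Lemma ready_isolated a : isolated c (v a).
Proof. by case/and4P: rd => _ /forallP. Qed.

Lemma ready_neq a b : v a != w b.
Proof.
case/and4P: rd => _ _ /forallP/(_ b) nw _; apply: contraNneq nw => <-.
exact: ready_isolated.
Qed.

Lemma ready_touch (e : edge n) a : v a \in val e -> c e = finset.set0.
Proof. by apply: isolated_edge; exact: ready_isolated. Qed.

Lemma hanging_touch e : hanging v w e -> c e = finset.set0.
Proof. by case/existsP=> a /eqP E; apply: (@ready_touch e a); rewrite E !inE eqxx. Qed.

Lemma chain_touch e : chain v e -> c e = finset.set0.
Proof.
case/existsP=> b /eqP E; apply: (@ready_touch e (lift ord0 b)).
by rewrite E !inE eqxx orbT.
Qed.

Lemma mark_hanging a : mark finset.set0 (insert v w c) (v a) (w a) = [set i0]%SET.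
Proof.
rewrite (mark_edge _ _ (ready_neq a a)) ffunE.
by have -> : hanging v w (edge_of (ready_neq a a)) by apply/existsP; exists a.
Qed.

(** The inserted edges of color [i0] reveal [w], since [v a] was isolated and the
    path has the other color [i1]. *)
Lemma hanging_unique a y : mark finset.set0 (insert v w c) (v a) y = [set i0]%SET -> y = w a.
Proof.
case: (eqVneq (v a) y) => [->|vy].
  rewrite mark_diag => E; have i0i : i0 \in [set i0]%SET by rewrite inE.
  by move: i0i; rewrite -E inE.
rewrite (mark_edge _ _ vy) ffunE; case: ifP => [/existsP[a' /eqP E] _|_].
  have : v a \in [set v a'; w a']%SET by rewrite -E !inE eqxx.
  rewrite !inE (negPf (ready_neq a a')) orbF => /eqP/ready_inj aa'; subst a'.
  have : w a \in [set v a; y]%SET by rewrite (E : [set v a; y]%SET = _) !inE eqxx orbT.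
  by rewrite !inE [w a == _]eq_sym (negPf (ready_neq a a)) => /eqP.
case: ifP => [_ /finset.set1_inj E|_ E]; first by move: i01; rewrite E eqxx.
have c0 : c (edge_of vy) = finset.set0 by apply: (@ready_touch _ a); rewrite !inE eqxx.
have i0i : i0 \in [set i0]%SET by rewrite inE.
by move: i0i; rewrite -E c0 inE.
Qed.

Lemma chain_not_hanging e : chain v e -> hanging v w e = false.
Proof.
case/existsP=> b /eqP E; apply/negbTE/negP => /existsP[a /eqP E'].
have : w a \in [set v a; w a]%SET by rewrite !inE eqxx orbT.
by rewrite -E' E !inE ![w a == _]eq_sym !(negPf (ready_neq _ _)).
Qed.

Lemma insert_keep i y z : crel i c y z -> crel i (insert v w c) y z.
Proof.
rewrite /crel /orel; case: (eqVneq y z) => [->|yz]; first by rewrite !mark_diag.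
rewrite !(mark_edge _ _ yz) ffunE => o.
case: ifP => [/hanging_touch E|_]; first by move: o; rewrite E (negPf (other_color0 i)).
by case: ifP => [/chain_touch E|_ //]; move: o; rewrite E (negPf (other_color0 i)).
Qed.

(** Without color [i0] the path is cut off from all other vertices, so the class
    is within the path. The path itself is connected when any color other than
    [i1] is deleted; when [i1] is deleted, its vertices are connected through
    their hanging edges and the component of [w]. *)
Lemma insert_class : avoiding_class (insert v w c) (v ord0) = (v @: [set: _])%SET.
Proof.
apply/eqP; rewrite finset.eqEsubset; apply/andP; split.
  have sub0 : avoiding_class (insert v w c) (v ord0) \subset C i0 (insert v w c) (v ord0).
    by apply/fintype.subsetP => x; rewrite in_avoiding => /forallP.
  apply: fintype.subset_trans sub0 _.
  apply: gcomp_min; first exact: imset_f.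
  move=> x y /imsetP[a _ ->]; rewrite /crel /orel.
  case: (eqVneq (v a) y) => [<-|vy]; first by rewrite imset_f.
  rewrite (mark_edge _ _ vy) ffunE; case: ifP => [_|_].
    by rewrite /other_color fintype.subxx.
  case: ifP => [/existsP[b /eqP E] _|_]; last first.
    by rewrite (@ready_touch _ a) ?(negPf (other_color0 i0)) //= !inE eqxx.
  have : y \in [set v a; y]%SET by rewrite !inE eqxx orbT.
  by rewrite (E : [set v a; y]%SET = _) !inE => /orP[] /eqP ->; rewrite imset_f.
apply/fintype.subsetP => _ /imsetP[a _ ->]; rewrite in_avoiding; apply/forallP => i.
have sC := crel_sym i (insert v w c).
case: (eqVneq i i1) => [ii|ii].
  have vw b : w b \in C i (insert v w c) (v b).
    rewrite inE; apply: connect1; rewrite /crel /orel mark_hanging ii /other_color.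
    by rewrite finset.sub1set finset.in_set1.
  have ww : w a \in C i (insert v w c) (w ord0).
    case/and4P: rd => _ _ _ /forallP/(_ a); rewrite !inE ii; apply: connect_sub => y z yz.
    by apply: connect1; exact: insert_keep.
  by rewrite -(gcomp_same sC (vw ord0)) -(gcomp_same sC ww) (in_compC sC).
have step (b : 'I_m) : crel i (insert v w c) (v (widen_ord (leqnSn m) b)) (v (lift ord0 b)).
  have ne : v (widen_ord (leqnSn m) b) != v (lift ord0 b).
    apply/negP => /eqP/ready_inj/(congr1 val) /=; rewrite /bump /=; lia.
  rewrite /crel /orel (mark_edge _ _ ne) ffunE.
  have ch : chain v (edge_of ne) by apply/existsP; exists b.
  by rewrite chain_not_hanging // ch /other_color finset.sub1set finset.in_set1 eq_sym.
case: a => a am; elim: a am => [|a IH] am.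
  by rewrite (_ : Ordinal am = ord0) ?gcomp_center //; apply: val_inj.
have am' : (a < m)%N by [].
have := step (Ordinal am'); rewrite (_ : lift ord0 _ = Ordinal am); last exact: val_inj.
rewrite (_ : widen_ord _ _ = Ordinal (ltnW am : a < m.+1)%N); last exact: val_inj.
by apply: gcomp_closed; exact: IH.
Qed.

End Ready.

(** The inserted edges were absent before. *)
Lemma insert_inj v w c c' : ready c v w -> ready c' v w ->
  insert v w c = insert v w c' -> c = c'.
Proof.
move=> r r' E; apply/ffunP => e; have := congr1 (fun f : {ffun edge n -> {set 'I_k}} => f e) E.
rewrite !ffunE; case: ifP => [h _|_].
  by rewrite (hanging_touch r h) (hanging_touch r' h).
by case: ifP => [h _|_ //]; rewrite (chain_touch r h) (chain_touch r' h).
Qed.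

Definition reached c (p : {ffun 'I_m.+1 -> 'I_n} * {ffun 'I_m.+1 -> 'I_n}) : bool :=
  [exists c0, ready c0 p.1 p.2 && (c == insert p.1 p.2 c0)].

Definition insertions c := [set p | reached c p]%SET.

(** An insertion leading to a given configuration is determined by [v], as [w] is
    read off the edges of color [i0]; and [v] enumerates a class of size [m.+1]. *)
Lemma card_insertions c :
  (#|insertions c| <=
   m.+1 ^ m.+1 * #|[set u | #|avoiding_class c u| == m.+1]%SET|)%N.
Proof.
set Q := insertions c.
have QP p : p \in Q -> exists2 c0, ready c0 p.1 p.2 & c = insert p.1 p.2 c0.
  by rewrite inE => /existsP[c0 /andP[r /eqP E]]; exists c0.
have inj : {in Q &, injective (fun p : {ffun 'I_m.+1 -> 'I_n} * {ffun 'I_m.+1 -> 'I_n} => p.1)}.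
  move=> [v w] [v' w'] /QP[c0 /= r E] /QP[c1 /= r' E'] /= vv'; subst v'.
  congr pair; apply/ffunP => a; apply: (hanging_unique r'); rewrite -E' E.
  exact: (mark_hanging r).
rewrite -(card_in_imset inj) mulnC -sum_nat_const.
pose U := (\bigcup_(u in [set u | #|avoiding_class c u| == m.+1])
    [set v : {ffun 'I_m.+1 -> 'I_n} | v \in ffun_on (avoiding_class c u)])%SET.
apply: (@leq_trans #|U|).
  apply: subset_leq_card; apply/fintype.subsetP => _ /imsetP[[v w] /QP[c0 /= r E] ->].
  have AC := insert_class r; rewrite -E in AC.
  apply/finset.bigcupP; exists (v ord0).
    by rewrite inE AC card_imset ?finset.cardsT ?card_ord //; exact: (ready_inj r).
  by rewrite inE; apply/ffun_onP => a; rewrite AC imset_f.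
apply: leq_trans (card_bigcup_sum _ _) _; apply: leq_sum => u; rewrite inE => /eqP Au.
rewrite -[X in (_ <= X ^ _)%N]Au -[X in (_ <= _ ^ X)%N]card_ord -card_ffun_on.
by apply: subset_leq_card; apply/fintype.subsetP => f; rewrite inE.
Qed.

Definition giant_size c : nat := (\max_(u < n) #|C i1 c u|)%N.

Definition isolated_count c : nat := #|[set u | isolated c u]%SET|.

Lemma isolated_gcomp i c u : isolated c u -> C i c u = [set u]%SET.
Proof.
move=> /forallP iso; apply: gcomp_eq; [by rewrite inE|by rewrite finset.sub1set gcomp_center|].
move=> x y; rewrite finset.in_set1 => /eqP ->; rewrite /crel /orel (eqP (iso y)).
by rewrite (negPf (other_color0 i)).
Qed.

(** The component is not a single vertex, so that none of its vertices is
    isolated; hence [w] may be chosen freely in it. *)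
Lemma card_ready c : (1 < giant_size c)%N ->
  ((isolated_count c - m) ^ m.+1 * giant_size c ^ m.+1 <=
   #|[set p : {ffun 'I_m.+1 -> 'I_n} * {ffun 'I_m.+1 -> 'I_n} | ready c p.1 p.2]%SET|)%N.
Proof.
move=> g1.
have n0 : (0 < #|'I_n|)%N.
  rewrite card_ord; case: (posnP n) => // n0.
  by move: g1; rewrite /giant_size big1 // => -[a an]; exfalso; move: an; rewrite n0.
have [r Er'] := @bigop.eq_bigmax 'I_n (fun u => #|C i1 c u|) n0.
have Er : giant_size c = #|C i1 c r| by [].
pose S1 := [set v : {ffun 'I_m.+1 -> 'I_n} | (v \in ffun_on [set u | isolated c u]) && injectiveb v]%SET.
pose S2 := [set w : {ffun 'I_m.+1 -> 'I_n} | w \in ffun_on (C i1 c r)]%SET.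
apply: (@leq_trans #|finset.setX S1 S2|).
  rewrite finset.cardsX; apply: leq_mul.
    have -> : #|S1| = (isolated_count c ^_ m.+1)%N.
      transitivity (isolated_count c ^_ #|'I_m.+1|)%N; last by rewrite card_ord.
      by rewrite -card_inj_ffuns_on; apply: eq_card => f; rewrite !inE.
    have -> : ((isolated_count c - m) ^ m.+1 = \prod_(a < m.+1) (isolated_count c - m))%N.
      by rewrite prod_nat_const card_ord.
    by rewrite ffact_prod; apply: leq_prod => a _; apply: leq_sub2l; rewrite -ltnS.
  have -> : (giant_size c ^ m.+1 = #|C i1 c r| ^ #|'I_m.+1|)%N by rewrite card_ord Er.
  rewrite -card_ffun_on; apply: subset_leq_card; apply/fintype.subsetP => f fon.
  by rewrite inE.
apply: subset_leq_card; apply/fintype.subsetP => -[v w]; rewrite finset.in_setX /S1 /S2 !inE /=.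
case/andP => /andP[/ffun_onP von inj] /ffun_onP won; apply/and4P; split; first exact: inj.
- by apply/forallP => a; have := von a; rewrite inE.
- apply/forallP => a; apply/negP => /(isolated_gcomp i1) E.
  by move: g1; rewrite Er -(gcomp_same (crel_sym i1 c) (won a)) E finset.cards1.
- by apply/forallP => a; rewrite (gcomp_same (crel_sym i1 c) (won ord0)).
Qed.

Variable R : realType.

Lemma card_hanging v w : (#|[set e | hanging v w e]%SET| <= m.+1)%N.
Proof.
rewrite -(card_imset _ val_inj); apply: (@leq_trans #|[set [set v a; w a] | a in [set: 'I_m.+1]]%SET|).
  apply: subset_leq_card; apply/fintype.subsetP => _ /imsetP[e eS ->]; move: eS; rewrite inE => /existsP[a /eqP E].
  by apply/imsetP; exists a.
by apply: leq_trans (leq_imset_card _ _) _; rewrite finset.cardsT card_ord.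
Qed.

Lemma card_chain v : (#|[set e | chain v e]%SET| <= m)%N.
Proof.
rewrite -(card_imset _ val_inj).
apply: (@leq_trans #|[set [set v (widen_ord (leqnSn m) b); v (lift ord0 b)] | b in [set: 'I_m]]%SET|).
  apply: subset_leq_card; apply/fintype.subsetP => _ /imsetP[e eS ->]; move: eS; rewrite inE => /existsP[b /eqP E].
  by apply/imsetP; exists b.
by apply: leq_trans (leq_imset_card _ _) _; rewrite finset.cardsT card_ord.
Qed.

(** Only the marks of the inserted edges change; their former factors are at most
    one. *)
Lemma weight_insert (wv : {set 'I_k} -> R) c v w : is_law1 wv -> ready c v w ->
  wv [set i0]%SET ^+ m.+1 * wv [set i1]%SET ^+ m * weight (fun _ : edge n => wv) c <=
  weight (fun _ : edge n => wv) (insert v w c).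
Proof.
move=> [w0 sw] r.
have w1 J : 0 <= wv J <= 1.
  by rewrite w0 -sw (bigD1 J) //= lerDl; apply: sumr_ge0.
have powle J (x y : nat) : (x <= y)%N -> wv J ^+ y <= wv J ^+ x.
  by move=> xy; have /andP[? ?] := w1 J; apply: ler_wiXn2l.
rewrite /weight (bigID (hanging v w)) /= [X in _ * (_ * X) <= _](bigID (chain v)) /=.
rewrite [leRHS](bigID (hanging v w)) /= [X in _ <= _ * X](bigID (chain v)) /=.
set P3 := \prod_(e | ~~ hanging v w e && ~~ chain v e) wv (c e).
have -> : \prod_(e | ~~ hanging v w e && ~~ chain v e) wv (insert v w c e) = P3.
  by apply: eq_bigr => e /andP[/negPf h /negPf h']; rewrite ffunE h h'.
have P30 : 0 <= P3 by apply: prodr_ge0 => e _; have /andP[] := w1 (c e).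
have le1 (Q : pred (edge n)) : 0 <= \prod_(e | Q e) wv (c e) <= 1.
  rewrite prodr_ge0 => [|e _]; last by have /andP[] := w1 (c e).
  by apply: prodr_ile1 => e _; exact: w1.
have h1 : wv [set i0]%SET ^+ m.+1 <= \prod_(e | hanging v w e) wv (insert v w c e).
  rewrite (eq_bigr (fun=> wv [set i0]%SET)); last by move=> e h; rewrite ffunE h.
  rewrite prodr_const; apply: powle; apply: leq_trans (card_hanging v w).
  by apply: subset_leq_card; apply/fintype.subsetP => e; rewrite inE.
have h2 : wv [set i1]%SET ^+ m <= \prod_(e | ~~ hanging v w e && chain v e) wv (insert v w c e).
  rewrite (eq_bigr (fun=> wv [set i1]%SET)); last by move=> e /andP[/negPf h h']; rewrite ffunE h h'.
  rewrite prodr_const; apply: powle; apply: leq_trans (card_chain v).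
  by apply: subset_leq_card; apply/fintype.subsetP => e; rewrite inE unfold_in => /andP[].
rewrite !mulrA; apply: ler_wpM2r => //.
have /andP[a0 a1] := le1 (hanging v w).
have /andP[b0 b1] := le1 (fun e => ~~ hanging v w e && chain v e).
have x0 : 0 <= wv [set i0]%SET ^+ m.+1 * wv [set i1]%SET ^+ m by rewrite mulr_ge0 ?exprn_ge0.
apply: (@le_trans _ _ (wv [set i0]%SET ^+ m.+1 * wv [set i1]%SET ^+ m)).
  rewrite -mulrA -[leRHS]mulr1; apply: ler_wpM2l => //.
  by rewrite mulr_ile1.
by apply: ler_pM; rewrite ?exprn_ge0.
Qed.

(** Double counting of the pairs (configuration, insertion) by the weight of the
    configuration before and after. *)
Lemma insertion_bound (wv : {set 'I_k} -> R) : is_law1 wv ->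
  wv [set i0]%SET ^+ m.+1 * wv [set i1]%SET ^+ m *
    pexp (fun _ : edge n => wv) (fun c =>
      #|[set p : {ffun 'I_m.+1 -> 'I_n} * {ffun 'I_m.+1 -> 'I_n} | ready c p.1 p.2]%SET|%:R) <=
  (m.+1 ^ m.+1)%:R * pexp (fun _ : edge n => wv) (fun c => class_count c m.+1).
Proof.
move=> lw; have lw' : is_law (fun _ : edge n => wv) by [].
pose T := ({ffun 'I_m.+1 -> 'I_n} * {ffun 'I_m.+1 -> 'I_n})%type.
apply: (@le_trans _ _ (pexp (fun _ : edge n => wv) (fun c => \sum_(p : T) (reached c p)%:R))); last first.
  rewrite -pexpZ; apply: ler_pexp => // c; rewrite /class_count -!natr_sum -natrM ler_nat.
  have card_sum (X : finType) (Q : pred X) : (\sum_x (Q x : nat))%N = #|[set x | Q x]%SET|.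
    by rewrite -sum1_card [RHS]big_mkcond; apply: eq_bigr => x _; rewrite inE; case: (Q x).
  by rewrite !card_sum; exact: card_insertions.
rewrite -pexpZ pexp_sum.
rewrite (@eq_pexp _ _ _ _ _ (fun c => \sum_(p : T) wv [set i0]%SET ^+ m.+1 * wv [set i1]%SET ^+ m *
    (ready c p.1 p.2)%:R)); last first.
  move=> c; rewrite -mulr_sumr; congr (_ * _); rewrite -sum1_card natr_sum [LHS]big_mkcond.
  by apply: eq_bigr => p _; rewrite inE; case: (ready _ _ _).
rewrite pexp_sum; apply: ler_sum => -[v w] _ /=; rewrite pexpZ.
rewrite [pexp _ (fun c => (ready c v w)%:R)]/pexp mulr_sumr.
apply: (@le_trans _ _ (\sum_(c | ready c v w) weight (fun _ : edge n => wv) (insert v w c))).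
  rewrite [leRHS]big_mkcond; apply: ler_sum => c _; case: ifPn => [r|_]; last by rewrite !mulr0.
  by rewrite mulr1; exact: weight_insert.
rewrite -(big_imset (fun c => weight (fun _ : edge n => wv) c) (h := insert v w) (A := mem [pred c | ready c v w])) /=; last first.
  by move=> c c' r r'; exact: insert_inj r r'.
rewrite /pexp big_mkcond; apply: ler_sum => c _; case: ifPn => [/imsetP[c0 r E]|_].
  have -> : reached c (v, w) by apply/existsP; exists c0; rewrite /= E eqxx andbT.
  by rewrite mulr1.
by rewrite mulr_ge0 // weight_ge0.
Qed.

End Insertion.

Section Positivity.
Context {R : realType} (k : nat).
Local Open Scope classical_set_scope.
Variable lambda : 'I_k -> R.
Hypothesis lambda_gt0 : forall i, 0 < lambda i.

Notation Ec n f := (pexp (fun _ : edge n => edge_law lambda n) f).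
Let lambda_ge0 i : 0 <= lambda i := ltW (lambda_gt0 i).
Let law n : is_law (fun _ : edge n => edge_law lambda n) := @edge_law_law R k lambda lambda_ge0 n.
Let lw n : is_law1 (edge_law lambda n). Proof. by case: (edge_law_sparse lambda_ge0) => H _; exact: H. Qed.

(** An exploration of radius zero: the range of [sigma] is the vertex alone. *)
Lemma pexp_isolated n (u : 'I_n) :
  Ec n (fun c => (isolated c u)%:R) = edge_law lambda n finset.set0 ^+ (1 * (n - 1)).
Proof.
pose sigma := fun _ : 'I_1 => u.
have inj : injective sigma by move=> x y _; rewrite !ord1.
have no_edge (e : edge 1) : False.
  by have [x [y [xy _]]] := edgeP e; move: xy; rewrite !ord1 eqxx.
pose H : {ffun edge 1 -> {set 'I_k}} := [ffun=> finset.set0].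
have := pexp_cylinder finset.set0 [set: 'I_1]%SET H (lw n) inj.
rewrite finset.cardsT card_ord big1 ?mul1r => [<-|e]; last by case: (no_edge e).
apply: eq_pexp => c; congr (nat_of_bool _)%:R.
have -> : pull finset.set0 sigma c == H by apply/eqP/ffunP => e; case: (no_edge e).
rewrite andTb; apply/forallP/forall_inP => [iso x _|iso v].
  by apply/forallP => y; rewrite iso implybT.
case: (eqVneq u v) => [<-|uv]; first by rewrite mark_diag.
have /forallP/(_ v) := iso ord0 (finset.in_setT _).
by move/implyP; apply; apply/imsetP => -[x _ E]; move: uv; rewrite E eqxx.
Qed.

Lemma isolated_mean_cvg : exists2 rho : R, 0 < rho &
  (fun n => Ec n (fun c => (isolated_count c)%:R / n%:R)) @ \oo --> rho.
Proof.
exists (expR (- (1%:R * \sum_(J | J != finset.set0) color_rate lambda J))); first exact: expR_gt0.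
apply: cvg_near_eq (@w0_powB_cvg _ _ _ _ _ (edge_law_sparse lambda_ge0) 1 1); near=> n.
have n0 : (n%:R : R) != 0 by rewrite pnatr_eq0 -lt0n; near: n; exact: nbhs_infty_gt.
rewrite (@eq_pexp _ _ _ _ _ (fun c => n%:R^-1 * \sum_u (isolated c u)%:R)); last first.
  move=> c; rewrite mulrC /isolated_count -sum1_card natr_sum [X in _ * X]big_mkcond.
  by congr (_ * _); apply: eq_bigr => u _; rewrite inE; case: (isolated c u).
rewrite pexpZ pexp_sum (eq_bigr _ (fun u _ => pexp_isolated u)) sumr_const card_ord.
by rewrite -[X in _ * X = _]mulr_natl mulKf.
Unshelve. all: by end_near. Qed.

(** Each vertex is connected to at most [giant_size] vertices, and there are order
    [n ^ 2] connected pairs. *)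
Lemma giant_size_mean i : 1 < \sum_(j < k) lambda j - lambda i ->
  exists2 delta : R, 0 < delta &
    \forall n \near \oo, delta <= Ec n (fun c => (giant_size i c)%:R / n%:R).
Proof.
move=> rate; have [delta d0 Hd] := giant_pairs (fun n => without_prob01 lambda_ge0 n i)
  (@without_prob_cvg R k lambda lambda_ge0 i) rate.
exists delta => //; near=> n.
have n0 : 0 < n%:R :> R by rewrite ltr0n; near: n; exact: nbhs_infty_gt.
have n2 : 0 < n%:R ^+ 2 :> R by rewrite exprn_gt0.
have hd : delta * n%:R ^+ 2 <= pexp (fun _ : edge n => bern (without_prob lambda n i))
    (fun c => \sum_u \sum_v (v \in gcomp (orel false (predC1 false) c) u)%:R) by near: n; exact: Hd.
rewrite -(ler_pM2r n2); apply: le_trans hd _.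
rewrite -(pexp_without lambda_ge0) mulrC -pexpZ; apply: ler_pexp => // c.
rewrite expr2 -mulrA [X in _ * X]mulrC divfK ?gt_eqF //.
rewrite mulr_natl -[n in _ *+ n]card_ord -sumr_const.
apply: ler_sum => u _; rewrite (eq_gcomp (orel_forget c (other_color0 i))).
apply: (@le_trans _ _ #|gcomp (crel i c) u|%:R).
  rewrite -sum1_card natr_sum [leRHS]big_mkcond; apply: ler_sum => v _.
  by rewrite /crel; case: (v \in _).
rewrite ler_nat; exact: (leq_bigmax u).
Unshelve. all: by end_near. Qed.

Variables (m : nat) (i0 i1 : 'I_k).
Hypothesis i01 : i0 != i1.

(** The left factor is positive only if both counts are at least half their
    typical size: otherwise the subtracted terms exceed the proportion
    [giant_size / n], which is at most one. *)
Lemma ready_density n (c : {ffun edge n -> {set 'I_k}}) (rho delta : R) :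
  0 < rho -> 0 < delta -> 1 < delta / 2 * n%:R -> m%:R <= rho / 4 * n%:R ->
  (rho / 4) ^+ m.+1 * (delta / 2) ^+ m.+1 *
    ((giant_size i1 c)%:R / n%:R - delta / 2 -
     4 / rho ^+ 2 * ((isolated_count c)%:R / n%:R - rho) ^+ 2) * (n%:R * n%:R) ^+ m.+1 <=
  #|[set p : {ffun 'I_m.+1 -> 'I_n} * {ffun 'I_m.+1 -> 'I_n} | ready i1 c p.1 p.2]%SET|%:R.
Proof.
move=> r0 d0 n1 nm.
have n0 : 0 < n%:R :> R.
  by rewrite lt_neqAle ler0n andbT; apply/negP => /eqP E; move: n1; rewrite -E mulr0 ltr10.
set g := (giant_size i1 c)%:R / n%:R; set x := (isolated_count c)%:R / n%:R.
have A0 : 0 <= (rho / 4) ^+ m.+1 * (delta / 2) ^+ m.+1 * (n%:R * n%:R) ^+ m.+1.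
  by rewrite !mulr_ge0 ?exprn_ge0 ?divr_ge0 ?mulr_ge0 ?ltW.
have rr : 0 <= 4 / rho ^+ 2 * (x - rho) ^+ 2.
  by rewrite mulr_ge0 ?sqr_ge0 // divr_ge0 ?sqr_ge0.
have neg z : z <= 0 ->
    (rho / 4) ^+ m.+1 * (delta / 2) ^+ m.+1 * z * (n%:R * n%:R) ^+ m.+1 <= #|[set p : {ffun 'I_m.+1 -> 'I_n} * {ffun 'I_m.+1 -> 'I_n} | ready i1 c p.1 p.2]%SET|%:R.
  move=> z0; apply: (@le_trans _ _ 0); last exact: ler0n.
  by rewrite mulrAC mulr_ge0_le0.
case: (ltP g (delta / 2)) => [gd|gd]; first by apply: neg; lra.
case: (ltP x (rho / 2)) => [xr|xr].
  have g1 : g <= 1.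
    rewrite /g ler_pdivrMr // mul1r ler_nat; apply/bigmax_leqP => u _.
    by rewrite -[X in (_ <= X)%N]card_ord; exact: max_card.
  apply: neg; suff : 1 <= 4 / rho ^+ 2 * (x - rho) ^+ 2 by lra.
  rewrite mulrAC ler_pdivlMr ?exprn_gt0 // mul1r; nra.
have giant1 : (1 < giant_size i1 c)%N.
  rewrite -(ltr_nat R); apply: lt_le_trans n1 _.
  by rewrite -ler_pdivlMr.
apply: le_trans (_ : ((isolated_count c - m) ^ m.+1 * giant_size i1 c ^ m.+1)%:R <= _); last first.
  by rewrite ler_nat; exact: card_ready.
apply: (@le_trans _ _ ((rho / 4) ^+ m.+1 * (delta / 2) ^+ m.+1 * (n%:R * n%:R) ^+ m.+1)).
  rewrite mulrAC; apply: ler_piMr => //.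
  suff : g <= 1 by lra.
  rewrite /g ler_pdivrMr // mul1r ler_nat; apply/bigmax_leqP => u _.
  by rewrite -[X in (_ <= X)%N]card_ord; exact: max_card.
rewrite [(_ * n%:R) ^+ _]exprMn mulrACA -[X in X * _ <= _]exprMn -[X in _ * X <= _]exprMn natrM !natrX; apply: ler_pM; rewrite ?exprn_ge0 ?mulr_ge0 ?divr_ge0 ?(ltW r0) ?(ltW d0) //.
  apply: lerXn2r; rewrite ?nnegrE ?mulr_ge0 ?divr_ge0 ?(ltW r0) //.
  have xn : rho / 2 * n%:R <= (isolated_count c)%:R by rewrite -ler_pdivlMr.
  rewrite natrB; first by lra.
  by rewrite -(ler_nat R); apply: le_trans nm _; apply: le_trans xn; rewrite ler_pM2r //; lra.
by apply: lerXn2r; rewrite ?nnegrE ?mulr_ge0 ?divr_ge0 ?(ltW d0) // -ler_pdivlMr.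
Qed.

(** With probability bounded below, both the isolated vertices and a component
    in the colors other than [i1] are of linear size, so that the number of
    possible insertions is of order [n ^ (2 * m + 2)]; each costs a factor of
    order [n ^- (2 * m + 1)]. *)
Lemma density_gt0 (nu : R) : 1 < \sum_(j < k) lambda j - lambda i1 ->
  mean_cvg lambda (fun n c => class_count c m.+1 / n%:R : R) nu -> 0 < nu.
Proof.
move=> rate Hnu.
have [rho r0 Hrho] := isolated_mean_cvg.
have [delta d0 Hdelta] := giant_size_mean rate.
have Hx : (fun n => Ec n (fun c => ((isolated_count c)%:R / n%:R - rho) ^+ 2)) @ \oo --> (0 : R).
  have E n (c : {ffun edge n -> {set 'I_k}}) : (isolated_count c)%:R = \sum_u (isolated c u)%:R :> R.
    rewrite /isolated_count -sum1_card natr_sum [LHS]big_mkcond.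
    by apply: eq_bigr => u _; rewrite inE; case: (isolated c u).
  apply: (@concentration R k lambda lambda_ge0 (fun n c => (isolated_count c)%:R) 2%:R rho) => //.
  by move=> n; rewrite (_ : (fun c => _) = fun c => \sum_u (isolated c u)%:R); [exact: bounded_influence_isolated|apply/funext => c; exact: E].
(* [A] comes from the choices of the path and of its anchors, [B] from the
   probabilities of the inserted edges, [N] from the multiplicity of the
   insertions leading to one configuration. *)
pose A := (rho / 4) ^+ m.+1 * (delta / 2) ^+ m.+1.
have A0 : 0 < A by rewrite mulr_gt0 ?exprn_gt0 ?divr_gt0.
pose B := (lambda i0 / 2) ^+ m.+1 * (lambda i1 / 2) ^+ m.
have B0 : 0 < B by rewrite mulr_gt0 ?exprn_gt0 ?divr_gt0.
pose N := (m.+1 ^ m.+1)%:R : R.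
have N0 : 0 < N by rewrite ltr0n expn_gt0.
pose q := B * (A * (delta / 4)) / N.
have d4 : 0 < delta / 4 by rewrite divr_gt0.
have q0 : 0 < q := divr_gt0 (mulr_gt0 B0 (mulr_gt0 A0 d4)) N0.
apply: lt_le_trans q0 _; apply/ler_addgt0Pl => eps e0.
have Lim : (fun n => 4 / rho ^+ 2 * Ec n (fun c => ((isolated_count c)%:R / n%:R - rho) ^+ 2)) @ \oo --> 4 / rho ^+ 2 * 0.
  by apply: cvgM => //; exact: cvg_cst.
have rate1 (j : 'I_k) : (fun n => n%:R * edge_law lambda n [set j]%SET) @ \oo --> lambda j.
  have [_ /(_ [set j]%SET)] := edge_law_sparse lambda_ge0.
  rewrite /color_rate (bigD1 j) //= eqxx mul1r big1 ?addr0; last first.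
    by move=> j' jj'; rewrite (inj_eq finset.set1_inj) eq_sym (negPf jj') mul0r.
  by apply; apply/eqP => /setP/(_ j); rewrite !inE eqxx.
have half (j : 'I_k) : lambda j / 2 < lambda j by rewrite ltr_pdivrMr // ltr_pMr // ltr1n.
have small : 4 / rho ^+ 2 * 0 < delta / 4 by rewrite mulr0 divr_gt0.
near \oo => n.
have n0 : 0 < n%:R :> R by rewrite ltr0n; near: n; exact: nbhs_infty_gt.
have n1 : 1 < delta / 2 * n%:R.
  by rewrite -ltr_pdivrMl ?divr_gt0 //; near: n; exact: nbhs_infty_gtr.
have nm : m%:R <= rho / 4 * n%:R.
  by rewrite -ler_pdivrMl ?divr_gt0 //; near: n; exact: nbhs_infty_ger.
have hg : delta <= Ec n (fun c => (giant_size i1 c)%:R / n%:R) by near: n; exact: Hdelta.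
have hx : 4 / rho ^+ 2 * Ec n (fun c => ((isolated_count c)%:R / n%:R - rho) ^+ 2) <= delta / 4.
  by near: n; exact: (cvgr_le _ Lim _ small).
have h0 : lambda i0 / 2 <= n%:R * edge_law lambda n [set i0]%SET.
  by near: n; exact: (cvgr_ge _ (rate1 i0) _ (half i0)).
have h1 : lambda i1 / 2 <= n%:R * edge_law lambda n [set i1]%SET.
  by near: n; exact: (cvgr_ge _ (rate1 i1) _ (half i1)).
have hnu : Ec n (fun c => `|class_count c m.+1 / n%:R - nu|) <= eps.
  by near: n; exact: (cvgr_le _ Hnu _ e0).
have ready_mean : A * (delta / 4) * (n%:R * n%:R) ^+ m.+1 <= Ec n (fun c =>
    #|[set p : {ffun 'I_m.+1 -> 'I_n} * {ffun 'I_m.+1 -> 'I_n} | ready i1 c p.1 p.2]%SET|%:R).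
  apply: (@le_trans _ _ (Ec n (fun c => A * ((giant_size i1 c)%:R / n%:R - delta / 2 -
     4 / rho ^+ 2 * ((isolated_count c)%:R / n%:R - rho) ^+ 2) * (n%:R * n%:R) ^+ m.+1))); last first.
    by apply: ler_pexp => // c; exact: ready_density.
  rewrite (@eq_pexp _ _ _ _ _ (fun c => A * (n%:R * n%:R) ^+ m.+1 * ((giant_size i1 c)%:R / n%:R - delta / 2 -
     4 / rho ^+ 2 * ((isolated_count c)%:R / n%:R - rho) ^+ 2))); last by move=> c; rewrite mulrAC.
  rewrite pexpZ mulrAC; apply: ler_wpM2l; first by apply: mulr_ge0; [exact: ltW|rewrite exprn_ge0 ?mulr_ge0].
  rewrite !pexpB (pexp_cst _ (@law n)) pexpZ.
  move: hg hx; set z1 := Ec n _; set z2 := _ * Ec n _; lra.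
have bound := @insertion_bound k n m i0 i1 i01 R _ (lw n).
have [w0 _] := lw n.
have class_mean : q <= Ec n (fun c => class_count c m.+1 / n%:R).
  rewrite (@eq_pexp _ _ _ _ _ (fun c => n%:R^-1 * class_count c m.+1)) ?pexpZ; last by move=> c; rewrite mulrC.
  rewrite mulrC ler_pdivlMr // /q mulrAC ler_pdivrMr // [leRHS]mulrC.
  apply: le_trans bound; set W0 := edge_law _ _ _ in h0 *; set W1 := edge_law _ _ _ in h1 *.
  apply: (@le_trans _ _ (W0 ^+ m.+1 * W1 ^+ m * (A * (delta / 4) * (n%:R * n%:R) ^+ m.+1))); last first.
    by apply: ler_wpM2l => //; rewrite mulr_ge0 ?exprn_ge0 // w0.
  have -> : W0 ^+ m.+1 * W1 ^+ m * (A * (delta / 4) * (n%:R * n%:R) ^+ m.+1) =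
      (n%:R * W0) ^+ m.+1 * (n%:R * W1) ^+ m * (A * (delta / 4)) * n%:R.
    move: (n%:R : R) W0 W1 {h0 h1} => x W0 W1; rewrite !exprMn !exprS.
    by move: (x ^+ m) (W0 ^+ m) (W1 ^+ m) => x' W0' W1'; ring.
  apply: ler_wpM2r => //; apply: ler_wpM2r; first by rewrite mulr_ge0 ?divr_ge0 ?ltW.
  apply: ler_pM; rewrite ?exprn_ge0 ?divr_ge0 //; apply: lerXn2r => //;
    by rewrite nnegrE ?divr_ge0 ?mulr_ge0 ?w0.
apply: le_trans class_mean _.
apply: le_trans (_ : Ec n (fun c => `|class_count c m.+1 / n%:R - nu|) + nu <= _); last by rewrite lerD2r.
rewrite -[X in _ + X](pexp_cst _ (@law n)) -pexpD; apply: ler_pexp => // c.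
by rewrite -lerBlDr ler_norm.
Unshelve. all: by end_near. Qed.

End Positivity.

(** * Colored random graphs as independent marks on the edges *)

Section Configuration.
Context (n k : nat).
Implicit Types (g : 'I_k -> sgraph n) (c : {ffun edge n -> {set 'I_k}}).

Definition conf g : {ffun edge n -> {set 'I_k}} := [ffun e => [set j | e \in g j]%SET].

Definition layer c (j : 'I_k) : sgraph n := [set e | j \in c e]%SET.

Lemma conf_layer c : conf (layer c) = c.
Proof. by apply/ffunP => e; rewrite ffunE; apply/setP => j; rewrite !inE. Qed.

Lemma conf_eq g c : (forall j, g j = layer c j) <-> conf g = c.
Proof.
split=> [gc|<- j].
  by rewrite -[RHS]conf_layer; apply/ffunP => e; rewrite !ffunE; apply/setP => j; rewrite !inE gc inE.
by apply/setP => e; rewrite !inE ffunE inE.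
Qed.

Lemma adj_conf g i : adj (without_color g i) =2 crel i (conf g).
Proof.
move=> u v; rewrite /crel /orel; case: (eqVneq u v) => [<-|uv].
  rewrite mark_diag (negPf (other_color0 i)); apply/negbTE/existsP => -[e /andP[_ /eqP E]].
  by have := valP e; rewrite /= E finset.setUid finset.cards1.
rewrite (mark_edge _ _ uv) ffunE; apply/existsP/subsetPn => [[e /andP[/finset.bigcupP[j ji ej] /eqP E]]|[j]].
  exists j; rewrite ?finset.in_set1 // inE (_ : edge_of uv = e) //; exact: val_inj.
rewrite inE => ej; rewrite finset.in_set1 => ji; exists (edge_of uv); rewrite eqxx andbT.
by apply/finset.bigcupP; exists j.
Qed.

Lemma ca_component_conf g u : ca_component g u = avoiding_class (conf g) u.
Proof.
apply/setP => v; rewrite in_avoiding inE; apply: eq_forallb => i.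
by rewrite inE; apply: eq_connect; exact: adj_conf.
Qed.

Lemma num_vertices_conf (R : realType) g l :
  (num_vertices_ca g l)%:R = class_count (conf g) l :> R.
Proof.
rewrite /num_vertices_ca /class_count -sum1_card natr_sum [LHS]big_mkcond.
by apply: eq_bigr => u _; rewrite inE ca_component_conf; case: (_ == _).
Qed.

Lemma max_ca_conf g : max_ca_component g = max_class (conf g).
Proof. by apply: eq_bigr => u _; rewrite ca_component_conf. Qed.

Lemma ca_component_eq g u v : (v \in ca_component g u) = (ca_component g v == ca_component g u).
Proof.
rewrite !ca_component_conf; apply/idP/eqP => [|<-]; last first.
  by rewrite in_avoiding; apply/forallP => i; exact: gcomp_center.
rewrite in_avoiding => /forallP vC; apply/setP => x; rewrite !in_avoiding.
by apply: eq_forallb => i; rewrite (gcomp_same (crel_sym i _) (vC i)).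
Qed.

(** The classes of size [l] partition the vertices counted. *)
Lemma num_vertices_components g l : num_vertices_ca g l = (l * num_ca_components g l)%N.
Proof.
rewrite /num_vertices_ca /num_ca_components -sum1_card.
rewrite (partition_big (ca_component g) (mem [set C in ca_components g | #|C| == l]%SET)) /=; last first.
  by move=> u; rewrite !inE imset_f.
rewrite mulnC -sum_nat_const; apply: eq_bigr => C; rewrite inE => /andP[/imsetP[u _ ->{C}] /eqP ul].
rewrite -[RHS]ul -sum1_card; apply: eq_bigl => v; rewrite ca_component_eq inE.
by case: (eqVneq (ca_component g v) _) => [->|_]; rewrite ?andbF // ul eqxx.
Qed.

End Configuration.

Section Probability.
Context {R : realType} (d : measure_display) (T : measurableType d) (P : probability T R).
Local Open Scope classical_set_scope.

Lemma prob_finite_image (F : finType) (X : T -> F) (Q : pred F) :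
  (forall c, measurable [set w | X w = c]) ->
  P [set w | Q (X w)] = (\sum_(c | Q c) P [set w | X w = c])%E.
Proof.
move=> mX; suff H (s : seq F) : uniq s -> measurable [set w | X w \in s] /\
    P [set w | X w \in s] = (\sum_(c <- s) P [set w | X w = c])%E.
  have [_ E] := H _ (enum_uniq Q); rewrite big_enum in E; rewrite -E; congr (P _).
  by apply/seteqP; split=> w /=; rewrite mem_enum.
elim: s => [_|c s IH /= /andP[cs us]].
  by rewrite big_nil (_ : [set w | _] = classical_sets.set0) ?measure0 //; apply/seteqP; split.
have [ms Es] := IH us.
have E : [set w | X w \in c :: s] = [set w | X w = c] `|` [set w | X w \in s].
  apply/seteqP; split=> w /=; rewrite inE.
    by case/orP => [/eqP|]; [left|right].
  by case=> [->|->]; rewrite ?eqxx ?orbT.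
rewrite E big_cons -Es; split; first exact: measurableU.
rewrite measureU //; apply/seteqP; split=> w //= [Xc]; rewrite Xc => cs'.
by rewrite cs' in cs.
Qed.

Variables (n k : nat) (lambda : 'I_k -> R) (G : 'I_k -> T -> sgraph n).
Hypothesis lambda_ge0 : forall i, 0 <= lambda i.
Hypothesis hG : is_colored_random_graph P lambda G.

Lemma gnp_weight (c : {ffun edge n -> {set 'I_k}}) :
  \prod_i gnp_pmf (prob_of (lambda i) n) (layer c i) =
  weight (fun _ : edge n => edge_law lambda n) c.
Proof.
rewrite /gnp_pmf exchange_big /=; apply: eq_bigr => e _; apply: eq_bigr => j _.
by rewrite inE.
Qed.

Lemma measurable_conf c : measurable [set w | conf (G ^~ w) = c].
Proof.
have [gnp _] := hG.
suff H (s : seq 'I_k) : measurable [set w | forall i, i \in s -> G i w = layer c i].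
  rewrite (_ : mkset _ = [set w | forall i, i \in enum 'I_k -> G i w = layer c i]) //.
  apply/seteqP; split=> w /=; first by move/conf_eq => + i _; apply.
  by move=> Gw; apply/conf_eq => j; apply: Gw; rewrite mem_enum.
elim: s => [|i s IH]; first by rewrite (_ : mkset _ = setT) //; apply/seteqP; split.
rewrite (_ : mkset _ = [set w | G i w = layer c i] `&` [set w | forall i, i \in s -> G i w = layer c i]).
  by apply: measurableI => //; case: (gnp i (layer c i)).
apply/seteqP; split=> w /=.
  by move=> Gw; split=> [|j js]; apply: Gw; rewrite inE ?eqxx // js orbT.
by move=> [Gi Gs] j; rewrite inE => /orP[/eqP ->|/Gs].
Qed.

(** The only use of the probability spaces: independence and the laws of the
    graphs give every configuration its weight. *)
Lemma prob_conf (Q : pred {ffun edge n -> {set 'I_k}}) :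
  P [set w | Q (conf (G ^~ w))] = (pexp (fun _ : edge n => edge_law lambda n) (fun c => (Q c)%:R))%:E.
Proof.
have [gnp indep] := hG.
rewrite prob_finite_image; last exact: measurable_conf.
rewrite /pexp big_mkcond -sumEFin; apply: eq_bigr => c _; case: (Q c); rewrite ?mulr0 // mulr1.
rewrite -gnp_weight -prodEFin -(_ : [set w | forall i, G i w = layer c i] = [set w | conf (G ^~ w) = c]).
  by rewrite indep; apply: eq_bigr => i _; case: (gnp i (layer c i)).
by apply/seteqP; split=> w /=; move/conf_eq.
Qed.

End Probability.

Lemma eq_cvg_in_probability (R : realType) (d : nat -> measure_display)
    (T : forall n, measurableType (d n)) (P : forall n, probability (T n) R)
    (X Y : forall n, T n -> R) (l : R) : (forall n w, X n w = Y n w) ->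
  cvg_in_probability P X l -> cvg_in_probability P Y l.
Proof.
move=> XY H eps e0; have := H eps e0.
have -> // : (fun n => P n [set w | eps < `|X n w - l|]%classic) =
  (fun n => P n [set w | eps < `|Y n w - l|]%classic).
by apply/funext => n; congr (P n _); apply/seteqP; split=> w /=; rewrite XY.
Qed.

Section Transfer.
Context {R : realType} (k : nat) (lambda : 'I_k -> R).
Variables (d : nat -> measure_display) (T : forall n, measurableType (d n))
  (P : forall n, probability (T n) R) (G : forall n, 'I_k -> T n -> sgraph n).
Hypothesis lambda_ge0 : forall i, 0 <= lambda i.
Hypothesis hG : forall n, is_colored_random_graph (P n) lambda (@G n).
Local Open Scope classical_set_scope.

Notation Ec n f := (pexp (fun _ : edge n => edge_law lambda n) f).
Let law n : is_law (fun _ : edge n => edge_law lambda n) := @edge_law_law R k lambda lambda_ge0 n.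

Variables (X : forall n, {ffun edge n -> {set 'I_k}} -> R) (l : R).

Let tail (eps : R) n := Ec n (fun c => (eps < `|X c - l|)%R%:R).

Let tail_cvg (eps : R) : (fun n => P n [set w | eps < `|X (conf (@G n ^~ w)) - l|]) @ \oo --> 0%E <->
  tail eps @ \oo --> (0 : R).
Proof.
have -> : (fun n => P n [set w | eps < `|X (conf (@G n ^~ w)) - l|]) = (fun n => (tail eps n)%:E).
  apply/funext => n; exact: (prob_conf (hG n) (fun c => eps < `|X c - l|)).
split; first by move/fine_cvgP => [].
by move=> H; apply: cvg_EFin => //; near=> n.
Unshelve. all: by end_near. Qed.

(** Markov's inequality. *)
Lemma cvg_in_probability_of_mean : mean_cvg lambda X l ->
  cvg_in_probability P (fun n w => X (conf (@G n ^~ w))) l.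
Proof.
move=> HX eps e0; apply/tail_cvg.
have lim : (fun n => Ec n (fun c => `|X c - l|) / eps) @ \oo --> (0 : R) / eps.
  by apply: cvgM => //; exact: cvg_cst.
rewrite mul0r in lim; apply: squeeze_cvgr (cvg_cst 0) lim; near=> n.
rewrite pexp_ge0 //= mulrC -pexpZ; apply: ler_pexp => // c.
case: ltP => h; last by rewrite mulr_ge0 // invr_ge0 ltW.
by rewrite mulrC ler_pdivlMr // mul1r ltW.
Unshelve. all: by end_near. Qed.

(** Bounded variables that converge in probability converge in mean. *)
Lemma mean_of_cvg_in_probability : (forall n c, `|@X n c - l| <= 1) ->
  cvg_in_probability P (fun n w => X (conf (@G n ^~ w))) l -> mean_cvg lambda X l.
Proof.
move=> X1 HX; apply/cvgrPdist_le => eps e0.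
have e2 : 0 < eps / 2 by rewrite divr_gt0.
have /tail_cvg lim := HX _ e2.
near=> n.
have h : tail (eps / 2) n <= eps / 2 by near: n; exact: (cvgr_le _ lim _ e2).
rewrite sub0r normrN ger0_norm ?pexp_ge0 //.
apply: (@le_trans _ _ (eps / 2 + tail (eps / 2) n)); last by rewrite [leRHS]splitr lerD2l.
rewrite -[X in X + _](pexp_cst _ (@law n)) -pexpD; apply: ler_pexp => // c.
case: ltP => h'; last by rewrite addr0.
by apply: le_trans (X1 n c) _; rewrite lerDr ltW.
Unshelve. all: by end_near. Qed.

End Transfer.

(** * Densities of the classes in the random graphs *)

Theorem proposition1p2 (R : realType) (k : nat) (hk : (2 <= k)%N)
    (lambda : 'I_k -> R)
    (lambda_noninc : forall i j : 'I_k, (i <= j)%N -> lambda j <= lambda i)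
    (lambda_gt0 : forall i, 0 < lambda i)
    (d : nat -> measure_display) (T : forall n, measurableType (d n))
    (P : forall n, probability (T n) R)
    (G : forall n, 'I_k -> T n -> sgraph n)
    (hG : forall n, is_colored_random_graph (P n) lambda (G n))
    (a1 : R) (a1_ge0 : 0 <= a1) (a1_lt1 : a1 < 1)
    (ha1 : cvg_in_probability P
      (fun n w => (max_ca_component (fun i => G n i w))%:R / n%:R) a1) :
  exists nu : nat -> R,
    [/\ forall l, (1 <= l)%N -> 0 <= nu l,
        ((fun m => \sum_(1 <= l < m.+1) nu l) @ \oo --> 1 - a1)%classic,
        forall l, (1 <= l)%N ->
          (forall n (w : T n),
             (num_vertices_ca (fun i => G n i w) l)%:R / n%:R =
             (l * num_ca_components (fun i => G n i w) l)%:R / n%:R :> R) /\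
          cvg_in_probability P
            (fun n w => (num_vertices_ca (fun i => G n i w) l)%:R / n%:R)
            (nu l),
        (forall l, (1 <= l)%N -> 0 < nu l) <->
          1 < lambda_star lambda (last_color hk) &
        lambda_star lambda (last_color hk) <= 1 -> nu 1%N = 1].
Proof.
have lambda_ge0 i : 0 <= lambda i by exact: ltW.
have rate_gt0 i : 0 < \sum_(j < k) lambda j - lambda i.
  have [j ji] : exists j : 'I_k, j != i.
    apply/existsP; apply: contraLR hk => /existsPn H; rewrite -ltnNge ltnS -[k]card_ord -(finset.cards1 i).
    by apply: subset_leq_card; apply/fintype.subsetP => x _; rewrite finset.in_set1; apply/negPn/H.
  rewrite (bigD1 i) //= [X in X - _]addrC addrK (bigD1 j) //=.
  by apply: ltr_wpDr => //; apply: sumr_ge0.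
have [nu Hnu] := choice (class_density_cvg lambda_ge0 rate_gt0).
have nu0 l : 0 <= nu l by case: (Hnu l).
have nu_cvg l := (Hnu l).2.
have mean_max : mean_cvg lambda (fun n c => (max_class c)%:R / n%:R : R) a1.
  apply: (mean_of_cvg_in_probability lambda_ge0 hG) => [n c|].
    have m1 : 0 <= ((max_class c)%:R / n%:R : R) <= 1.
      case: (posnP n) => [n0|n0].
        have -> : n%:R^-1 = 0 :> R by rewrite n0 invr0.
        by rewrite mulr0 lexx ler01.
      rewrite divr_ge0 //= ler_pdivrMr ?ltr0n // mul1r ler_nat; apply/bigmax_leqP => u _.
      by rewrite -[X in (_ <= X)%N]card_ord; exact: max_card.
    by rewrite ler_norml; case/andP: m1 => m0 m1; apply/andP; split; lra.
  by apply: eq_cvg_in_probability ha1 => n w; rewrite max_ca_conf.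
have sum_cvg := class_density_sum lambda_ge0 rate_gt0 a1_ge0 nu_cvg mean_max.
have critical : lambda_star lambda (last_color hk) <= 1 -> nu 1%N = 1.
  move=> le1; apply: (subcritical_density lambda_ge0 (last_color hk) _ (nu_cvg 1%N)) => i.
  rewrite ltW //=; apply: le_trans le1; rewrite lerD2l lerN2; apply: lambda_noninc => /=.
  by rewrite -ltnS prednK // (leq_trans _ hk).
exists nu; split => //.
- move=> l l0; split=> [n w|]; first by rewrite num_vertices_components.
  apply: eq_cvg_in_probability (cvg_in_probability_of_mean lambda_ge0 hG (nu_cvg l)) => n w.
  by rewrite num_vertices_conf.
- split=> [nu_gt0|gt1 [//|m] _].
    rewrite ltNge; apply/negP => /critical nu1.
    (* The densities sum to at most one, so that [nu 1 = 1] forces [nu 2 = 0]. *)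
    have nondec : nondecreasing_seq (fun m => \sum_(1 <= l < m.+1) nu l).
      by apply/nondecreasing_seqP => m; rewrite [leRHS]big_nat_recr //= lerDl.
    have := nondecreasing_cvgn_le nondec (cvgP _ sum_cvg) 2%N.
    rewrite (cvg_lim _ sum_cvg) // big_nat_recr //= big_nat1 nu1.
    have := nu_gt0 2%N isT; lra.
  have k0 : (0 < k)%N by exact: ltnW hk.
  apply: (@density_gt0 R k lambda lambda_gt0 m (Ordinal k0) (last_color hk) _ _ gt1 (nu_cvg _)).
  by rewrite -val_eqE /= eq_sym -lt0n -subn1 subn_gt0.
Qed.
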